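(* Assume that the elements of $\bm{x}\in\mathbb{R}^N$ are i.i.d. with a known distribution $p_X$ that has some finite mean and variance, that $\bm{A}\in\mathbb{R}^{M\times N}$ has i.i.d. entries with distribution $\mathcal{N}(0,1/N)$, and that $\bm{v}\in\mathbb{R}^M$ has i.i.d. entries with distribution $\mathcal{N}(0,\sigma_{\mathrm v}^2)$. Put $\bm{y}=\bm{A}\bm{x}+\bm{v}$, let $\gamma>0$, and consider the output of the proximity operator $$\hat{\bm{s}}=\operatorname{prox}_{\gamma L}(\bm{z})=\operatorname*{arg\,min}_{\bm{s}\in\mathbb{R}^N}\left\{\tfrac12\|\bm{y}-\bm{A}\bm{s}\|_2^2+\tfrac{1}{2\gamma}\|\bm{s}-\bm{z}\|_2^2\right\}=\left(\bm{A}^\top\bm{A}+\tfrac1\gamma\bm{I}\right)^{-1}\left(\bm{A}^\top\bm{y}+\tfrac1\gamma\bm{z}\right),$$ where $\bm{z}\in\mathbb{R}^N$ has i.i.d. elements with a distribution $p_Z$ and is assumed to be independent of $\bm{A}$. Assume that the optimization problem $$\min_{\alpha>0}\max_{\beta\ge0}\left\{\frac{\alpha\beta\sqrt\Delta}{2}+\frac{\beta\sigma_{\mathrm v}^2\sqrt\Delta}{2\alpha}-\frac12\beta^2+\mathrm{E}\left[J(\alpha,\beta;Z)\right]\right\}$$ has a unique optimizer $(\alpha^\ast,\beta^\ast)$, where $$J(\alpha,\beta;Z)=\frac{\beta\sqrt\Delta}{2\alpha}\left(\hat S(\alpha,\beta;Z)-X\right)^2-\beta H\left(\hat S(\alpha,\beta;Z)-X\right)+\frac{1}{2\gamma}\left(\hat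 S(\alpha,\beta;Z)-Z\right)^2,$$ $$\hat S(\alpha,\beta;Z)=\frac{1}{\frac{\beta\sqrt\Delta}{\alpha}+\frac1\gamma}\left(\frac{\beta\sqrt\Delta}{\alpha}\left(X+\frac{\alpha}{\sqrt\Delta}H\right)+\frac1\gamma Z\right),$$ $X\sim p_X$, $H\sim\mathcal{N}(0,1)$, $Z\sim p_Z$, and the expectation $\mathrm{E}[\cdot]$ is calculated over all random variables $X$, $H$, and $Z$. Then the following statements hold: 1. The asymptotic mean-square error of $\hat{\bm{s}}$ is $$\operatorname*{plim}_{M,N\to\infty}\frac1N\|\hat{\bm{s}}-\bm{x}\|_2^2=(\alpha^\ast)^2-\sigma_{\mathrm v}^2.$$ 2. Let $\mu_{\hat{\bm{s}}}$ denote the empirical distribution of $\hat{\bm{s}}=[\hat s_1\ \cdots\ \hat s_N]^\top$, corresponding to the cumulative distribution function $P_{\hat{\bm{s}}}(s)=\frac1N\sum_{n=1}^N\mathbb{I}(\hat s_n<s)$, where $\mathbb{I}(\hat s_n<s)=1$ if $\hat s_n<s$ and $0$ otherwise. Then $\mu_{\hat{\bm{s}}}$ converges weakly in probability to the distribution $\mu_S$ of $S=\hat S(\alpha^\ast,\beta^\ast;Z)$, i.e., $\int g\,d\mu_{\hat{\bm{s}}}$ converges in probability to $\int g\,d\mu_S$ for any continuous compactly supported function $g:\mathbb{R}\to\mathbb{R}$.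
   Context: The squared loss is $L(\bm{s})=\frac12\|\bm{y}-\bm{A}\bm{s}\|_2^2$, and for a lower semicontinuous function $\phi:\mathbb{R}^N\to\mathbb{R}\cup\{+\infty\}$ the proximity operator is $\operatorname{prox}_\phi(\bm{u})=\operatorname*{arg\,min}_{\bm{s}\in\mathbb{R}^N}\{\phi(\bm{s})+\frac12\|\bm{s}-\bm{u}\|_2^2\}$. The large system limit is $M,N\to\infty$ with $M/N=\Delta$ fixed, where a sequence of problems with $\{\bm{x},\bm{A},\bm{v}\}$ indexed by $N$ is considered; all limits in the claim are in this sense. The notation $\operatorname{plim}$ denotes the limit in probability. *)

(* Defs.v *)
From HB Require Import structures.
From mathcomp Require Import all_boot all_order all_algebra.
From mathcomp Require Import all_classical all_reals all_analysis measurable_realfun.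

Set Implicit Arguments.
Unset Strict Implicit.
Unset Printing Implicit Defensive.

Import Order.TTheory GRing.Theory Num.Theory.
Import numFieldNormedType.Exports.

Local Open Scope classical_set_scope.
Local Open Scope ring_scope.

Section independence.
Context d (T : measurableType d) (R : realType) (P : probability T R).

Definition sigma_rv d' (E : measurableType d') (X : T -> E) : set (set T) :=
  preimage_set_system setT X measurable.

Definition sigma_rvs d' (E : measurableType d') (I : Type) (X : I -> T -> E) :
    set (set T) :=
  <<s \bigcup_i sigma_rv (X i) >>.

(* The product rule over the whole (finite) index set gives the one over every
   subfamily: the sigma-algebras contain setT. *)
Definition mutually_independent d' (E : measurableType d') (I : finType)
    (X : I -> T -> E) : Prop :=
  forall B : I -> set T, (forall i, sigma_rv (X i) (B i)) ->
    P (\bigcap_i B i) = (\prod_i P (B i))%E.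

Definition independent_sigma (F G : set (set T)) : Prop :=
  forall B C, F B -> G C -> P (B `&` C) = (P B * P C)%E.

Definition has_law d' (E : measurableType d') (X : T -> E)
    (mu : set E -> \bar R) : Prop :=
  forall B, measurable B -> P (X @^-1` B) = mu B.

Definition cvg_in_prob (U : nat -> T -> R) (l : R) : Prop :=
  forall e, 0 < e ->
    P [set w | e < `|U k w - l|] @[k --> \oo] --> 0%E.

Definition weak_cvg_in_prob
    (mu : nat -> T -> {measure set R -> \bar R})
    (nu : {measure set R -> \bar R}) : Prop :=
  forall g : R -> R, continuous g ->
    compact (closure [set t | g t != 0]) ->
    cvg_in_prob (fun k w => \int[mu k w]_t g t) (\int[nu]_t g t).

End independence.

Section empirical.
Context (R : realType) (n : nat) (s : 'cV[R]_n).

Definition empirical_measure (B : set R) : \bar R :=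
  ((n%:R^-1)%:E * \sum_(i < n) \d_(s i 0%R) B)%E.

Let atom (i : nat) : R := if insub i is Some j then s j 0 else 0.

Let mu : {measure set R -> \bar R} :=
  mscale (n%:R^-1)%:nng
    (msum (fun i => @dirac _ R (atom i) R) n).

Let empirical_measureE : empirical_measure = mu.
Proof.
apply/funext => B; rewrite /empirical_measure /mu /= /mscale /msum /=.
by congr (_ * _)%E; apply: eq_bigr => i _; rewrite /atom valK.
Qed.

Let empirical0 : empirical_measure set0 = 0%E.
Proof. by rewrite empirical_measureE measure0. Qed.

Let empirical_ge0 B : (0 <= empirical_measure B)%E.
Proof. by rewrite empirical_measureE. Qed.

Let empirical_sigma_additive : semi_sigma_additive empirical_measure.
Proof. by rewrite empirical_measureE; exact: measure_semi_sigma_additive. Qed.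

HB.instance Definition _ := isMeasure.Build _ R R
  empirical_measure empirical0 empirical_ge0 empirical_sigma_additive.

(* The strict inequality makes this the measure of the open half-line. *)
Definition empirical_cdf (t : R) : R :=
  n%:R^-1 * \sum_(i < n) (s i 0 < t)%R%:R.

Lemma empirical_measure_cdf (t : R) :
  empirical_measure `]-oo, t[ = (empirical_cdf t)%:E.
Proof.
rewrite /empirical_measure /empirical_cdf EFinM; congr (_ * _)%E.
rewrite -sumEFin; apply: eq_bigr => i _.
by rewrite diracE mem_setE in_itv.
Qed.

End empirical.

Section prox.
Context (R : realType) (n : nat).

Definition sqnorm2 m (s : 'cV[R]_m) : R := \sum_(i < m) s i 0 ^+ 2.

Definition argmin (f : 'cV[R]_n -> \bar R) : set 'cV[R]_n :=
  [set s | forall s', (f s <= f s')%E].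

Definition prox_set (phi : 'cV[R]_n -> \bar R) (u : 'cV[R]_n) :
    set 'cV[R]_n :=
  argmin (fun s => phi s + (2^-1 * sqnorm2 (s - u))%:E)%E.

(* Only meaningful when prox_set phi u is a singleton. *)
Definition prox (phi : 'cV[R]_n -> \bar R) (u : 'cV[R]_n) : 'cV[R]_n :=
  xget 0 (prox_set phi u).

Definition sqloss m (A : 'M[R]_(m, n)) (y : 'cV[R]_m) (s : 'cV[R]_n) : R :=
  2^-1 * sqnorm2 (y - A *m s).

Definition prox_sqloss m (gamma : R) (A : 'M[R]_(m, n)) (y : 'cV[R]_m)
    (z : 'cV[R]_n) : 'cV[R]_n :=
  prox (fun s => (gamma * sqloss A y s)%:E) z.

End prox.

Section scalar_problem.
Context (R : realType) (Delta gamma : R).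

Definition Shat (alpha beta x h z : R) : R :=
  (beta * Num.sqrt Delta / alpha + gamma^-1)^-1 *
  (beta * Num.sqrt Delta / alpha * (x + alpha / Num.sqrt Delta * h)
   + gamma^-1 * z).

Definition Jfun (alpha beta x h z : R) : R :=
  let s := Shat alpha beta x h z in
  beta * Num.sqrt Delta / (2 * alpha) * (s - x) ^+ 2
  - beta * h * (s - x) + (2 * gamma)^-1 * (s - z) ^+ 2.

Context d (T : measurableType d) (Q : probability T R).

Section Shat_rv.
Variables (X H Z : {RV Q >-> R}) (alpha beta : R).

Definition Shat_fun : T -> R := fun w => Shat alpha beta (X w) (H w) (Z w).

Let measurable_Shat_fun : measurable_fun setT Shat_fun.
Proof.
apply: measurable_funM => //; apply: measurable_funD.
  apply: measurable_funM => //; apply: measurable_funD => //.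
  exact: measurable_funM.
exact: measurable_funM.
Qed.

HB.instance Definition _ :=
  isMeasurableFun.Build _ _ T R Shat_fun measurable_Shat_fun.

Definition Shat_rv : {RV Q >-> R} := Shat_fun : {mfun T >-> R}.

End Shat_rv.

(* E[J] is taken in the extended reals. The negative part of J is always
   integrable, as J >= - alpha * beta * h ^+ 2 / (2 * sqrt Delta). *)
Definition objective (sigmav : R) (X H Z : {RV Q >-> R}) (alpha beta : R) :
    \bar R :=
  ((alpha * beta * Num.sqrt Delta / 2
    + beta * sigmav ^+ 2 * Num.sqrt Delta / (2 * alpha)
    - 2^-1 * beta ^+ 2)%:E
   + 'E_Q[fun w => Jfun alpha beta (X w) (H w) (Z w)])%E.

End scalar_problem.

Section minimax.
Context (R : realType) (F : R -> R -> \bar R).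

Definition minimax_optimizer (a b : R) : Prop :=
  [/\ 0 < a, 0 <= b,
      forall b', 0 <= b' -> (F a b' <= F a b)%E &
      forall a', 0 < a' ->
        (F a b <= ereal_sup [set F a' b' | b' in [set b' : R | (0 <= b')%R]])%E].

Definition unique_minimax_optimizer (a b : R) : Prop :=
  minimax_optimizer a b /\
  forall a' b', minimax_optimizer a' b' -> a' = a /\ b' = b.

End minimax.

(* Main.v *)
Require Import Defs.
From HB Require Import structures.
From mathcomp Require Import all_boot all_order all_algebra.
From mathcomp Require Import all_classical all_reals all_analysis measurable_realfun.
From mathcomp Require Import ring lra.

Set Implicit Arguments.
Unset Strict Implicit.
Unset Printing Implicit Defensive.

Import Order.TTheory GRing.Theory Num.Theory.
Import numFieldNormedType.Exports.

Local Open Scope classical_set_scope.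
Local Open Scope ring_scope.

(** Put [t = 1 / gamma] and [D = z - x]. The error [e = shat - x] and the residual [r = v - A e]
    solve a ridge problem: with [G] the inverse of [A^T A + t], one has [e = G (A^T v + t D)] and
    [A^T r = t (e - D)]. No min-max comparison is used; everything comes from Gaussian integration
    by parts in the entries of [A], with the data [(x, z, v)] frozen.

    Let [phi_i] be a function of [e_i] with derivative [psi_i], and [Y] a bounded smooth function of
    [A]. Integrating the sum of [A_mi r_m phi_i Y] by parts gives [tested_relation]: up to lower
    order, the sums over [i] of [((t + kappa) e_i - t D_i) phi_i Y] and of
    [(|r|^2 / N) psi_i G_ii Y] have the same expectation, where [kappa] is the trace of
    [1 - A G A^T] divided by [N]. Choosing for [Y] the deviation to be controlled turns such a
    relation into a variance bound of order [1 / N]. This is done in turn for the following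
    quantities. The normalized trace and the diagonal of [G] concentrate at [1 / (c + t)], where [c]
    is the positive root of [Delta (c + t) = c (c + t) + c]; then [kappa] is close to [c]
    ([mean_trG_concentration], [resolvent_concentration]). The energies [|e|^2 / N] and [|r|^2 / N]
    concentrate at explicit linear functions of [|D|^2 / N] and [|v|^2 / N]
    ([sqr_error_concentration], [sqr_res_concentration]). With [phi_i] a solution of Stein's
    equation, averages of smooth functions of [x_i + e_i] behave as if [e_i] were Gaussian with mean
    [t D_i / (c + t)] and variance [tau ^ 2], where [(c + t) ^ 2 tau ^ 2] is the limit of
    [|r|^2 / N] ([statistic_concentration]).

    Independence of [A] and the data allows Chebyshev's inequality with the data frozen, on the
    event that [|D|^2 / N] and [|v|^2 / N] are near their limits ([conditional_chebyshev],
    [concentration_cvg]); the weak law of large numbers makes this event likely.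

    On the scalar side, uniqueness of the optimizer forces [E (Z - X) ^ 2] to be finite, since
    otherwise the objective is infinite for every [beta > 0]. The objective is then an explicit
    function with an explicit saddle point, so [beta sqrt Delta = c alpha] and a second equation
    hold ([optimizer_equations]). These equations give the limit [alpha ^ 2 - sigmav ^ 2] for
    [|e|^2 / N] and [beta ^ 2] for [|r|^2 / N] ([limit_values]). Hence [tau = beta / (c + t)], and
    [X + t (Z - X) / (c + t) + tau H] is exactly [Shat]. Uniform approximation extends the second
    statement from smooth functions to continuous compactly supported ones. *)

(** * Bounded functions on a probability space, and Fubini for independent variables *)

Section bounded_functions.
Context d (T : measurableType d) (R : realType) (P : probability T R).

Definition bounded_mfun (f : T -> R) :=
  measurable_fun setT f /\ exists K, forall w, `|f w| <= K.

Lemma bounded_mfun_integrable f : bounded_mfun f ->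
  P.-integrable setT (EFin \o f).
Proof.
move=> [mf [K fK]].
apply: (@le_integrable _ _ _ P setT measurableT _ (EFin \o cst K)).
- exact/measurable_EFinP.
- by move=> w _ /=; rewrite lee_fin (le_trans (fK w))// ler_norm.
- exact: finite_measure_integrable_cst.
Qed.

Lemma bounded_mfunD f g : bounded_mfun f -> bounded_mfun g ->
  bounded_mfun (fun w => f w + g w).
Proof.
move=> [mf [K fK]] [mg [L gL]]; split; first exact: measurable_funD.
by exists (K + L) => w; rewrite (le_trans (ler_normD _ _))// lerD.
Qed.

Lemma bounded_mfunM f g : bounded_mfun f -> bounded_mfun g ->
  bounded_mfun (fun w => f w * g w).
Proof.
move=> [mf [K fK]] [mg [L gL]]; split; first exact: measurable_funM.
by exists (K * L) => w; rewrite normrM ler_pM.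
Qed.

Lemma bounded_mfun_cst c : bounded_mfun (fun=> c).
Proof. by split => //; exists `|c|. Qed.

Lemma bounded_mfunN f : bounded_mfun f -> bounded_mfun (fun w => - f w).
Proof.
move=> [mf [K fK]]; split; first exact: measurableT_comp.
by exists K => w; rewrite normrN.
Qed.

Lemma bounded_mfunB f g : bounded_mfun f -> bounded_mfun g ->
  bounded_mfun (fun w => f w - g w).
Proof. by move=> bf bg; apply: bounded_mfunD => //; exact: bounded_mfunN. Qed.

Lemma bounded_mfunX f n : bounded_mfun f -> bounded_mfun (fun w => f w ^+ n).
Proof.
move=> bf; elim: n => [|n ih].
  by under eq_fun do rewrite expr0; exact: bounded_mfun_cst.
by under eq_fun do rewrite exprS; exact: bounded_mfunM.
Qed.

Lemma bounded_mfun_sum (I : Type) (s : seq I) (f : I -> T -> R) :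
  (forall i, bounded_mfun (f i)) -> bounded_mfun (fun w => \sum_(i <- s) f i w).
Proof.
move=> bf; elim: s => [|i s ih].
  by under eq_fun do rewrite big_nil; exact: bounded_mfun_cst.
by under eq_fun do rewrite big_cons; exact: bounded_mfunD.
Qed.

Lemma Rintegral_sum (I : Type) (s : seq I) (f : I -> T -> R) :
  (forall i, P.-integrable setT (EFin \o f i)) ->
  \int[P]_w (\sum_(i <- s) f i w) = \sum_(i <- s) \int[P]_w f i w.
Proof.
move=> fi.
have si s' : P.-integrable setT (EFin \o (fun w => \sum_(i <- s') f i w)).
  elim: s' => [|i s' ih].
    have := @bounded_mfun_integrable _ (bounded_mfun_cst 0).
    by congr integrable; apply/funext => w /=; rewrite big_nil.
  have := integrableD measurableT (fi i) ih.
  by congr integrable; apply/funext => w /=; rewrite big_cons EFinD.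
elim: s => [|i s ih].
  by under eq_Rintegral do rewrite big_nil; rewrite Rintegral_cst// mul0r big_nil.
under eq_Rintegral do rewrite big_cons.
by rewrite RintegralD// ih big_cons.
Qed.

Lemma Rintegral_prob_cst (c : R) : \int[P]_w c = c.
Proof.
rewrite Rintegral_cst//= (_ : fine _ = 1) ?mulr1//.
by rewrite -[RHS]/(fine 1%:E); congr fine; exact: probability_setT.
Qed.

Lemma le_Rintegral_bounded f g : bounded_mfun f -> bounded_mfun g ->
  (forall w, f w <= g w) -> \int[P]_w f w <= \int[P]_w g w.
Proof.
by move=> bf bg fg; apply: le_Rintegral => //; exact: bounded_mfun_integrable.
Qed.

End bounded_functions.
Arguments bounded_mfun_integrable {d T R P f} _.

Section independence_fubini.
Context d (T : measurableType d) (R : realType) (P : probability T R).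
Context d1 d2 (T1 : measurableType d1) (T2 : measurableType d2).
Variables (U : {mfun T >-> T1}) (V : {mfun T >-> T2}).
Hypothesis indUV : forall B C, measurable B -> measurable C ->
  P (U @^-1` B `&` V @^-1` C) = (P (U @^-1` B) * P (V @^-1` C))%E.

Let mUV : measurable_fun setT (fun w => (U w, V w)).
Proof. exact/measurable_fun_pair. Qed.

Let UV : {mfun T >-> (T1 * T2)%type} :=
  HB.pack (fun w => (U w, V w)) (isMeasurableFun.Build _ _ _ _ _ mUV).

Let PUV B : measurable B ->
  (distribution P U \x distribution P V)%E B = distribution P UV B.
Proof. by move=> mB; apply: product_measure_unique. Qed.

Lemma integral_independent (f : T1 * T2 -> R) : measurable_fun setT f ->
  P.-integrable setT (EFin \o (fun w => f (U w, V w))) ->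
  \int[P]_w f (U w, V w) =
  \int[distribution P U]_u \int[distribution P V]_v f (u, v).
Proof.
move=> mf intf.
have mf' : measurable_fun setT (EFin \o f) by exact/measurable_EFinP.
have if1 : (distribution P UV).-integrable setT (EFin \o f).
  exact: integrable_pushforward.
have if2 : (distribution P U \x distribution P V)%E.-integrable setT (EFin \o f).
  apply/integrableP; split => //; move/integrableP : if1 => [_].
  by rewrite (eq_measure_integral (distribution P UV) (fun A mA _ => PUV mA)).
have -> : \int[P]_w f (U w, V w) = fine (\int[distribution P UV]_y (f y)%:E)%E.
  by rewrite integral_distribution.
rewrite -(eq_measure_integral (distribution P UV) (fun A mA _ => PUV mA)).
rewrite -integral12_prod_meas1//; congr fine.
(* The inner integral is finite only for almost every [u]; elsewhere [fine] returns its default, on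
   a null set. *)
have iF := integrable_fubini_F if2.
have [N [mN N0 HN]] := integrable_ae measurableT iF.
apply: ae_eq_integral => //.
- exact: measurable_int iF.
- apply/measurable_EFinP.
  apply: (measurableT_comp (f := fine)) => //.
  exact: measurable_int iF.
- exists N; split => // u /= nu; apply: HN => /= h; apply: nu => _.
  by rewrite /= /Rintegral fineK//; exact: h.
Qed.

(** Conditioning in the form of Tonelli: a bound that holds with [V] frozen at every value survives
    averaging over [V]. *)
Lemma ge0_integral_independent_le (f : T1 * T2 -> R) (c : \bar R) :
  measurable_fun setT f -> (forall p, 0 <= f p) ->
  (forall v, \int[P]_w (f (U w, v))%:E <= c)%E ->
  (\int[P]_w (f (U w, V w))%:E <= c)%E.
Proof.
move=> mf f0 fc.
have mf' : measurable_fun setT (EFin \o f) by exact/measurable_EFinP.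
(* The hypothesis [fc] needs a frozen value [v]; one exists because a probability space is
   inhabited. *)
have c0 : (0 <= c)%E.
  have [w|noT] := pselect (exists w : T, True).
    by have [w0 _] := w; apply: le_trans (fc (V w0)); apply: integral_ge0 => w' _; rewrite lee_fin.
  have := @probability_setT _ T R P; rewrite (_ : setT = set0) ?measure0; last first.
    by apply/seteqP; split => // w _; apply: noT; exists w.
  by move=> /eqP; rewrite eq_sym onee_eq0.
have -> : (\int[P]_w (f (U w, V w))%:E = \int[distribution P UV]_y (f y)%:E)%E.
  by rewrite ge0_integral_distribution// => y; rewrite lee_fin.
rewrite -(eq_measure_integral (distribution P UV) (fun A mA _ => PUV mA)).
rewrite fubini_tonelli2//.
apply: (@le_trans _ _ (\int[distribution P V]_v c)%E); last first.
  have := @probability_setT _ _ _ (distribution P V) => p1.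
  by rewrite integral_cst// [X in (_ * X)%E]p1 mule1.
apply: ge0_le_integral => //.
- by move=> v _; apply: integral_ge0 => u _; rewrite lee_fin.
- by apply: measurable_fun_fubini_tonelli_G => // p; rewrite lee_fin.
move=> v _; apply: le_trans (fc v); rewrite /fubini_G/=.
rewrite ge0_integral_distribution//; last by move=> u; rewrite lee_fin.
by apply/measurable_EFinP; apply: measurableT_comp => //; exact: measurable_pair2.
Qed.

End independence_fubini.

(** * Integration against the normal density *)

Section normal_density.
Context {R : realType} (s : R).
Hypothesis s0 : 0 < s.
Notation mu := (@lebesgue_measure R).
Notation N := (@normal_prob R 0 s).
Notation p := (@normal_pdf R 0 s).
Local Open Scope ereal_scope.

Let mp : measurable_fun setT (EFin \o p).
Proof. by apply/measurable_EFinP; exact: measurable_normal_pdf. Qed.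

(** Both functions integrate to [N] over every measurable set. This turns change of variables for
    the abstract Radon-Nikodym derivative into integration against [normal_pdf]. *)
Let ae_density : ae_eq mu setT (Radon_Nikodym_SigmaFinite.f N mu) (EFin \o p).
Proof.
have Nmu := @normal_prob_dominates R 0%R s.
have if1 := Radon_Nikodym_SigmaFinite.f_integrable Nmu.
apply: integral_ae_eq => // E _ mE.
by rewrite -(Radon_Nikodym_SigmaFinite.f_integral Nmu).
Qed.

Lemma ge0_integral_normal_prob (f : R -> \bar R) : measurable_fun setT f ->
  (forall a, 0 <= f a) -> \int[N]_a f a = \int[mu]_a (f a * (p a)%:E).
Proof.
move=> mf f0; have Nmu := @normal_prob_dominates R 0%R s.
rewrite -(Radon_Nikodym_SigmaFinite.change_of_variables Nmu)//.
have if1 := Radon_Nikodym_SigmaFinite.f_integrable Nmu.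
apply: ae_eq_integral => //.
- apply: emeasurable_funM => //; exact: measurable_int if1.
- exact: emeasurable_funM.
- exact: ae_eqe_mul2l.
Qed.

Lemma integrable_normal_prob (f : R -> R) :
  mu.-integrable setT (EFin \o (fun a => f a * p a)%R) -> measurable_fun setT f ->
  N.-integrable setT (EFin \o f).
Proof.
move=> /integrableP[_ fi] mf; apply/integrableP; split; first exact/measurable_EFinP.
rewrite ge0_integral_normal_prob//; last first.
  by apply: measurableT_comp => //; exact/measurable_EFinP.
apply: le_lt_trans fi; rewrite le_eqVlt; apply/orP; left; apply/eqP.
apply: eq_integral => a _ /=; rewrite normrM EFinM.
by rewrite (ger0_norm (normal_pdf_ge0 _ _ _)).
Qed.

Lemma Rintegral_normal_prob (f : R -> R) :
  mu.-integrable setT (EFin \o (fun a => f a * p a)%R) -> measurable_fun setT f ->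
  (\int[N]_a f a = \int[mu]_a (f a * p a))%R.
Proof.
move=> fi mf; have fN := integrable_normal_prob fi mf.
have Nmu := @normal_prob_dominates R 0%R s.
have mf' : measurable_fun setT (EFin \o f) by exact/measurable_EFinP.
congr fine; rewrite -(Radon_Nikodym_change_of_variables Nmu)//.
apply: ae_eq_integral => //.
- apply: emeasurable_funM => //.
- exact: measurable_int fi.
- under [in X in ae_eq _ _ _ X]eq_fun do rewrite EFinM.
  apply: ae_eqe_mul2l; apply: ae_eq_trans ae_density.
  exact/ae_eq_sym/ae_eq_Radon_Nikodym_SigmaFinite.
Qed.
End normal_density.

(** * Gaussian integration by parts on the line *)

Section improper_FTC.
Context {R : realType}.
Notation mu := (@lebesgue_measure R).

(** Integrals over growing symmetric intervals are boundary differences of [G], and dominated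
    convergence with bound [|g|] passes to the whole line. *)
Lemma integral_derivative_eq0 (G g : R -> R) :
  (forall a : R, is_derive a (1 : R) G (g a)) -> continuous g ->
  mu.-integrable setT (EFin \o g) ->
  G n.+1%:R - G (- n.+1%:R) @[n --> \oo] --> (0 : R) ->
  \int[mu]_a g a = 0.
Proof.
move=> dG cg ig G0.
(* The shift to [n.+1] keeps the interval nondegenerate, as the fundamental theorem requires. *)
pose J n : set R := [set` `[- n.+1%:R, n.+1%:R]].
pose g_ n : R -> \bar R := (EFin \o g) \_ (J n).
have mg : measurable_fun setT (EFin \o g) by exact: measurable_int ig.
have mg_ n : measurable_fun setT (g_ n).
  by apply/(measurable_restrictT _ (measurable_itv _)); exact: measurable_funTS.
have cG : continuous G.
  by move=> a; apply: differentiable_continuous; apply/derivable1_diffP; case: (dG a).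
have gJ n : (\int[mu]_a g_ n a = (G n.+1%:R - G (- n.+1%:R))%:E)%E.
  rewrite /g_ -integral_mkcond /J.
  rewrite (@continuous_FTC2 _ g G)//.
  - by rewrite -subr_gt0 opprK.
  - by apply: continuous_subspaceT.
  - split.
    + by move=> a _; case: (dG a).
    + by apply: cvg_at_right_filter; exact: cG.
    + by apply: cvg_at_left_filter; exact: cG.
  - by move=> a _; rewrite derive1E; case: (dG a).
have [] := @dominated_convergence _ _ _ mu setT measurableT g_ (EFin \o g)
  (abse \o (EFin \o g)) mg_ mg.
- apply: aeW => a _; apply: cvg_near_cst.
  near=> n; rewrite /g_ patchE mem_set// /J /= in_itv /= -ler_norml.
  near: n; exists (Num.truncn `|a|).+1 => // n /= an.
  rewrite ltW// (lt_le_trans (truncnS_gt _))// ler_nat; exact: leqW.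
- exact: integrable_abse.
- apply: aeW => a n _; rewrite /g_ patchE; case: ifPn => // _.
  by rewrite abse0 abse_ge0.
move=> _ _ /=; under eq_fun do rewrite gJ.
move=> gcvg; have : (G n.+1%:R - G (- n.+1%:R))%:E @[n --> \oo] --> 0%:E.
  by apply: cvg_EFin => //; exact: nearW.
move=> /(cvg_unique _ gcvg) h.
by rewrite /Rintegral h.
Unshelve. all: by end_near. Qed.

End improper_FTC.

Section normal_integration_by_parts.
Context {R : realType} (s : R).
Hypothesis s0 : 0 < s.
Notation mu := (@lebesgue_measure R).
Notation N := (@normal_prob R 0 s).
Notation p := (@normal_pdf R 0 s).

Let sN0 : s != 0. Proof. by rewrite gt_eqF. Qed.

Let c := normal_peak s.

Let pE a : p a = c * expR (- (a ^+ 2 / (2 * s ^+ 2))).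
Proof.
rewrite normal_pdfE// /normal_fun subr0; congr (_ * expR _).
by rewrite mulNr -mulr_natl.
Qed.

Let p' (a : R) : is_derive a (1 : R) p (- (a / s ^+ 2 * p a)).
Proof.
have -> : p = (fun a => c * expR (- (a ^+ 2 / (2 * s ^+ 2)))) by apply/funext => ?; exact: pE.
apply: is_derive_eq.
rewrite /GRing.scale /=; set e := expR _.
by field.
Qed.

Let cp : continuous p. Proof. exact: continuous_normal_pdf. Qed.

(** With [b = a ^+ 2 / (4 * s ^+ 2)] the exponential in [p] is the square of [expR (- b)]. One
    factor absorbs the polynomial through [1 + b <= expR b]; the other belongs to the density of
    standard deviation [s * sqrt 2]. *)
Let p_quad a : (1 + a ^+ 2) * p a <=
  (1 + 4 * s ^+ 2) * c / normal_peak (s * Num.sqrt 2) *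
    normal_pdf 0 (s * Num.sqrt 2) a.
Proof.
have r0 : s * Num.sqrt 2 != 0 by rewrite gt_eqF// mulr_gt0// sqrtr_gt0.
rewrite (normal_pdfE _ r0) mulrA divfK; last first.
  by rewrite gt_eqF// normal_peak_gt0.
rewrite pE /normal_fun subr0 exprMn sqr_sqrtr//.
set b := a ^+ 2 / (4 * s ^+ 2).
have b0 : 0 <= b by rewrite divr_ge0 ?sqr_ge0// mulr_ge0// sqr_ge0.
have -> : expR (- (a ^+ 2 / (2 * s ^+ 2))) = expR (- b) * expR (- b).
  rewrite -expRD; congr expR; rewrite /b; field; exact: sN0.
have -> : - a ^+ 2 / (s ^+ 2 * 2 *+ 2) = - b by rewrite /b; field; exact: sN0.
have -> : a ^+ 2 = 4 * s ^+ 2 * b by rewrite /b; field; exact: sN0.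
have eb : (1 + 4 * s ^+ 2 * b) * expR (- b) <= 1 + 4 * s ^+ 2.
  rewrite expRN ler_pdivrMr ?expR_gt0//.
  have := expR_ge1Dx b; have s20 : 0 <= 4 * s ^+ 2 by rewrite mulr_ge0// sqr_ge0.
  nra.
have c0 : 0 <= c by exact: normal_peak_ge0.
have := ler_wpM2r (mulr_ge0 c0 (expR_ge0 (- b))) eb.
by congr (_ <= _); ring.
Qed.

Lemma normal_pdf_quadratic_bound : exists K, forall a, (1 + a ^+ 2) * p a <= K.
Proof.
have r0 : s * Num.sqrt 2 != 0 by rewrite gt_eqF// mulr_gt0// sqrtr_gt0.
exists ((1 + 4 * s ^+ 2) * c / normal_peak (s * Num.sqrt 2) *
  normal_peak (s * Num.sqrt 2)) => a.
apply: le_trans (p_quad a) _; rewrite ler_wpM2l ?normal_pdf_ub//.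
by rewrite !mulr_ge0 ?invr_ge0 ?normal_peak_ge0// addr_ge0// mulr_ge0// sqr_ge0.
Qed.

Lemma is_derive_normal_pdf (a : R) : is_derive a (1 : R) p (- (a / s ^+ 2 * p a)).
Proof. exact: p'. Qed.

Lemma normal_pdf_gt0 a : 0 < p a.
Proof. by rewrite pE mulr_gt0 ?expR_gt0// normal_peak_gt0. Qed.

Lemma normal_pdf_sym a : p (- a) = p a.
Proof. by rewrite !pE sqrrN. Qed.

Lemma normal_pdf_decreasing a b : 0 <= a -> a <= b -> p b <= p a.
Proof.
move=> a0 ab; rewrite !pE ler_wpM2l ?normal_peak_ge0// ler_expR lerN2.
rewrite ler_pM2r; last by rewrite invr_gt0 mulr_gt0// exprn_gt0.
by rewrite lerXn2r// nnegrE// (le_trans a0).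
Qed.

Lemma integrable_quadratic_normal_pdf :
  mu.-integrable setT (EFin \o (fun a => (1 + a ^+ 2) * p a)).
Proof.
set K := (1 + 4 * s ^+ 2) * c / normal_peak (s * Num.sqrt 2).
apply: (@le_integrable _ _ _ mu setT measurableT _
  (fun a => K%:E * (normal_pdf 0 (s * Num.sqrt 2) a)%:E)%E).
- apply/measurable_EFinP/measurable_funM; last exact: measurable_normal_pdf.
  by apply: measurable_funD => //; exact: measurable_funX.
- move=> a _ /=; rewrite lee_fin; apply: le_trans (ler_norm _).
  rewrite ger0_norm; first exact: p_quad.
  by rewrite mulr_ge0 ?normal_pdf_ge0// addr_ge0 ?sqr_ge0.
- by apply: integrableZl => //; exact: integrable_normal_pdf.
Qed.

Lemma integrable_normal_prob_quadratic (f : R -> R) K : measurable_fun setT f ->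
  (forall a, `|f a| <= K * (1 + a ^+ 2)) ->
  mu.-integrable setT (EFin \o (fun a => f a * p a)) /\
  N.-integrable setT (EFin \o f).
Proof.
move=> mf fK.
suff i : mu.-integrable setT (EFin \o (fun a => f a * p a)).
  by split => //; exact: integrable_normal_prob.
apply: (@le_integrable _ _ _ mu setT measurableT _
  (fun a => K%:E * ((1 + a ^+ 2) * p a)%:E)%E).
- by apply/measurable_EFinP/measurable_funM => //; exact: measurable_normal_pdf.
- move=> a _ /=; rewrite lee_fin; apply: le_trans (ler_norm _).
  rewrite normrM (ger0_norm (normal_pdf_ge0 _ _ _)) mulrA.
  by rewrite ler_wpM2r// normal_pdf_ge0.
- by apply: integrableZl => //; exact: integrable_quadratic_normal_pdf.
Qed.

Let absr_le_quad (a : R) : `|a| <= 1 + a ^+ 2.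
Proof.
rewrite -(real_normK (num_real a)).
by have := sqr_ge0 (`|a| - 1); have := sqr_ge0 `|a|; lra.
Qed.

(* The linear growth allowed for F makes the second moment an instance. *)
Lemma normal_prob_by_parts (F f : R -> R) K :
  (forall a : R, is_derive a (1 : R) F (f a)) -> continuous f ->
  (forall a, `|F a| <= K * (1 + `|a|)) -> (forall a, `|f a| <= K) ->
  N.-integrable setT (EFin \o (fun a : R => a * F a)) /\
  \int[N]_a (a * F a) = s ^+ 2 * \int[N]_a f a.
Proof.
move=> dF cf FK fK.
have K0 : 0 <= K by exact: le_trans (fK 0).
have cF : continuous F.
  by move=> a; apply: differentiable_continuous; apply/derivable1_diffP; case: (dF a).
have mF : measurable_fun setT F by exact: continuous_measurable_fun.
have mf : measurable_fun setT f by exact: continuous_measurable_fun.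
have maF : measurable_fun setT (fun a : R => a * F a) by exact: measurable_funM.
have [i1 i1'] : mu.-integrable setT (EFin \o (fun a : R => a * F a * p a)) /\
    N.-integrable setT (EFin \o (fun a : R => a * F a)).
  apply: (@integrable_normal_prob_quadratic _ (K * 2)) => // a.
  rewrite normrM; have := ler_wpM2l (normr_ge0 a) (FK a); have := absr_le_quad a.
  have : a ^+ 2 = `|a| ^+ 2 by rewrite real_normK ?num_real.
  move=> -> h1 h2; apply: le_trans h2 _.
  have -> : `|a| * (K * (1 + `|a|)) = K * (`|a| + `|a| ^+ 2) by ring.
  rewrite -mulrA ler_wpM2l//; have := sqr_ge0 (`|a|); lra.
have [i2 i2'] : mu.-integrable setT (EFin \o (fun a => f a * p a)) /\
    N.-integrable setT (EFin \o f).
  apply: (@integrable_normal_prob_quadratic _ K) => // a.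
  by apply: le_trans (fK a) _; rewrite ler_peMr// lerDl sqr_ge0.
split => //.
have i3 : mu.-integrable setT
    (EFin \o (fun a : R => - (s ^+ 2)^-1 * (a * F a * p a))).
  have := integrableZl measurableT (- (s ^+ 2)^-1) i1.
  by congr integrable; apply/funext => a /=; rewrite EFinM.
rewrite !Rintegral_normal_prob//.
(* The integrand is the derivative of [F * p], because [p' = - a / s ^+ 2 * p]. *)
have : \int[mu]_a (f a * p a + - (s ^+ 2)^-1 * (a * F a * p a)) = 0.
  apply: (@integral_derivative_eq0 _ (fun a => F a * p a)).
  - move=> a; have := dF a; have := p' a; move=> dp dFa.
    apply: is_derive_eq; rewrite /GRing.scale/=; field; exact: sN0.
  - move=> a; apply: cvgD; apply: cvgM => //; [exact: cf|exact: cp|exact: cvg_cst|].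
    by apply: cvgM; [apply: cvgM => //; exact: cF|exact: cp].
  - have := integrableD measurableT i2 i3.
    by congr integrable; apply/funext => a /=; rewrite EFinD.
  (* Boundary terms: [F * p] is at most [C / |a|], from linear growth of [F] against the quadratic
     decay bound for [p]. *)
  - pose C := K * 2 * ((1 + 4 * s ^+ 2) * c / normal_peak (s * Num.sqrt 2) *
      normal_peak (s * Num.sqrt 2)).
    have r0 : s * Num.sqrt 2 != 0 by rewrite gt_eqF// mulr_gt0// sqrtr_gt0.
    have Fp a : 1 <= `|a| -> `|F a * p a| <= C * `|a|^-1.
      move=> a1; rewrite ler_pdivlMr; last exact: lt_le_trans a1.
      rewrite normrM (ger0_norm (normal_pdf_ge0 _ _ _)).
      have h1 : `|F a| * `|a| <= K * 2 * (1 + a ^+ 2).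
        apply: le_trans (ler_wpM2r (normr_ge0 a) (FK a)) _.
        rewrite -2!mulrA ler_wpM2l// -(real_normK (num_real a)).
        by have := sqr_ge0 (`|a| - 1); have := sqr_ge0 `|a|; nra.
      rewrite mulrAC; apply: le_trans (ler_wpM2r (normal_pdf_ge0 _ _ _) h1) _.
      rewrite /C -[leLHS]mulrA ler_wpM2l ?mulr_ge0//.
      apply: le_trans (p_quad a) _; rewrite ler_wpM2l ?normal_pdf_ub//.
      by rewrite !mulr_ge0 ?invr_ge0 ?normal_peak_ge0// addr_ge0// mulr_ge0// sqr_ge0.
    apply/norm_cvg0P.
    apply: (@squeeze_cvgr _ _ _ _ (cst 0) (fun n => 2 * C * n.+1%:R^-1)).
    + near=> n; rewrite normr_ge0/=.
      have n1 : 1 <= `|n.+1%:R : R| by rewrite ger0_norm// ler1n.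
      apply: le_trans (ler_normB _ _) _.
      have := Fp n.+1%:R n1; have := Fp (- n.+1%:R); rewrite normrN => /(_ n1).
      rewrite [`|n.+1%:R|]ger0_norm// => h1 h2.
      by rewrite -mulrA mulr_natl mulr2n lerD.
    + exact: cvg_cst.
    + rewrite -(mulr0 (2 * C)); apply: cvgM; first exact: cvg_cst.
      exact: cvg_harmonic.
rewrite RintegralD//.
rewrite RintegralZl//; move=> /eqP; rewrite addr_eq0 => /eqP ->.
by field; exact: sN0.
Unshelve. all: by end_near. Qed.

Lemma normal_prob_mean : N.-integrable setT (EFin \o id) /\ \int[N]_a a = 0.
Proof.
have dc (a : R) : is_derive a (1 : R) (cst (1 : R)) 0 by exact: is_derive_cst.
have [i e] := @normal_prob_by_parts (cst 1) (cst 0) 1 dc (@cst_continuous _ _ _)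
  ltac:(by move=> a; rewrite normr1 mul1r lerDl) ltac:(by move=> a; rewrite normr0).
have E : (fun a : R => a * cst 1 a) = id by apply/funext => a; rewrite /= mulr1.
rewrite E in i; split => //.
move: e; rewrite (_ : (fun a : R => a * cst 1 a) = id)// => ->.
by rewrite Rintegral_prob_cst mulr0.
Qed.

Lemma normal_prob_second_moment :
  N.-integrable setT (EFin \o (fun a : R => a ^+ 2)) /\ \int[N]_a a ^+ 2 = s ^+ 2.
Proof.
have dc (a : R) : is_derive a (1 : R) (@id R) 1 by exact: is_derive_id.
have [i e] := @normal_prob_by_parts id (cst 1) 1 dc (@cst_continuous _ _ _)
  ltac:(by move=> a; rewrite mul1r lerDr) ltac:(by move=> a; rewrite normr1).
split => //; move: e; rewrite Rintegral_prob_cst mulr1 => <-.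
by apply: eq_Rintegral.
Qed.

End normal_integration_by_parts.

(** * Inner product of column vectors *)

Section dot_product.
Context {R : realType} {n : nat}.
Implicit Types u v w : 'cV[R]_n.

Definition dot u v : R := \sum_i u i 0 * v i 0.

Lemma dot_mulmx u v : dot u v = (u^T *m v) 0 0.
Proof. by rewrite mxE; apply: eq_bigr => i _; rewrite mxE. Qed.

Lemma sqnorm2_dot u : sqnorm2 u = dot u u.
Proof. by apply: eq_bigr => i _; rewrite expr2. Qed.

Lemma dotC u v : dot u v = dot v u.
Proof. by apply: eq_bigr => i _; rewrite mulrC. Qed.

Lemma dotDl u v w : dot (u + v) w = dot u w + dot v w.
Proof. by rewrite -big_split; apply: eq_bigr => i _; rewrite mxE mulrDl. Qed.

Lemma dotZl a u v : dot (a *: u) v = a * dot u v.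
Proof. by rewrite mulr_sumr; apply: eq_bigr => i _; rewrite mxE mulrA. Qed.

Lemma dotDr u v w : dot w (u + v) = dot w u + dot w v.
Proof. by rewrite dotC dotDl !(dotC w). Qed.

Lemma dotZr a u v : dot u (a *: v) = a * dot u v.
Proof. by rewrite dotC dotZl dotC. Qed.

Lemma dotNl u v : dot (- u) v = - dot u v.
Proof. by rewrite -scaleN1r dotZl mulN1r. Qed.

Lemma dotNr u v : dot u (- v) = - dot u v.
Proof. by rewrite dotC dotNl dotC. Qed.

Lemma dotBl u v w : dot (u - v) w = dot u w - dot v w.
Proof. by rewrite dotDl dotNl. Qed.

Lemma dotBr u v w : dot w (u - v) = dot w u - dot w v.
Proof. by rewrite dotDr dotNr. Qed.

Lemma dot0l u : dot 0 u = 0.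
Proof. by rewrite -(scale0r (0 : 'cV[R]_n)) dotZl mul0r. Qed.

Lemma dot0r u : dot u 0 = 0. Proof. by rewrite dotC dot0l. Qed.

Lemma dot_suml (I : Type) (s : seq I) (F : I -> 'cV[R]_n) u :
  dot (\sum_(i <- s) F i) u = \sum_(i <- s) dot (F i) u.
Proof.
elim: s => [|i s ih]; first by rewrite !big_nil dot0l.
by rewrite !big_cons dotDl ih.
Qed.

Lemma dot_ge0 u : 0 <= dot u u.
Proof. by apply: sumr_ge0 => i _; rewrite -expr2 sqr_ge0. Qed.

Lemma dot_eq0 u : dot u u = 0 -> u = 0.
Proof.
move=> /eqP; rewrite psumr_eq0; last by move=> i _; rewrite -expr2 sqr_ge0.
move=> /allP h; apply/colP => i; rewrite mxE.
by have := h i (mem_index_enum _); rewrite /= -expr2 sqrf_eq0 => /eqP.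
Qed.

Lemma dot_delta i u : dot (delta_mx i 0) u = u i 0.
Proof.
rewrite /dot (bigD1 i)//= big1 ?addr0 ?mxE ?eqxx ?mul1r// => j ji.
by rewrite mxE (negbTE ji) mul0r.
Qed.

Lemma sqr_coord_le_dot i u : u i 0 ^+ 2 <= dot u u.
Proof.
rewrite /dot (bigD1 i)//= -expr2 lerDl.
by apply: sumr_ge0 => j _; rewrite -expr2 sqr_ge0.
Qed.

Lemma dot_le_half u v : `|dot u v| <= (dot u u + dot v v) / 2.
Proof.
have h1 := dot_ge0 (u - v); have h2 := dot_ge0 (u + v).
rewrite ler_norml; move: h1 h2.
rewrite !(dotDl, dotDr, dotNl, dotNr) (dotC v u).
by move=> h1 h2; apply/andP; split; lra.
Qed.

Lemma CauchySchwarz_dot u v : dot u v ^+ 2 <= dot u u * dot v v.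
Proof.
have [v0|v0] := eqVneq (dot v v) 0.
  by rewrite (dot_eq0 v0) dot0r expr0n/= dot0r mulr0.
have vp : 0 < dot v v by rewrite lt_neqAle eq_sym v0 dot_ge0.
have := dot_ge0 (dot v v *: u - dot u v *: v).
rewrite !(dotBl, dotBr, dotZl, dotZr) (dotC v u) => h.
have : 0 <= dot v v * (dot u u * dot v v - dot u v ^+ 2).
  by apply: le_trans h _; rewrite le_eqVlt; apply/orP; left; apply/eqP; ring.
by rewrite pmulr_rge0// subr_ge0.
Qed.

Lemma dotDD_le u v : dot (u + v) (u + v) <= 2 * dot u u + 2 * dot v v.
Proof.
have := dot_ge0 (u - v).
by rewrite !(dotDl, dotDr, dotNl, dotNr) (dotC v u); lra.
Qed.

End dot_product.

Lemma dot_adjoint {R : realType} {m n : nat} (A : 'M[R]_(m, n)) u v :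
  dot (A *m u) v = dot u (A^T *m v).
Proof. by rewrite !dot_mulmx trmx_mul mulmxA. Qed.

Lemma mulmx_delta_col {R : realType} {m n : nat} (i : 'I_m) (j : 'I_n)
  (u : 'cV[R]_n) : delta_mx i j *m u = u j 0 *: delta_mx i 0.
Proof.
apply/colP => k; rewrite !mxE (bigD1 j)//= big1 ?addr0 => [|l lj].
  by rewrite !mxE eqxx !andbT mulrC.
by rewrite !mxE (negbTE lj) andbF mul0r.
Qed.

(** * Ridge regression: error, residual and rank-one perturbation *)

Section ridge.
Context {R : realType} {M N : nat} (t : R).
Hypothesis t0 : 0 < t.
Implicit Types (A : 'M[R]_(M, N)) (v : 'cV[R]_M) (D : 'cV[R]_N).

Definition gram A : 'M[R]_N := A^T *m A + t%:M.

(* ridge A v D and ridge_res A v D are the error (minimizer minus signal) and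
   the residual of the regularized least-squares problem with noise v and prior
   error D; the resolvent column G e_i is ridge A 0 (t^-1 e_i). *)
Definition ridge A v D : 'cV[R]_N := invmx (gram A) *m (A^T *m v + t *: D).

Definition ridge_res A v D : 'cV[R]_M := v - A *m ridge A v D.

(** Twice the regularized least-squares objective at the zero vector, hence a bound for its minimum
    that does not involve [A]. *)
Definition ridge_energy v D : R := dot v v + t * dot D D.

Lemma gram_sym A : (gram A)^T = gram A.
Proof. by rewrite /gram linearD /= trmx_mul trmxK tr_scalar_mx. Qed.

Lemma gram_unit A : gram A \in unitmx.
Proof.
rewrite -row_free_unit; apply: inj_row_free => u uB.
have : dot u^T (gram A *m u^T) = 0.
  by rewrite dot_mulmx mulmxA trmxK uB mul0mx mxE.
rewrite /gram mulmxDl dotDr -mulmxA -dot_adjoint mul_scalar_mx dotZr => h.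
have u0 : dot u^T u^T = 0.
  move/eqP: h; rewrite paddr_eq0 ?dot_ge0 ?mulr_ge0 ?dot_ge0 ?(ltW t0)//.
  by move=> /andP[_]; rewrite mulf_eq0 (gt_eqF t0) => /eqP.
by rewrite -(trmxK u) (dot_eq0 u0) trmx0.
Qed.

Lemma gram_ridge A v D : gram A *m ridge A v D = A^T *m v + t *: D.
Proof. by rewrite mulKVmx// gram_unit. Qed.

Lemma ridge_unique A v D e : gram A *m e = A^T *m v + t *: D -> e = ridge A v D.
Proof. by rewrite /ridge => <-; rewrite mulKmx// gram_unit. Qed.

Lemma ridge_kkt A v D : A^T *m ridge_res A v D = t *: (ridge A v D - D).
Proof.
have := gram_ridge A v D.
rewrite /gram mulmxDl mul_scalar_mx -mulmxA /ridge_res mulmxBr scalerBr => h.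
by apply/eqP; rewrite subr_eq addrAC eq_sym subr_eq addrC h.
Qed.

Lemma mulmx_ridge A v D : A *m ridge A v D = v - ridge_res A v D.
Proof. by rewrite /ridge_res subKr. Qed.

(** Expansion of the quadratic objective around its minimizer, with the cross term removed by
    [ridge_kkt]. All four terms are nonnegative, so error and residual are bounded uniformly in
    [A]. *)
Lemma ridge_energyE A v D : ridge_energy v D =
  dot (ridge_res A v D) (ridge_res A v D) +
  t * dot (ridge A v D - D) (ridge A v D - D) +
  dot (A *m ridge A v D) (A *m ridge A v D) + t * dot (ridge A v D) (ridge A v D).
Proof.
set e := ridge A v D; set r := ridge_res A v D.
have vE : v = r + A *m e by rewrite /r /ridge_res subrK.
have h : dot (A *m e) r = t * dot e (e - D).
  by rewrite dot_adjoint ridge_kkt dotZr.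
clearbody r e; have vv : dot v v = dot r r + 2 * dot (A *m e) r + dot (A *m e) (A *m e).
  have -> : dot v v = dot (r + A *m e) (r + A *m e) by rewrite -vE.
  by rewrite !(dotDl, dotDr) (dotC r (_ *m _)); ring.
rewrite /ridge_energy vv h.
by rewrite !(dotDl, dotDr, dotNl, dotNr) (dotC D e); ring.
Qed.

Lemma ridge_res_le A v D :
  dot (ridge_res A v D) (ridge_res A v D) <= ridge_energy v D.
Proof.
rewrite (ridge_energyE A) -!addrA lerDl.
by rewrite !addr_ge0 ?dot_ge0// mulr_ge0 ?dot_ge0// ltW.
Qed.

Lemma ridge_le A v D : dot (ridge A v D) (ridge A v D) <= ridge_energy v D / t.
Proof.
rewrite ler_pdivlMr// mulrC (ridge_energyE A) lerDr.
by rewrite !addr_ge0 ?dot_ge0// mulr_ge0 ?dot_ge0// ltW.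
Qed.

Lemma ridge_energy_ge0 v D : 0 <= ridge_energy v D.
Proof. by rewrite addr_ge0 ?dot_ge0// mulr_ge0 ?dot_ge0// ltW. Qed.

Lemma ridgeD A v1 v2 D1 D2 :
  ridge A (v1 + v2) (D1 + D2) = ridge A v1 D1 + ridge A v2 D2.
Proof.
by rewrite /ridge -mulmxDr; congr (_ *m _); rewrite mulmxDr scalerDr addrACA.
Qed.

Lemma ridgeZ A a v D : ridge A (a *: v) (a *: D) = a *: ridge A v D.
Proof.
rewrite /ridge scalemxAr; congr (_ *m _).
by rewrite -scalemxAr scalerDr !scalerA mulrC.
Qed.

Lemma ridge0 A : ridge A 0 0 = 0.
Proof. by rewrite /ridge mulmx0 scaler0 addr0 mulmx0. Qed.

Lemma ridge_resD A v1 v2 D1 D2 :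
  ridge_res A (v1 + v2) (D1 + D2) = ridge_res A v1 D1 + ridge_res A v2 D2.
Proof. by rewrite /ridge_res ridgeD mulmxDr opprD addrACA. Qed.

Lemma ridge_resZ A a v D : ridge_res A (a *: v) (a *: D) = a *: ridge_res A v D.
Proof. by rewrite /ridge_res ridgeZ -scalemxAr scalerBr. Qed.

Lemma ridge_res0 A : ridge_res A 0 0 = 0.
Proof. by rewrite /ridge_res ridge0 mulmx0 subr0. Qed.

(** With [G] the inverse of [gram A], these four are the columns of [G], [G A^T], [- A G] and
    [1 - A G A^T]. The derivatives of error and residual in an entry of [A] involve nothing else. *)
Definition ridge_prior A i := ridge A 0 (t^-1 *: delta_mx i 0).
Definition ridge_noise A m := ridge A (delta_mx m 0) 0.
Definition res_prior A i := ridge_res A 0 (t^-1 *: delta_mx i 0).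
Definition res_noise A m := ridge_res A (delta_mx m 0) 0.

Lemma trmx_perturb A h m i :
  (A + h *: delta_mx m i)^T = A^T + h *: delta_mx i m.
Proof. by apply/matrixP => a b; rewrite !mxE andbC. Qed.

Lemma gram_delta A h m i :
  gram (A + h *: delta_mx m i) - gram A =
  h *: (delta_mx i m *m (A + h *: delta_mx m i)) + h *: (A^T *m delta_mx m i).
Proof.
rewrite /gram trmx_perturb opprD addrACA subrr addr0.
rewrite mulmxDl [A^T *m (_ + _)]mulmxDr -scalemxAl -scalemxAr.
by rewrite addrC -addrA addKr addrC.
Qed.

(** The resolvent identity for a change of one entry. It is exact: the coefficients are taken at the
    perturbed matrix and the columns at the original one, so a single formula yields first
    continuity in [h] and then the derivative at [0]. *)
Lemma ridge_perturb A h m i v D :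
  let A' := A + h *: delta_mx m i in
  ridge A' v D - ridge A v D =
  h *: (ridge_res A' v D m 0 *: ridge_prior A i -
        ridge A' v D i 0 *: ridge_noise A m).
Proof.
move=> A'; set e := ridge A v D; set e' := ridge A' v D.
set r' := ridge_res A' v D.
have -> : h *: (r' m 0 *: ridge_prior A i - e' i 0 *: ridge_noise A m) =
    ridge A (h *: (- e' i 0 *: delta_mx m 0))
      (h *: (r' m 0 *: (t^-1 *: delta_mx i 0))).
  rewrite ridgeZ; congr (_ *: _); rewrite -scaleNr -!ridgeZ !scaler0 -ridgeD.
  by rewrite add0r addr0.
apply: ridge_unique.
rewrite mulmxBr [gram A *m e]gram_ridge.
have -> : gram A *m e' = (A'^T *m v + t *: D) - (gram A' - gram A) *m e'.
  by rewrite mulmxBl gram_ridge opprB addrC subrK.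
rewrite gram_delta -/A' mulmxDl -!scalemxAl -!mulmxA !mulmx_delta_col.
rewrite {1}/A' trmx_perturb mulmxDl -scalemxAl mulmx_delta_col.
have -> : r' m 0 = v m 0 - (A' *m e') m 0 by rewrite /r' /ridge_res !mxE.
rewrite -!scalemxAr !scalerA; clearbody e'.
apply/colP => j; rewrite !mxE.
by field; rewrite gt_eqF.
Qed.

End ridge.

(** * Measurability of matrix functions *)

Lemma measurable_inv (R : realType) : measurable_fun setT (@GRing.inv R).
Proof.
rewrite -(setvU [set 0]); apply/measurable_funU => //; first exact: measurableC.
split; last exact: measurable_fun_set1.
apply: open_continuous_measurable_fun; first by apply: closed_openC; apply: accessible_closed_set1; exact/hausdorff_accessible/Rhausdorff.
by move=> x; rewrite inE => /= /eqP x0; exact: inv_continuous.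
Qed.

Section measurable_matrix_functions.
Context {R : realType} d (W : measurableType d).

Definition measurable_mx m n (B : W -> 'M[R]_(m, n)) :=
  forall i j, measurable_fun setT (fun w => B w i j).

Lemma measurable_mx_cst m n (B : 'M[R]_(m, n)) : measurable_mx (fun=> B).
Proof. by move=> i j; exact: measurable_cst. Qed.

Lemma measurable_mxD m n (B C : W -> 'M[R]_(m, n)) :
  measurable_mx B -> measurable_mx C -> measurable_mx (fun w => B w + C w).
Proof.
by move=> mB mC i j; under eq_fun do rewrite mxE; exact: measurable_funD.
Qed.

Lemma measurable_mxB m n (B C : W -> 'M[R]_(m, n)) :
  measurable_mx B -> measurable_mx C -> measurable_mx (fun w => B w - C w).
Proof.
by move=> mB mC i j; under eq_fun do rewrite !mxE; exact: measurable_funB.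
Qed.

Lemma measurable_mxM m n k (B : W -> 'M[R]_(m, n)) (C : W -> 'M[R]_(n, k)) :
  measurable_mx B -> measurable_mx C -> measurable_mx (fun w => B w *m C w).
Proof.
move=> mB mC i j; under eq_fun do rewrite mxE.
by apply: measurable_sum => l; exact: measurable_funM.
Qed.

Lemma measurable_mxT m n (B : W -> 'M[R]_(m, n)) :
  measurable_mx B -> measurable_mx (fun w => (B w)^T).
Proof. by move=> mB i j; under eq_fun do rewrite mxE; exact: mB. Qed.

Lemma measurable_mxZ m n c (B : W -> 'M[R]_(m, n)) :
  measurable_mx B -> measurable_mx (fun w => c *: B w).
Proof.
by move=> mB i j; under eq_fun do rewrite mxE; exact: measurable_funM.
Qed.

Lemma measurable_det n (B : W -> 'M[R]_n) :
  measurable_mx B -> measurable_fun setT (fun w => \det (B w)).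
Proof.
move=> mB; apply: measurable_sum => s; apply: measurable_funM => //.
by apply: measurable_prod => i _; exact: mB.
Qed.

Lemma measurable_invmx n (B : W -> 'M[R]_n) : (forall w, B w \in unitmx) ->
  measurable_mx B -> measurable_mx (fun w => invmx (B w)).
Proof.
move=> uB mB i j; under eq_fun do rewrite /invmx uB mxE.
apply: measurable_funM.
  apply: measurableT_comp; last exact: measurable_det.
  exact: measurable_inv.
under eq_fun do rewrite mxE; apply: measurable_funM => //.
by apply: measurable_det => k l; under eq_fun do rewrite !mxE; exact: mB.
Qed.

End measurable_matrix_functions.

(** * Classes of matrix functions suited to integration by parts *)

Section regular_matrix_functions.
Context {R : realType} {M N : nat}.
Implicit Types (F G : 'M[R]_(M, N) -> R) (DF DG : 'M[R]_(M, N) -> 'M[R]_(M, N)).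

(** Measurability is tested along all maps with measurable entries, so no sigma-algebra on matrices
    is involved and the same function can be read on several source spaces. *)
Definition measurable_of_entries F := forall d (W : measurableType d)
  (B : W -> 'M[R]_(M, N)), measurable_mx B -> measurable_fun setT (fun w => F (B w)).

Definition entrywise_continuous F := forall A m i,
  continuous (fun h : R => F (A + h *: delta_mx m i)).

Definition regular0 F := [/\ measurable_of_entries F,
  (exists K, forall A, `|F A| <= K) & entrywise_continuous F].

(** Differentiating at [h = 0] is enough because the base point [A] is arbitrary; see
    [entrywise_derivative_at]. *)
Definition entrywise_derivative F DF := forall A m i,
  is_derive (0 : R) (1 : R) (fun h : R => F (A + h *: delta_mx m i)) (DF A m i).

(** What [entry_by_parts] consumes, in a form stable under sums, products and composition with
    smooth bounded functions. *)
Definition regular1 F DF := [/\ regular0 F, (forall m i, regular0 (fun A => DF A m i))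
  & entrywise_derivative F DF].

Lemma entrywise_derivative_at F DF A m i (h : R) : entrywise_derivative F DF ->
  is_derive h (1 : R) (fun h : R => F (A + h *: delta_mx m i))
    (DF (A + h *: delta_mx m i) m i).
Proof.
move=> /(_ (A + h *: delta_mx m i) m i) [d1 d2].
have E : (fun k => k^-1 *: (((fun h0 : R => F (A + h0 *: delta_mx m i)) \o
      shift h) (k *: (1 : R)) - F (A + h *: delta_mx m i))) =
    (fun k => k^-1 *: (((fun h0 : R => F (A + h *: delta_mx m i + h0 *: delta_mx m i)) \o
      shift 0) (k *: (1 : R)) - F (A + h *: delta_mx m i + 0 *: delta_mx m i))).
  apply/funext => k /=; rewrite scale0r addr0 addr0 -addrA -scalerDl.
  by rewrite [h + _]addrC.
by split; rewrite /derivable /derive E.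
Qed.

Lemma entrywise_derivative_continuous F DF :
  entrywise_derivative F DF -> entrywise_continuous F.
Proof.
move=> dF A m i h; apply: differentiable_continuous; apply/derivable1_diffP.
by case: (entrywise_derivative_at A m i h dF).
Qed.

Lemma regular0_cst c : regular0 (fun=> c).
Proof.
split; [by move=> *; exact: measurable_cst|by exists `|c| |].
by move=> *; exact: cst_continuous.
Qed.

Lemma regular0D F G : regular0 F -> regular0 G -> regular0 (fun A => F A + G A).
Proof.
move=> [mF [K FK] cF] [mG [L GL] cG]; split.
- by move=> d W B mB; apply: measurable_funD; [exact: mF|exact: mG].
- by exists (K + L) => A; rewrite (le_trans (ler_normD _ _))// lerD.
- by move=> A m i h; apply: cvgD; [exact: cF|exact: cG].
Qed.

Lemma regular0M F G : regular0 F -> regular0 G -> regular0 (fun A => F A * G A).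
Proof.
move=> [mF [K FK] cF] [mG [L GL] cG]; split.
- by move=> d W B mB; apply: measurable_funM; [exact: mF|exact: mG].
- by exists (K * L) => A; rewrite normrM ler_pM.
- by move=> A m i h; apply: cvgM; [exact: cF|exact: cG].
Qed.

Lemma regular0N F : regular0 F -> regular0 (fun A => - F A).
Proof.
move=> rF; under eq_fun do rewrite -mulN1r.
by apply: regular0M => //; exact: regular0_cst.
Qed.

Lemma regular0B F G : regular0 F -> regular0 G -> regular0 (fun A => F A - G A).
Proof. by move=> rF rG; apply: regular0D => //; exact: regular0N. Qed.

Lemma regular0_sum (I : Type) (s : seq I) (F : I -> 'M[R]_(M, N) -> R) :
  (forall i, regular0 (F i)) -> regular0 (fun A => \sum_(i <- s) F i A).
Proof.
move=> rF; elim: s => [|i s ih].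
  by under eq_fun do rewrite big_nil; exact: regular0_cst.
by under eq_fun do rewrite big_cons; exact: regular0D.
Qed.

Lemma regular0_comp (f : R -> R) F : continuous f ->
  (exists K, forall a, `|f a| <= K) -> regular0 F -> regular0 (fun A => f (F A)).
Proof.
move=> cf [K fK] [mF _ cF]; split; last 2 first.
- by exists K.
- by move=> A m i h; apply: continuous_comp; [exact: cF|exact: cf].
move=> d W B mB; apply: measurableT_comp; last exact: mF.
exact: continuous_measurable_fun.
Qed.

Lemma regular1_cst c : regular1 (fun=> c) (fun=> 0).
Proof.
split; first exact: regular0_cst.
- by move=> m i; under eq_fun do rewrite mxE; exact: regular0_cst.
- by move=> A m i; rewrite mxE; exact: is_derive_cst.
Qed.

Lemma regular1D F DF G DG : regular1 F DF -> regular1 G DG ->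
  regular1 (fun A => F A + G A) (fun A => DF A + DG A).
Proof.
move=> [rF rDF dF] [rG rDG dG]; split; first exact: regular0D.
- by move=> m i; under eq_fun do rewrite mxE; exact: regular0D.
- by move=> A m i; rewrite mxE; apply: is_deriveD.
Qed.

Lemma regular1M F DF G DG : regular1 F DF -> regular1 G DG ->
  regular1 (fun A => F A * G A) (fun A => F A *: DG A + G A *: DF A).
Proof.
move=> [rF rDF dF] [rG rDG dG]; split; first exact: regular0M.
- move=> m i; under eq_fun do rewrite !mxE.
  by apply: regular0D; exact: regular0M.
- move=> A m i; rewrite !mxE.
  have := is_deriveM (dF A m i) (dG A m i).
  by rewrite scale0r addr0.
Qed.

Lemma regular1Z c F DF : regular1 F DF ->
  regular1 (fun A => c * F A) (fun A => c *: DF A).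
Proof.
move=> rF; have := regular1M (regular1_cst c) rF.
by congr regular1; apply/funext => A; rewrite scaler0 addr0.
Qed.

Lemma regular1_sum (I : Type) (s : seq I) (F : I -> 'M[R]_(M, N) -> R)
  (DF : I -> 'M[R]_(M, N) -> 'M[R]_(M, N)) :
  (forall i, regular1 (F i) (DF i)) ->
  regular1 (fun A => \sum_(i <- s) F i A) (fun A => \sum_(i <- s) DF i A).
Proof.
move=> rF; elim: s => [|i s ih].
  have := regular1_cst 0; congr regular1; apply/funext => A; by rewrite big_nil.
have := regular1D (rF i) ih; congr regular1; apply/funext => A; by rewrite big_cons.
Qed.

Lemma regular1_comp (f f' : R -> R) F DF :
  (forall a : R, is_derive a (1 : R) f (f' a)) -> continuous f' ->
  (exists K, forall a, `|f a| <= K) -> (exists K, forall a, `|f' a| <= K) ->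
  regular1 F DF -> regular1 (fun A => f (F A)) (fun A => f' (F A) *: DF A).
Proof.
move=> df cf' bf bf' [rF rDF dF]; split.
- apply: regular0_comp => // a; apply: differentiable_continuous.
  by apply/derivable1_diffP; case: (df a).
- move=> m i; under eq_fun do rewrite mxE.
  by apply: regular0M => //; exact: regular0_comp.
- move=> A m i; rewrite mxE.
  have h : is_derive (F (A + 0 *: delta_mx m i)) (1 : R) f (f' (F A)).
    by rewrite scale0r addr0; exact: df.
  exact: (is_derive1_comp (g := fun h : R => F (A + h *: delta_mx m i)) h (dF A m i)).
Qed.

End regular_matrix_functions.

(** Caratheodory's form of differentiability, suited to [ridge_perturb], which provides the
    difference quotient in closed form. *)
Lemma is_derive_factor {R : realType} (f psi : R -> R) :
  (forall h, f h - f 0 = h * psi h) -> {for 0, continuous psi} ->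
  is_derive (0 : R) (1 : R) f (psi 0).
Proof.
move=> fE cpsi.
have c : psi h @[h --> 0^'] --> psi 0 by apply/continuous_withinNx.
have q : h^-1 *: ((f \o shift 0) (h *: (1 : R)) - f 0) @[h --> (0 : R)^'] --> psi 0.
  apply: cvg_trans c; apply: near_eq_cvg; near=> h.
  have h0 : h != 0 by near: h; exact: nbhs_dnbhs_neq.
  by rewrite /= addr0 /GRing.scale /= mulr1 fE mulKf.
by split; [apply/cvg_ex; exists (psi 0)|exact: cvg_lim].
Unshelve. all: by end_near. Qed.

(** * Regularity of the ridge error and residual *)

Section ridge_regular.
Context {R : realType} {M N : nat} (t : R).
Hypothesis t0 : 0 < t.
Implicit Types (A : 'M[R]_(M, N)) (v : 'cV[R]_M) (D : 'cV[R]_N).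
Local Notation ridge := (ridge t).
Local Notation ridge_res := (ridge_res t).
Local Notation ridge_prior := (ridge_prior t).
Local Notation ridge_noise := (ridge_noise t).
Local Notation res_prior := (res_prior t).
Local Notation res_noise := (res_noise t).

Lemma ridge_res_perturb A h m i v D :
  let A' := A + h *: delta_mx m i in
  ridge_res A' v D - ridge_res A v D =
  h *: (ridge_res A' v D m 0 *: res_prior A i - ridge A' v D i 0 *: res_noise A m).
Proof.
move=> A'; have := ridge_perturb t0 A h m i v D; rewrite -/A' /=.
set e' := ridge A' v D; set e := ridge A v D; set rm := ridge_res A' v D m 0 => eE.
have -> : ridge_res A' v D - ridge_res A v D =
    - (h *: (delta_mx m i *m e')) - A *m (e' - e).
  rewrite /ridge_res -/e' -/e {1}/A' mulmxDl -scalemxAl mulmxBr.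
  by apply/colP => j; rewrite !mxE; ring.
rewrite eE mulmx_delta_col /res_prior /res_noise /ridge_res !sub0r.
rewrite -!scalemxAr mulmxBr -!scalemxAr; apply/colP => j; rewrite !mxE; ring.
Qed.

Lemma measurable_ridge d (W : measurableType d) (B : W -> 'M[R]_(M, N))
    (V : W -> 'cV[R]_M) (E : W -> 'cV[R]_N) :
  measurable_mx B -> measurable_mx V -> measurable_mx E ->
  measurable_mx (fun w => ridge (B w) (V w) (E w)).
Proof.
move=> mB mV mE; apply: measurable_mxM.
  apply: measurable_invmx => [w|]; first exact: gram_unit.
  apply: measurable_mxD; last exact: measurable_mx_cst.
  by apply: measurable_mxM => //; exact: measurable_mxT.
apply: measurable_mxD; last exact: measurable_mxZ.
by apply: measurable_mxM => //; exact: measurable_mxT.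
Qed.

Lemma measurable_ridge_res d (W : measurableType d) (B : W -> 'M[R]_(M, N))
    (V : W -> 'cV[R]_M) (E : W -> 'cV[R]_N) :
  measurable_mx B -> measurable_mx V -> measurable_mx E ->
  measurable_mx (fun w => ridge_res (B w) (V w) (E w)).
Proof.
move=> mB mV mE; apply: measurable_mxB => //; apply: measurable_mxM => //.
exact: measurable_ridge.
Qed.

Lemma coord_bound n (u : 'cV[R]_n) i C : dot u u <= C -> `|u i 0| <= 1 + C.
Proof.
move=> uC; have := le_trans (sqr_coord_le_dot i u) uC.
rewrite -(real_normK (num_real _)).
by have := sqr_ge0 (`|u i 0| - 1); have := sqr_ge0 `|u i 0|; lra.
Qed.

Lemma ridge_coord_le A v D i : `|ridge A v D i 0| <= 1 + ridge_energy t v D / t.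
Proof. exact/coord_bound/ridge_le. Qed.

Lemma ridge_res_coord_le A v D m : `|ridge_res A v D m 0| <= 1 + ridge_energy t v D.
Proof. exact/coord_bound/ridge_res_le. Qed.

(** The coefficients [a] and [b] do not depend on [h], and the other factors are bounded by the
    energy, so [F] is Lipschitz along each entry. *)
Let perturb_bound (F : 'M[R]_(M, N) -> R) v D :
  (forall A m i, exists a b, forall h, let A' := A + h *: delta_mx m i in
    F A' - F A = h * (ridge_res A' v D m 0 * a - ridge A' v D i 0 * b)) ->
  entrywise_continuous F.
Proof.
move=> FE A m i h.
have [p [q pq]] := FE (A + h *: delta_mx m i) m i.
pose C := (1 + ridge_energy t v D) * `|p| + (1 + ridge_energy t v D / t) * `|q|.
have C0 : 0 <= C.
  have := ridge_energy_ge0 t0 v D => E0.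
  by rewrite addr_ge0// mulr_ge0// addr_ge0// divr_ge0// ltW.
have HC k : `|F (A + h *: delta_mx m i + k *: delta_mx m i) -
    F (A + h *: delta_mx m i)| <= C * `|k|.
  rewrite pq normrM mulrC ler_wpM2r//.
  apply: le_trans (ler_normB _ _) _; rewrite !normrM; apply: lerD.
    by rewrite ler_wpM2r// ridge_res_coord_le.
  by rewrite ler_wpM2r// ridge_coord_le.
apply/cvgrPdist_le => e e0.
have d0 : 0 < e / (C + 1) by rewrite divr_gt0// ltr_wpDl.
apply/nbhs_ballP; exists (e / (C + 1)) => //= k.
rewrite /ball /= distrC => /ltW hk; rewrite distrC.
have := HC (k - h); rewrite -addrA -scalerDl addrCA subrr addr0 => /le_trans; apply.
apply: le_trans (ler_wpM2l C0 hk) _.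
by rewrite mulrA ler_pdivrMr ?ltr_wpDl// mulrC ler_wpM2l ?(ltW e0)// lerDl.
Qed.

Let ridge_coordE A m i h v D j : let A' := A + h *: delta_mx m i in
  ridge A' v D j 0 - ridge A v D j 0 =
  h * (ridge_res A' v D m 0 * ridge_prior A i j 0 -
       ridge A' v D i 0 * ridge_noise A m j 0).
Proof.
move=> A'; transitivity ((ridge A' v D - ridge A v D) j 0); first by rewrite !mxE.
by rewrite ridge_perturb// !mxE.
Qed.

Let res_coordE A m i h v D j : let A' := A + h *: delta_mx m i in
  ridge_res A' v D j 0 - ridge_res A v D j 0 =
  h * (ridge_res A' v D m 0 * res_prior A i j 0 -
       ridge A' v D i 0 * res_noise A m j 0).
Proof.
move=> A'; transitivity ((ridge_res A' v D - ridge_res A v D) j 0).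
  by rewrite [RHS]mxE [X in _ = _ + X]mxE.
by rewrite ridge_res_perturb [LHS]mxE [X in _ * X]mxE [X in _ + X]mxE !mxE.
Qed.

Lemma regular0_ridge v D j : regular0 (fun A => ridge A v D j 0).
Proof.
split.
- by move=> d W B mB; apply: measurable_ridge => //; exact: measurable_mx_cst.
- by exists (1 + ridge_energy t v D / t) => A; exact: ridge_coord_le.
- apply: (@perturb_bound _ v D) => A m i.
  by exists (ridge_prior A i j 0), (ridge_noise A m j 0) => h; exact: ridge_coordE.
Qed.

Lemma regular0_ridge_res v D j : regular0 (fun A => ridge_res A v D j 0).
Proof.
split.
- by move=> d W B mB; apply: measurable_ridge_res => //; exact: measurable_mx_cst.
- by exists (1 + ridge_energy t v D) => A; exact: ridge_res_coord_le.
- apply: (@perturb_bound _ v D) => A m i.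
  by exists (res_prior A i j 0), (res_noise A m j 0) => h; exact: res_coordE.
Qed.

(** Letting [h] tend to [0] in the exact increment replaces the perturbed error and residual by the
    unperturbed ones, by the continuity just obtained. *)
Let derivative_of_perturb (F : 'M[R]_(M, N) -> R) (p q : 'I_M -> 'I_N -> 'M[R]_(M, N) -> R) v D :
  (forall A m i h, let A' := A + h *: delta_mx m i in
    F A' - F A = h * (ridge_res A' v D m 0 * p m i A - ridge A' v D i 0 * q m i A)) ->
  entrywise_derivative F
    (fun A => \matrix_(m, i) (ridge_res A v D m 0 * p m i A - ridge A v D i 0 * q m i A)).
Proof.
move=> FE A m i; rewrite mxE.
pose psi h := ridge_res (A + h *: delta_mx m i) v D m 0 * p m i A -
  ridge (A + h *: delta_mx m i) v D i 0 * q m i A.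
have -> : ridge_res A v D m 0 * p m i A - ridge A v D i 0 * q m i A = psi 0.
  by rewrite /psi scale0r addr0.
apply: is_derive_factor => [h|]; first by rewrite scale0r addr0 FE.
have [_ _ c1] := regular0_ridge_res v D m.
have [_ _ c2] := regular0_ridge v D i.
by apply: cvgB; (apply: cvgM; [exact: c1 || exact: c2|exact: cvg_cst]).
Qed.

Definition Dridge v D j A : 'M[R]_(M, N) := \matrix_(m, i)
  (ridge_res A v D m 0 * ridge_prior A i j 0 - ridge A v D i 0 * ridge_noise A m j 0).

Definition Dridge_res v D j A : 'M[R]_(M, N) := \matrix_(m, i)
  (ridge_res A v D m 0 * res_prior A i j 0 - ridge A v D i 0 * res_noise A m j 0).

Lemma DridgeE v D j A m i : Dridge v D j A m i =
  ridge_res A v D m 0 * ridge_prior A i j 0 - ridge A v D i 0 * ridge_noise A m j 0.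
Proof. by rewrite mxE. Qed.

Lemma Dridge_resE v D j A m i : Dridge_res v D j A m i =
  ridge_res A v D m 0 * res_prior A i j 0 - ridge A v D i 0 * res_noise A m j 0.
Proof. by rewrite mxE. Qed.

Lemma regular1_ridge v D j : regular1 (fun A => ridge A v D j 0) (Dridge v D j).
Proof.
split; first exact: regular0_ridge.
- move=> m i; under eq_fun do rewrite mxE.
  apply: regular0B; apply: regular0M; exact: regular0_ridge || exact: regular0_ridge_res.
- exact: derivative_of_perturb (fun A m i h => ridge_coordE A m i h v D j).
Qed.

Lemma regular1_ridge_res v D j :
  regular1 (fun A => ridge_res A v D j 0) (Dridge_res v D j).
Proof.
split; first exact: regular0_ridge_res.
- move=> m i; under eq_fun do rewrite mxE.
  apply: regular0B; apply: regular0M; exact: regular0_ridge || exact: regular0_ridge_res.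
- exact: derivative_of_perturb (fun A m i h => res_coordE A m i h v D j).
Qed.

End ridge_regular.

(** * Laws, generated sigma-algebras and the Gaussian law on the line *)

Section law_transfer.
Context d (T : measurableType d) (R : realType) (P : probability T R).
Context d' (E : measurableType d') (X : {mfun T >-> E}).
Variable mu : {measure set E -> \bar R}.
Hypothesis lawX : has_law P X mu.

Lemma eq_integral_law (f : E -> \bar R) :
  (\int[distribution P X]_x f x = \int[mu]_x f x)%E.
Proof. by apply: eq_measure_integral => A mA _; exact: lawX. Qed.

Lemma eq_Rintegral_law (f : E -> R) :
  \int[distribution P X]_x f x = \int[mu]_x f x.
Proof. by rewrite /Rintegral eq_integral_law. Qed.

Lemma integrable_law (f : E -> R) : mu.-integrable setT (EFin \o f) ->
  P.-integrable setT (EFin \o (f \o X)).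
Proof.
move=> /integrableP[mf fi]; apply/integrableP; split.
  by apply: measurableT_comp mf _; exact: measurable_funPT.
apply: le_lt_trans fi; rewrite -eq_integral_law ge0_integral_distribution//.
exact: measurableT_comp.
Qed.

Lemma Rintegral_law (f : E -> R) : mu.-integrable setT (EFin \o f) ->
  \int[P]_w f (X w) = \int[mu]_x f x.
Proof.
move=> fi; have fiP := integrable_law fi.
rewrite -eq_Rintegral_law /Rintegral integral_distribution//.
exact: measurable_int fi.
Qed.

End law_transfer.

Section independence_of_generated.
Context d (T : measurableType d) (R : realType) (P : probability T R).

(* The pi-lambda step. *)
Lemma independent_generated (B : set T) (G : set (set T)) :
  measurable B -> G `<=` measurable -> setI_closed G -> G setT ->
  (forall C, G C -> P (B `&` C) = (P B * P C)%E) ->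
  forall C, <<s G >> C -> P (B `&` C) = (P B * P C)%E.
Proof.
move=> mB Gm GI GT ind C GC.
have PBfin : P B = (fine (P B))%:E by rewrite fineK// fin_num_measure.
have PB0 : 0 <= fine (P B) by rewrite fine_ge0.
pose m2 : {measure set T -> \bar R} := mscale (NngNum PB0) P.
pose m1 : {measure set T -> \bar R} := mrestr P mB.
have cover : \bigcup_(k : nat) [set: T] = [set: T].
  by apply/seteqP; split => // x _; exists 0%N.
have E := g_sigma_algebra_measure_unique G Gm (fun=> setT) (fun=> GT) cover m1 m2.
rewrite setIC -[LHS]/(m1 C) E//.
- by rewrite /m2/= /mscale/= -PBfin.
- by move=> D GD; rewrite /m1 /m2/= /mscale/mrestr/= -PBfin -ind// setIC.
- by move=> k; rewrite /m1 /= /mrestr setTI ltey_eq fin_num_measure.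
Qed.

End independence_of_generated.

Section sub_sigma_algebra.
Context d (T : measurableType d) (G : set (set T)).
Hypothesis Gm : G `<=` measurable.

(** The identity, viewed as a random element of the space with the smaller sigma-algebra. Applying
    Fubini to it amounts to conditioning on [G]. *)
Definition to_sub (w : T) : g_sigma_algebraType G := w.

Lemma measurable_to_sub : measurable_fun setT to_sub.
Proof.
move=> _ B mB; rewrite setTI.
exact: (smallest_sub (@sigma_algebra_measurable _ T) Gm).
Qed.

Definition sub_mfun : {mfun T >-> g_sigma_algebraType G} :=
  HB.pack to_sub (isMeasurableFun.Build _ _ _ _ to_sub measurable_to_sub).

End sub_sigma_algebra.

(* normal_prob lives on the alias measurableTypeR R; transporting it along the
   identity gives a measure on R itself. *)
Section gauss.
Context {R : realType}.

Let measurable_idR : measurable_fun setT (fun a : measurableTypeR R => a : R).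
Proof. by move=> _ B mB; rewrite setTI. Qed.

Let idR : {mfun (measurableTypeR R) >-> R} :=
  HB.pack (fun a : measurableTypeR R => a : R)
    (isMeasurableFun.Build _ _ _ _ _ measurable_idR).

Definition gauss (s : R) : probability R R := distribution (normal_prob 0 s) idR.

Lemma integrable_gauss s (f : R -> R) :
  (normal_prob 0 s).-integrable setT (EFin \o f) -> (gauss s).-integrable setT (EFin \o f).
Proof.
move=> /integrableP[mf fi]; apply/integrableP; split => //.
rewrite /gauss ge0_integral_distribution//; exact: measurableT_comp.
Qed.

Lemma Rintegral_gauss s (f : R -> R) :
  (normal_prob 0 s).-integrable setT (EFin \o f) ->
  \int[gauss s]_a f a = \int[normal_prob 0 s]_a f a.
Proof.
move=> fi; rewrite /Rintegral /gauss integral_distribution//.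
exact: measurable_int fi.
Qed.

Variable s : R.
Hypothesis s0 : 0 < s.

Lemma gauss_integrable (f : R -> R) : bounded_mfun f -> (gauss s).-integrable setT (EFin \o f).
Proof. exact: bounded_mfun_integrable. Qed.

Lemma gauss_by_parts (F f : R -> R) K :
  (forall a : R, is_derive a (1 : R) F (f a)) -> continuous f ->
  (forall a, `|F a| <= K * (1 + `|a|)) -> (forall a, `|f a| <= K) ->
  (gauss s).-integrable setT (EFin \o (fun a : R => a * F a)) /\
  \int[gauss s]_a (a * F a) = s ^+ 2 * \int[gauss s]_a f a.
Proof.
move=> dF cf FK fK; have [i e] := normal_prob_by_parts s0 dF cf FK fK.
split; first exact: integrable_gauss.
rewrite Rintegral_gauss// e Rintegral_gauss//.
apply: bounded_mfun_integrable; split; last by exists K.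
exact: continuous_measurable_fun.
Qed.

Lemma gauss_mean : (gauss s).-integrable setT (EFin \o id) /\ \int[gauss s]_a a = 0.
Proof.
have [i e] := normal_prob_mean s0.
by split; [exact: integrable_gauss|rewrite Rintegral_gauss].
Qed.

Lemma gauss_second_moment :
  (gauss s).-integrable setT (EFin \o (fun a : R => a ^+ 2)) /\
  \int[gauss s]_a a ^+ 2 = s ^+ 2.
Proof.
have [i e] := normal_prob_second_moment s0.
by split; [exact: integrable_gauss|rewrite Rintegral_gauss].
Qed.

End gauss.

(** * Integration by parts in one entry of a Gaussian matrix *)

Section gaussian_entries.
Context d (T : measurableType d) (R : realType) (P : probability T R).
Context {M N : nat} (A : 'I_M -> 'I_N -> {RV P >-> R}) (s : R).
Hypothesis s0 : 0 < s.
Hypothesis A_law : forall m n, has_law P (A m n) (gauss s).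
Hypothesis A_ind : mutually_independent P (fun mn : 'I_M * 'I_N => A mn.1 mn.2 : T -> R).

Definition random_mx w : 'M[R]_(M, N) := \matrix_(m, n) A m n w.

Lemma measurable_random_mx : measurable_mx random_mx.
Proof. by move=> m n; under eq_fun do rewrite mxE; exact: measurable_funPT. Qed.

Lemma bounded_regular0 F : regular0 F -> bounded_mfun (fun w => F (random_mx w)).
Proof.
move=> [mF [K FK] _]; split; last by exists K.
by apply: mF; exact: measurable_random_mx.
Qed.

Variables (m : 'I_M) (n : 'I_N).

(** A pi-system generating the sigma-algebra of all entries other than [(m, n)]. *)
Let G : set (set T) := [set C | exists2 B : 'I_M * 'I_N -> set R,
  (forall p, measurable (B p)) /\ B (m, n) = setT &
  C = \bigcap_p (A p.1 p.2 @^-1` B p)].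

Let mA p (B : set R) : measurable B -> measurable (A p.1 p.2 @^-1` B).
Proof. by move=> mB; rewrite -[_ @^-1` _]setTI; exact: measurable_funPT. Qed.

Let Gm : G `<=` measurable.
Proof.
move=> _ [B [mB _] ->]; apply: fin_bigcap_measurable => // p _; exact: mA.
Qed.

Let GT : G setT.
Proof.
exists (fun=> setT) => //; apply/seteqP; split => // w _ p _ //.
Qed.

Let GI : setI_closed G.
Proof.
move=> _ _ [B [mB B0] ->] [C [mC C0] ->].
exists (fun p => B p `&` C p); first by split => [p|]; [exact: measurableI|rewrite B0 C0 setTI].
rewrite -bigcapI; apply: eq_bigcapr => p _; by rewrite preimage_setI.
Qed.

Let ind_G (B : set R) C : measurable B -> <<s G >> C ->
  P (A m n @^-1` B `&` C) = (P (A m n @^-1` B) * P C)%E.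
Proof.
move=> mB; apply: independent_generated => //; first exact: (mA (m, n)).
move=> _ [D [mD D0] ->].
pose D' p := if p == (m, n) then B else D p.
have mD' p : measurable (D' p) by rewrite /D'; case: ifP.
have sig E : (forall p, measurable (E p)) -> forall p, sigma_rv (A p.1 p.2 : T -> R) (A p.1 p.2 @^-1` E p).
  by move=> mE p; exists (E p) => //; rewrite setTI.
have -> : A m n @^-1` B `&` \bigcap_p A p.1 p.2 @^-1` D p =
    \bigcap_p A p.1 p.2 @^-1` D' p.
  apply/seteqP; split => [w [wB wD] p _|w wD].
    by rewrite /D'; case: eqP => [->//|_]; exact: wD.
  split; first by have := wD (m, n) I; rewrite /D' eqxx.
  move=> p _; have := wD p I; rewrite /D'; case: eqP => // -> _.
  by rewrite D0.
rewrite (A_ind (sig _ mD')) (A_ind (sig _ mD)).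
rewrite [in LHS](bigD1 (m, n))//= [in RHS](bigD1 (m, n))//=.
rewrite {1}/D' eqxx D0 preimage_setT probability_setT mul1e.
by congr (_ * _)%E; apply: eq_bigr => p pmn; rewrite /D' (negbTE pmn).
Qed.

(** With the other entries frozen, this is [gauss_by_parts] in the single variable [A m n]; Fubini
    over the independent pair (other entries, this entry) restores the expectation. *)
Lemma entry_by_parts F DF : regular1 F DF ->
  P.-integrable setT (EFin \o (fun w => A m n w * F (random_mx w))) /\
  \int[P]_w (A m n w * F (random_mx w)) =
  s ^+ 2 * \int[P]_w DF (random_mx w) m n.
Proof.
move=> rF; have [rF0 rDF dF] := rF.
have iA : P.-integrable setT (EFin \o (fun w => A m n w * F (random_mx w))).
  have [mF [K FK]] := bounded_regular0 rF0.
  have [i1 _] := gauss_mean s0.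
  have i2 := integrable_law (A_law m n) i1.
  apply: (@le_integrable _ _ _ P setT measurableT _
    (fun w => K%:E * (A m n w)%:E)%E).
  - by apply/measurable_EFinP/measurable_funM.
  - move=> w _ /=; rewrite lee_fin !normrM mulrC ler_wpM2r//.
    by apply: le_trans (FK w) _; exact: ler_norm.
  - exact: integrableZl.
split => //.
pose V := sub_mfun Gm.
(* The matrix as a function of the pair (other entries, value put at [(m, n)]). It must be
   measurable for the smaller sigma-algebra in its first argument. *)
pose repl (p : g_sigma_algebraType G * R) : 'M[R]_(M, N) :=
  \matrix_(k, l) if (k, l) == (m, n) then p.2 else A k l p.1.
have mrepl : measurable_mx repl.
  move=> k l; under eq_fun do rewrite mxE.
  case: (boolP ((k, l) == (m, n))) => [_|kl]; first exact: measurable_snd.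
  have mAkl : measurable_fun setT (A k l : g_sigma_algebraType G -> R).
    move=> _ B mB; rewrite setTI; apply: sub_sigma_algebra.
    exists (fun p => if p == (k, l) then B else setT).
      split; first by move=> p; case: ifP.
      by rewrite eq_sym (negbTE kl).
    apply/seteqP; split => [w wB p _|w /(_ (k, l) I)]; last by rewrite eqxx.
    by case: eqP => // ->.
  exact: (measurableT_comp mAkl measurable_fst).
have replE w : repl (V w, A m n w) = random_mx w.
  by apply/matrixP => k l; rewrite !mxE; case: eqP => // -[-> ->].
have indVA : forall B C, measurable B -> measurable C ->
    P (V @^-1` B `&` A m n @^-1` C) = (P (V @^-1` B) * P (A m n @^-1` C))%E.
  by move=> B C mB mC; rewrite setIC muleC ind_G.
transitivity (\int[P]_w (A m n w * F (repl (V w, A m n w)))).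
  by apply: eq_Rintegral => w _; rewrite replE.
rewrite (integral_independent indVA (f := fun p => p.2 * F (repl p))); first last.
- by move: iA; congr integrable; apply/funext => w /=; rewrite replE.
- by apply: measurable_funM => //; have [mF _ _] := rF0; exact: mF.
have mDF := rDF m n.
have bDF := bounded_regular0 mDF.
rewrite -RintegralZl//; last exact: bounded_mfun_integrable.
transitivity (\int[P]_w (s ^+ 2 * DF (repl (V w, A m n w)) m n)); last first.
  by apply: eq_Rintegral => w _; rewrite replE.
rewrite (integral_independent indVA (f := fun p => s ^+ 2 * DF (repl p) m n)); first last.
- have := integrableZl measurableT (s ^+ 2) (bounded_mfun_integrable (P := P) bDF).
  by congr integrable; apply/funext => w /=; rewrite replE EFinM.
- by apply: measurable_funM => //; have [mF _ _] := mDF; exact: mF.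
apply: eq_Rintegral => w _; rewrite !(eq_Rintegral_law (A_law m n)).
pose A0 : 'M[R]_(M, N) := repl (w, 0).
have A0E a : repl (w, a) = A0 + a *: delta_mx m n.
  apply/matrixP => k l; rewrite !mxE; case: eqP => [[-> ->]|kl].
    by rewrite !eqxx mulr1 add0r.
  case: eqP => [k1|_]; last by rewrite mulr0 addr0.
  by case: eqP => [l1|_]; [case: kl; rewrite k1 l1|rewrite mulr0 addr0].
have [mF [K FK] cF] := rF0; have [mDF' [L DL] cDF] := mDF.
have dF' (a : R) : is_derive a (1 : R) (fun a => F (repl (w, a))) (DF (repl (w, a)) m n).
  under eq_fun do rewrite A0E; rewrite A0E.
  exact: entrywise_derivative_at.
have cDF' : continuous (fun a => DF (repl (w, a)) m n).
  by under eq_fun do rewrite A0E; exact: cDF.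
have [|a|_ ->] := gauss_by_parts s0 dF' cDF' (K := Num.max K L).
- move=> a; rewrite (le_trans (FK _))//.
  have K0 : 0 <= Num.max K L by rewrite le_max (le_trans _ (FK A0)).
  by apply: (@le_trans _ _ (Num.max K L)); rewrite ?le_max ?lexx// ler_peMr// lerDl.
- by rewrite (le_trans (DL _))// le_max lexx orbT.
rewrite RintegralZl//.
apply: gauss_integrable; split; last by exists L => a; exact: DL.
exact: continuous_measurable_fun.
Qed.

End gaussian_entries.

(** * Duality, trace and gradient bounds for the ridge problem *)

Section ridge_identities.
Context {R : realType} {M N : nat} (t : R).
Hypothesis t0 : 0 < t.
Implicit Types (A : 'M[R]_(M, N)) (v : 'cV[R]_M) (D : 'cV[R]_N).
Local Notation ridge := (ridge t).
Local Notation ridge_res := (ridge_res t).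
Local Notation ridge_prior := (ridge_prior t).
Local Notation ridge_noise := (ridge_noise t).
Local Notation res_prior := (res_prior t).
Local Notation res_noise := (res_noise t).
Local Notation ridge_energy := (ridge_energy t).

Definition trG A : R := \sum_i ridge_prior A i i 0.

(** Symmetry of the resolvent moves [psi] onto the data. Through this duality, sums of resolvent
    columns over coordinates collapse into single ridge solutions in the [sum_] lemmas below. *)
Lemma dot_ridge A v D psi : dot psi (ridge A v D) =
  t * dot (ridge A 0 (t^-1 *: psi)) D - dot (ridge_res A 0 (t^-1 *: psi)) v.
Proof.
set u := ridge A 0 (t^-1 *: psi).
have -> : ridge_res A 0 (t^-1 *: psi) = - (A *m u) by rewrite /ridge_res sub0r.
have uE : gram t A *m u = psi.
  by rewrite gram_ridge// mulmx0 add0r scalerA divff ?scale1r// gt_eqF.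
rewrite -{1}uE dot_adjoint gram_sym gram_ridge// dotDr dotZr -dot_adjoint.
by rewrite dotNl opprK addrC.
Qed.

Lemma dot_ridge_res A v D chi : dot chi (ridge_res A v D) =
  dot (ridge_res A chi 0) v - t * dot (ridge A chi 0) D.
Proof.
have E : ridge A 0 (t^-1 *: (A^T *m chi)) = ridge A chi 0.
  by rewrite /ridge mulmx0 add0r scalerA divff ?gt_eqF// scale1r scaler0 addr0.
rewrite {1}/ridge_res dotBr -[A]trmxK -dot_adjoint trmxK dot_ridge E.
rewrite /ridge_res sub0r E !dotBl dotNl; ring.
Qed.

Lemma ridge_priorC A i j : ridge_prior A i j 0 = ridge_prior A j i 0.
Proof.
rewrite -(dot_delta j) dot_ridge dot0r subr0 dotZr mulrA divff ?gt_eqF// mul1r.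
by rewrite dotC dot_delta.
Qed.

Lemma sum_ridge_prior A i (psi : 'cV[R]_N) :
  \sum_j psi j 0 * ridge_prior A i j 0 = ridge A 0 (t^-1 *: psi) i 0.
Proof.
rewrite -/(dot psi (ridge_prior A i)) dot_ridge dot0r subr0 dotZr mulrA.
by rewrite divff ?gt_eqF// mul1r dotC dot_delta.
Qed.

Lemma sum_ridge_noise A m (psi : 'cV[R]_N) :
  \sum_j psi j 0 * ridge_noise A m j 0 = - ridge_res A 0 (t^-1 *: psi) m 0.
Proof.
rewrite -/(dot psi (ridge_noise A m)) dot_ridge dot0r mulr0 sub0r.
by rewrite dotC dot_delta.
Qed.

Lemma sum_res_prior A i (chi : 'cV[R]_M) :
  \sum_m chi m 0 * res_prior A i m 0 = - ridge A chi 0 i 0.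
Proof.
rewrite -/(dot chi (res_prior A i)) dot_ridge_res dot0r sub0r dotZr mulrA.
by rewrite divff ?gt_eqF// mul1r dotC dot_delta.
Qed.

Lemma sum_res_noise A m (chi : 'cV[R]_M) :
  \sum_k chi k 0 * res_noise A m k 0 = ridge_res A chi 0 m 0.
Proof.
rewrite -/(dot chi (res_noise A m)) dot_ridge_res dot0r mulr0 subr0.
by rewrite dotC dot_delta.
Qed.

Lemma ridge_linear_prior A (psi : 'cV[R]_N) :
  ridge A 0 (t^-1 *: psi) = \sum_i psi i 0 *: ridge_prior A i.
Proof.
apply/colP => j; rewrite -sum_ridge_prior summxE.
by apply: eq_bigr => i _; rewrite [RHS]mxE; congr (_ * _); exact: ridge_priorC.
Qed.

Lemma ridge_prior_ge0 A i : 0 <= ridge_prior A i i 0.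
Proof.
have := dot_ridge A 0 (t^-1 *: delta_mx i 0) (delta_mx i 0).
have := gram_ridge t0 A 0 (t^-1 *: delta_mx i 0).
rewrite mulmx0 add0r scalerA divff ?gt_eqF// scale1r => E _.
rewrite -(dot_delta i) -E dotC /gram mulmxDl dotDr -mulmxA -dot_adjoint.
by rewrite mul_scalar_mx dotZr addr_ge0 ?dot_ge0// mulr_ge0 ?dot_ge0// ltW.
Qed.

Lemma energy_prior (psi : 'cV[R]_N) : ridge_energy (0 : 'cV[R]_M) (t^-1 *: psi) = dot psi psi / t.
Proof. by rewrite /ridge_energy dot0l add0r dotZl dotZr; field; rewrite gt_eqF. Qed.

Lemma energy_noise (chi : 'cV[R]_M) : ridge_energy chi (0 : 'cV[R]_N) = dot chi chi.
Proof. by rewrite /ridge_energy dot0l mulr0 addr0. Qed.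

(** The square of [G_ii] is at most the squared norm of the column [G e_i], which the energy bounds
    by [t^-1 / t]. *)
Lemma ridge_prior_le A i : ridge_prior A i i 0 <= t^-1.
Proof.
have h := ridge_le t0 A 0 (t^-1 *: delta_mx i 0).
have h2 := le_trans (sqr_coord_le_dot i _) h.
have dd : dot (delta_mx i 0) (delta_mx i 0 : 'cV[R]_N) = 1.
  by rewrite dot_delta mxE !eqxx.
move: h2; rewrite energy_prior dd -/(ridge_prior A i) => h2.
have := ridge_prior_ge0 A i; set x := ridge_prior A i i 0 in h2 * => x0.
rewrite -(ler_pXn2r (n := 2))// ?nnegrE ?invr_ge0 ?(ltW t0)//.
by apply: le_trans h2 _; rewrite mul1r expr2.
Qed.

(** By cyclicity, the trace of [A G A^T] is that of [G (gram A - t)], that is, [N - t tr G]. *)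
Lemma trace_res_noise A :
  \sum_m res_noise A m m 0 = M%:R - N%:R + t * trG A.
Proof.
have tG : trG A = \tr (invmx (gram t A)).
  apply: eq_bigr => i _.
  have -> : ridge_prior A i = col i (invmx (gram t A)).
    by rewrite colE /ridge_prior /ridge mulmx0 add0r scalerA divff ?gt_eqF// scale1r.
  by rewrite mxE.
have nE m : res_noise A m m 0 = 1 - (A *m invmx (gram t A) *m A^T) m m.
  have -> : res_noise A m = delta_mx m 0 - col m (A *m invmx (gram t A) *m A^T).
    by rewrite colE /res_noise /ridge_res /ridge scaler0 addr0 !mulmxA.
  have subE (X Y : 'cV[R]_M) : (X - Y) m 0 = X m 0 - Y m 0 by rewrite !mxE.
  by rewrite subE [X in X - _]mxE !eqxx; congr (_ - _); rewrite mxE.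
under eq_bigr do rewrite nE.
rewrite sumrB -/(\tr (A *m invmx (gram t A) *m A^T)) -mulmxA mxtrace_mulC -mulmxA.
have -> : A^T *m A = gram t A - t%:M by rewrite /gram addrK.
rewrite mulmxBr mulVmx ?gram_unit// mul_mx_scalar linearB linearZ /= mxtrace1 -tG.
rewrite big_const_ord iter_addr_0; ring.
Qed.

Lemma ridge_res_energy A v D :
  dot (ridge_res A v D) (ridge_res A v D) =
  dot v (ridge_res A v D) - t * (dot (ridge A v D) (ridge A v D) - dot D (ridge A v D)).
Proof.
rewrite {1}/ridge_res dotBl dot_adjoint ridge_kkt// dotZr dotBr.
by rewrite (dotC D).
Qed.

Lemma sum_sqr_outer (u p : 'cV[R]_M) (x y : 'cV[R]_N) :
  \sum_m \sum_i (u m 0 * x i 0 + p m 0 * y i 0) ^+ 2 <=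
  2 * dot u u * dot x x + 2 * dot p p * dot y y.
Proof.
apply: (@le_trans _ _ (\sum_m \sum_i (2 * (u m 0 ^+ 2 * x i 0 ^+ 2) +
    2 * (p m 0 ^+ 2 * y i 0 ^+ 2)))).
  apply: ler_sum => m _; apply: ler_sum => i _.
  by have := sqr_ge0 (u m 0 * x i 0 - p m 0 * y i 0); nra.
rewrite le_eqVlt; apply/orP; left; apply/eqP.
under eq_bigr do rewrite big_split /= -!mulr_sumr.
have sqE n (z : 'cV[R]_n) : \sum_i z i 0 ^+ 2 = dot z z.
  by apply: eq_bigr => i _; rewrite expr2.
under eq_bigr do rewrite !sqE.
by rewrite big_split /= -!mulr_sumr -!mulr_suml !sqE !mulrA.
Qed.

(** The gradient in [A] of a linear functional [psi] of the error is a sum of two rank-one matrices,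
    so its Frobenius norm is controlled by energies without any factor of the dimension. The rate
    [1 / N] rests on this. *)
Lemma Dridge_sum_sqr A v D (psi : 'cV[R]_N) :
  \sum_m \sum_i (\sum_j psi j 0 *: Dridge t v D j A) m i ^+ 2 <=
  4 / t ^+ 2 * ridge_energy v D * dot psi psi.
Proof.
have E m i : (\sum_j psi j 0 *: Dridge t v D j A) m i =
    ridge_res A v D m 0 * ridge A 0 (t^-1 *: psi) i 0 +
    ridge_res A 0 (t^-1 *: psi) m 0 * ridge A v D i 0.
  rewrite summxE -sum_ridge_prior -[ridge_res A 0 _ m 0]opprK -sum_ridge_noise.
  rewrite mulNr mulr_sumr mulr_suml -sumrB; apply: eq_bigr => j _.
  by rewrite !mxE; ring.
under eq_bigr do under eq_bigr do rewrite E.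
apply: le_trans (sum_sqr_outer _ _ _ _) _.
have h1 := ridge_res_le t0 A v D; have h2 := ridge_le t0 A v D.
have h3 := ridge_res_le t0 A 0 (t^-1 *: psi).
have h4 := ridge_le t0 A 0 (t^-1 *: psi).
rewrite energy_prior in h3 h4.
have -> : 4 / t ^+ 2 * ridge_energy v D * dot psi psi =
  2 * ridge_energy v D * (dot psi psi / t / t) +
  2 * (dot psi psi / t) * (ridge_energy v D / t).
  by field; rewrite gt_eqF.
by apply: lerD; apply: ler_pM; rewrite ?mulr_ge0 ?dot_ge0// ler_wpM2l.
Qed.

Lemma Dridge_res_sum_sqr A v D (chi : 'cV[R]_M) :
  \sum_m \sum_i (\sum_k chi k 0 *: Dridge_res t v D k A) m i ^+ 2 <=
  4 / t * ridge_energy v D * dot chi chi.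
Proof.
have E m i : (\sum_k chi k 0 *: Dridge_res t v D k A) m i =
    ridge_res A v D m 0 * (- ridge A chi 0) i 0 +
    (- ridge_res A chi 0) m 0 * ridge A v D i 0.
  have -> : (- ridge A chi 0) i 0 = \sum_k chi k 0 * res_prior A i k 0.
    by rewrite sum_res_prior mxE.
  have -> : (- ridge_res A chi 0) m 0 = - \sum_k chi k 0 * res_noise A m k 0.
    by rewrite sum_res_noise mxE.
  rewrite summxE.
  rewrite mulNr mulr_sumr mulr_suml -sumrB; apply: eq_bigr => j _.
  by rewrite !mxE; ring.
under eq_bigr do under eq_bigr do rewrite E.
apply: le_trans (sum_sqr_outer _ _ _ _) _.
have h1 := ridge_res_le t0 A v D; have h2 := ridge_le t0 A v D.
have h3 := ridge_res_le t0 A chi 0.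
have h4 := ridge_le t0 A chi 0.
rewrite energy_noise in h3 h4.
rewrite !dotNl !dotNr !opprK.
have -> : 4 / t * ridge_energy v D * dot chi chi =
  2 * ridge_energy v D * (dot chi chi / t) +
  2 * dot chi chi * (ridge_energy v D / t).
  by field; rewrite gt_eqF.
by apply: lerD; apply: ler_pM; rewrite ?mulr_ge0 ?dot_ge0// ler_wpM2l.
Qed.

(** Young's inequality with a free weight [mu], to be tuned to the sizes of [x], [y] and the
    gradient bound [kD]. *)
Lemma bilinear_sum_le mu kD (x : 'cV[R]_M) (y : 'cV[R]_N) (Z : 'M[R]_(M, N)) : 0 < mu ->
  \sum_m \sum_i Z m i ^+ 2 <= kD ->
  `|\sum_m \sum_i x m 0 * y i 0 * Z m i| <= (mu * dot x x * dot y y + kD / mu) / 2.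
Proof.
move=> mu0 ZkD.
apply: le_trans (ler_norm_sum _ _ _) _.
apply: (@le_trans _ _ (\sum_m \sum_i ((mu / 2) * (x m 0 ^+ 2 * y i 0 ^+ 2) +
    (2 * mu)^-1 * (Z m i ^+ 2)))).
  apply: ler_sum => m _; apply: le_trans (ler_norm_sum _ _ _) _.
  apply: ler_sum => i _; set a := x m 0 * y i 0; set z := Z m i.
  have -> : mu / 2 * (x m 0 ^+ 2 * y i 0 ^+ 2) + (2 * mu)^-1 * z ^+ 2 =
     (2 * mu)^-1 * ((mu * a) ^+ 2 + z ^+ 2).
    by rewrite /a; field; rewrite gt_eqF.
  rewrite ler_pdivlMl ?mulr_gt0//.
  have -> : 2 * mu * `|a * z| = 2 * (`|mu * a| * `|z|).
    by rewrite !normrM (gtr0_norm mu0); ring.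
  rewrite -(real_normK (num_real (mu * a))) -(real_normK (num_real z)).
  by have := sqr_ge0 (`|mu * a| - `|z|); nra.
have sqE n (z : 'cV[R]_n) : \sum_i z i 0 ^+ 2 = dot z z.
  by apply: eq_bigr => i _; rewrite expr2.
under eq_bigr do rewrite big_split /= -!mulr_sumr sqE.
rewrite big_split /= -!mulr_sumr -mulr_suml sqE.
have -> : (mu * dot x x * dot y y + kD / mu) / 2 =
    mu / 2 * (dot x x * dot y y) + (2 * mu)^-1 * kD.
  by field; rewrite gt_eqF.
by rewrite lerD2l ler_wpM2l// invr_ge0 mulr_ge0// ltW.
Qed.

End ridge_identities.

Ltac regular := repeat lazymatch goal with
  | H : regular0 ?F |- regular0 ?F => exact H
  | |- regular0 (fun=> ?c) => exact (regular0_cst c)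
  | |- regular0 (fun B => - (@?F B)) => apply: regular0N
  | |- regular0 (fun B => (@?F B) - (@?G B)) => apply: regular0B
  | |- regular0 (fun B => (@?F B) + (@?G B)) => apply: regular0D
  | |- regular0 (fun B => (@?F B) * (@?G B)) => apply: regular0M
  | |- regular0 (fun B => bigop.body _ _ _) => apply: regular0_sum => ?
  | |- regular0 (fun B => fun_of_matrix (ridge _ B _ _) _ _) => exact: regular0_ridge
  | |- regular0 (fun B => fun_of_matrix (ridge_res _ B _ _) _ _) =>
      exact: regular0_ridge_res
  | |- regular0 (fun B => fun_of_matrix (ridge_prior _ B _) _ _) => exact: regular0_ridge
  | |- regular0 (fun B => fun_of_matrix (res_prior _ B _) _ _) =>
      exact: regular0_ridge_res
  end.

(** * Expectation over the matrix, and the relations produced by integration by parts *)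

Section expectation_over_matrix.
Context d (T : measurableType d) (R : realType) (P : probability T R).
Context {M N : nat} (A : 'I_M -> 'I_N -> {RV P >-> R}).
Implicit Types F G : 'M[R]_(M, N) -> R.

Definition Ex F : R := \int[P]_w F (random_mx A w).

Lemma eq_Ex F G : (forall B, F B = G B) -> Ex F = Ex G.
Proof. by move=> FG; apply: eq_Rintegral => w _; rewrite FG. Qed.

Let int F : regular0 F -> P.-integrable setT (EFin \o (fun w => F (random_mx A w))).
Proof. by move=> rF; apply: bounded_mfun_integrable; exact: bounded_regular0. Qed.

Lemma ExD F G : regular0 F -> regular0 G -> Ex (fun B => F B + G B) = Ex F + Ex G.
Proof. by move=> rF rG; rewrite /Ex RintegralD//; exact: int. Qed.

Lemma ExB F G : regular0 F -> regular0 G -> Ex (fun B => F B - G B) = Ex F - Ex G.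
Proof. by move=> rF rG; rewrite /Ex RintegralB//; exact: int. Qed.

Lemma ExZ c F : regular0 F -> Ex (fun B => c * F B) = c * Ex F.
Proof. by move=> rF; rewrite /Ex RintegralZl//; exact: int. Qed.

Lemma Ex_sum (I : Type) (s : seq I) (F : I -> 'M[R]_(M, N) -> R) :
  (forall i, regular0 (F i)) ->
  Ex (fun B => \sum_(i <- s) F i B) = \sum_(i <- s) Ex (F i).
Proof. by move=> rF; rewrite /Ex Rintegral_sum// => i; exact: int. Qed.

Lemma Ex_cst c : Ex (fun=> c) = c. Proof. exact: Rintegral_prob_cst. Qed.

Lemma le_Ex F G : regular0 F -> regular0 G -> (forall B, F B <= G B) -> Ex F <= Ex G.
Proof.
by move=> rF rG FG; apply: le_Rintegral_bounded => //; exact: bounded_regular0.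
Qed.

Lemma Ex_norm_le F c : regular0 F -> (forall B, `|F B| <= c) -> `|Ex F| <= c.
Proof.
move=> rF Fc; rewrite ler_norml -{1}(Ex_cst (- c)) -{2}(Ex_cst c).
by apply/andP; split; apply: le_Ex => //; try exact: regular0_cst;
  move=> B; have := Fc B; rewrite ler_norml => /andP[].
Qed.

End expectation_over_matrix.

(* Stated for generic matrices because rewriting with mxE would also unfold the
   matrix products hidden in ridge. *)
Lemma combine_mxE {R : realType} {m n : nat} (a b c : R) (X Y : 'M[R]_(m, n)) i j :
  (a *: (b *: X + c *: Y)) i j = a * (b * X i j + c * Y i j).
Proof. by rewrite !mxE. Qed.

Lemma product_mxE {R : realType} {m n : nat} (a b c k : R) (X Y Z : 'M[R]_(m, n)) i j :
  (a *: (b *: X + c *: (k *: Y)) + (b * c) *: Z) i j =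
  a * (b * X i j + c * (k * Y i j)) + b * c * Z i j.
Proof. by rewrite !mxE. Qed.

Section tested_relations.
Context d (T : measurableType d) (R : realType) (P : probability T R).
Context {M N : nat} (A : 'I_M -> 'I_N -> {RV P >-> R}) (s t : R).
Hypotheses (s0 : 0 < s) (t0 : 0 < t) (N0 : (0 < N)%N) (sN : s ^+ 2 = N%:R^-1).
Hypothesis A_law : forall m n, has_law P (A m n) (gauss s).
Hypothesis A_ind : mutually_independent P (fun mn : 'I_M * 'I_N => A mn.1 mn.2 : T -> R).
Implicit Types (B : 'M[R]_(M, N)) (v : 'cV[R]_M) (D : 'cV[R]_N).
Local Notation Ex := (Ex A).
Local Notation ridge := (ridge t).
Local Notation ridge_res := (ridge_res t).
Local Notation ridge_prior := (ridge_prior t).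
Local Notation ridge_noise := (ridge_noise t).
Local Notation res_prior := (res_prior t).
Local Notation res_noise := (res_noise t).
Local Notation ridge_energy := (ridge_energy t).

Let Nr0 : 0 < N%:R :> R. Proof. by rewrite ltr0n. Qed.

Lemma sum_by_parts (F : 'I_M -> 'I_N -> 'M[R]_(M, N) -> R) DF :
  (forall m i, regular1 (F m i) (DF m i)) ->
  Ex (fun B => \sum_m \sum_i B m i * F m i B) =
  N%:R^-1 * Ex (fun B => \sum_m \sum_i DF m i B m i).
Proof.
move=> rF.
have iAF m i := (entry_by_parts s0 A_law A_ind m i (rF m i)).1.
have rD m i : regular0 (fun B => DF m i B m i) by have [_ h _] := rF m i; exact: h.
have iAFs m : P.-integrable setT
    (EFin \o (fun w => \sum_i A m i w * F m i (random_mx A w))).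
  have := integrable_sum (mu := P) measurableT (index_enum 'I_N) (P := xpredT) (fun i _ => iAF m i).
  by congr integrable; apply/funext => w /=; rewrite sumEFin.
transitivity (\int[P]_w \sum_m \sum_i A m i w * F m i (random_mx A w)).
  apply: eq_Rintegral => w _; apply: eq_bigr => m _; apply: eq_bigr => i _.
  by rewrite [X in X * _]mxE.
rewrite Rintegral_sum// Ex_sum; last by move=> m; regular.
rewrite mulr_sumr; apply: eq_bigr => m _.
rewrite Rintegral_sum// Ex_sum; last by move=> i; exact: rD.
rewrite mulr_sumr; apply: eq_bigr => i _.
by rewrite (entry_by_parts s0 A_law A_ind m i (rF m i)).2 sN.
Qed.

(** By [trace_res_noise], the trace of [1 - A G A^T] divided by [N]; it comes from differentiating
    [r_m] in the entries of row [m]. *)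
Definition kappa B : R := N%:R^-1 * (M%:R - N%:R + t * trG t B).

Lemma ridge_noiseE B m i : ridge_noise B m i 0 = - res_prior B i m 0.
Proof.
have := sum_ridge_noise t0 B m (delta_mx i 0).
by rewrite -/(dot (delta_mx i 0) (ridge_noise B m)) dot_delta => ->.
Qed.

Lemma regular0_kappa : regular0 kappa.
Proof. by rewrite /kappa /trG; regular. Qed.

Section tested_relation.
Variables (v : 'cV[R]_M) (D : 'cV[R]_N).
Variables (phi psi : 'I_N -> 'M[R]_(M, N) -> R) (Y : 'M[R]_(M, N) -> R).
Variable DY : 'M[R]_(M, N) -> 'M[R]_(M, N).
Hypothesis rphi : forall i, regular1 (phi i) (fun B => psi i B *: Dridge t v D i B).
Hypothesis rpsi : forall i, regular0 (psi i).
Hypothesis rY : regular1 Y DY.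
Variables (kpsi kY kD kphi mu : R).
Hypothesis mu0 : 0 < mu.
Hypothesis phi_le : forall B, \sum_i phi i B ^+ 2 <= kphi.
Hypothesis psi_le : forall i B, `|psi i B| <= kpsi.
Hypothesis Y_le : forall B, `|Y B| <= kY.
Hypothesis DY_le : forall B, \sum_m \sum_i DY B m i ^+ 2 <= kD.

Let E0 := ridge_energy v D.
Let r B := ridge_res B v D.
Let e B := ridge B v D.
Let b B := ridge B (r B) 0.

(** The terms of the integration by parts that carry no trace: the derivative of [Y], and the two
    places where the residual is paired with [res_prior], which collapse into [b]. *)
Let err B := \sum_m \sum_i r B m 0 * phi i B * DY B m i
  - Y B * (\sum_i psi i B * (e B i 0 * b B i 0))
  - Y B * \sum_i phi i B * b B i 0.

Let b_le B : dot (b B) (b B) <= E0 / t.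
Proof.
apply: le_trans (ridge_le t0 B (r B) 0) _.
by rewrite energy_noise ler_pM2r ?invr_gt0// /r ridge_res_le.
Qed.

Let kY0 : 0 <= kY. Proof. by apply: le_trans (Y_le 0). Qed.

Let err_le B : `|err B| <= (mu * E0 * kphi + kD / mu) / 2 + kY * kpsi * (E0 / t)
  + kY * ((kphi + E0 / t) / 2).
Proof.
apply: le_trans (ler_normB _ _) _; apply: lerD.
  apply: le_trans (ler_normB _ _) _; apply: lerD.
  - have phiE : dot (\col_i phi i B) (\col_i phi i B) = \sum_i phi i B ^+ 2.
      by apply: eq_bigr => i _; rewrite !mxE expr2.
    have -> : \sum_m \sum_i r B m 0 * phi i B * DY B m i =
        \sum_m \sum_i r B m 0 * (\col_i phi i B) i 0 * DY B m i.
      by apply: eq_bigr => m _; apply: eq_bigr => i _; rewrite [in RHS]mxE.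
    apply: le_trans (bilinear_sum_le _ _ mu0 (DY_le B)) _.
    rewrite phiE ler_pM2r// lerD2r -!mulrA ler_pM2l//.
    apply: ler_pM => //; [exact: dot_ge0| |exact: ridge_res_le].
    by apply: sumr_ge0 => i _; rewrite sqr_ge0.
  - rewrite normrM -mulrA; apply: ler_pM => //.
    apply: le_trans (ler_norm_sum _ _ _) _.
    apply: (@le_trans _ _ (\sum_i kpsi * ((e B i 0 ^+ 2 + b B i 0 ^+ 2) / 2))).
      apply: ler_sum => i _; rewrite normrM; apply: ler_pM => //.
      rewrite normrM -(real_normK (num_real (e B i 0))) -(real_normK (num_real (b B i 0))).
      by have := sqr_ge0 (`|e B i 0| - `|b B i 0|); nra.
    rewrite -mulr_sumr -mulr_suml big_split /=.
    have sqE (z : 'cV[R]_N) : \sum_i z i 0 ^+ 2 = dot z z.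
      by apply: eq_bigr => i _; rewrite expr2.
    rewrite !sqE; have h1 := b_le B; have h2 := ridge_le t0 B v D.
    rewrite ler_wpM2l//; last by rewrite -/E0 -/(e B) in h2; lra.
    by case: (pickP 'I_N) => [i _|N_0]; [exact: le_trans (psi_le i 0)|
      have := N_0 (Ordinal N0)].
- rewrite normrM; apply: ler_pM => //.
  have -> : \sum_i phi i B * b B i 0 = dot (\col_i phi i B) (b B).
    by apply: eq_bigr => i _; rewrite mxE.
  apply: le_trans (dot_le_half _ _) _; rewrite ler_pM2r// lerD//.
  apply: le_trans (phi_le B); rewrite le_eqVlt; apply/orP; left; apply/eqP.
  by apply: eq_bigr => i _; rewrite !mxE expr2.
Qed.

Let rphi0 i : regular0 (phi i). Proof. by case: (rphi i). Qed.
Let rY0 : regular0 Y. Proof. by case: rY. Qed.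
Let rDY m i : regular0 (fun B => DY B m i). Proof. by case: rY. Qed.
Let rr m : regular0 (fun B => r B m 0). Proof. exact: regular0_ridge_res. Qed.
Let re i : regular0 (fun B => e B i 0). Proof. exact: regular0_ridge. Qed.
Let rb i : regular0 (fun B => b B i 0).
Proof.
rewrite (_ : (fun B => _) = (fun B => - \sum_m r B m 0 * res_prior B i m 0)).
  by regular; exact: rr.
by apply/funext => B; rewrite sum_res_prior// opprK.
Qed.

Ltac reg := regular; match goal with
  | |- regular0 (fun B => fun_of_matrix (r B) _ _) => exact: rr
  | |- regular0 (fun B => fun_of_matrix (e B) _ _) => exact: re
  | |- regular0 (fun B => fun_of_matrix (DY B) _ _) => exact: rDY
  | |- regular0 (fun B => fun_of_matrix (b B) _ _) => exact: rb
  | |- ?G => first [exact: rphi0 | exact: rpsi | exact: rY0 | exact: regular0_kappa | idtac G]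
  end.

Let rerr : regular0 err.
Proof.
by rewrite /err; reg.
Qed.

Let main B : R := \sum_i ((t + kappa B) * e B i 0 - t * D i 0) * phi i B * Y B.
Let main' B : R := \sum_i psi i B * (dot (r B) (r B) * ridge_prior B i i 0) * Y B.

Let rG i : regular0 (fun B => ridge_prior B i i 0).
Proof. exact: regular0_ridge. Qed.

Let rkappa : regular0 kappa. Proof. exact: regular0_kappa. Qed.

Let rmain : regular0 main.
Proof. by rewrite /main; reg. Qed.

Let rmain' : regular0 main'.
Proof. by rewrite /main' /dot; reg. Qed.

(** The sum of [A_mi r_m phi_i Y] is computed twice: by the optimality condition
    [A^T r = t (e - D)], and by parts. Differentiating [r_m] yields [- kappa e_i phi_i], moved to
    the left; differentiating [phi_i] yields [|r|^2 psi_i G_ii]; the rest is [err]. *)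
Lemma tested_relation : `|Ex main - N%:R^-1 * Ex main'| <= N%:R^-1 *
  ((mu * E0 * kphi + kD / mu) / 2 + kY * kpsi * (E0 / t) + kY * ((kphi + E0 / t) / 2)).
Proof.
have rprod m i : regular1 (fun B => r B m 0 * (phi i B * Y B))
    (fun B => r B m 0 *: (phi i B *: DY B + Y B *: (psi i B *: Dridge t v D i B)) +
      (phi i B * Y B) *: Dridge_res t v D m B).
  apply: regular1M; first exact: regular1_ridge_res.
  exact: regular1M.
have IBP := sum_by_parts rprod.
have lhsE B : \sum_m \sum_i B m i * (r B m 0 * (phi i B * Y B)) =
    main B - kappa B * \sum_i e B i 0 * phi i B * Y B.
  rewrite exchange_big /main mulr_sumr -sumrB; apply: eq_bigr => i _.
  under eq_bigr do rewrite mulrA; rewrite -mulr_suml.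
  have -> : \sum_m B m i * r B m 0 = t * (e B i 0 - D i 0).
    have := congr1 (fun u : 'cV[R]_N => u i 0) (ridge_kkt t0 B v D).
    rewrite /= !mxE => <-; apply: eq_bigr => m _; by rewrite !mxE.
  ring.
(* [ridge_noise] is rewritten as minus [res_prior], so that all cross terms are sums of [r_m]
   against [res_prior]; the diagonal of [res_noise] sums to [N * kappa]. *)
have rhsE B : \sum_m \sum_i (r B m 0 *: (phi i B *: DY B + Y B *: (psi i B *: Dridge t v D i B)) +
      (phi i B * Y B) *: Dridge_res t v D m B) m i =
    err B + main' B - N%:R * kappa B * \sum_i e B i 0 * phi i B * Y B.
  have Nk : N%:R * kappa B = \sum_m res_noise B m m 0.
    by rewrite /kappa mulrA divff ?gt_eqF// mul1r trace_res_noise.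
  rewrite exchange_big /err [X in X - _ - _]exchange_big /main' !mulr_sumr /=.
  rewrite -!sumrB -big_split -sumrB /=; apply: eq_bigr => i _; rewrite Nk.
  transitivity (\sum_m (r B m 0 * phi i B * DY B m i +
      (Y B * psi i B * ridge_prior B i i 0) * (r B m 0 * r B m 0) +
      (Y B * psi i B * e B i 0 + phi i B * Y B) * (r B m 0 * res_prior B i m 0) -
      (phi i B * Y B * e B i 0) * res_noise B m m 0)).
    apply: eq_bigr => m _; rewrite product_mxE DridgeE Dridge_resE ridge_noiseE.
    by rewrite -/(r B) -/(e B); ring.
  rewrite sumrB !big_split /= -!mulr_sumr sum_res_prior// -/(b B).
  rewrite -/(dot (r B) (r B)); ring.
rewrite (eq_Ex A lhsE) (eq_Ex A rhsE) in IBP.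
have rk : regular0 (fun B => kappa B * \sum_i e B i 0 * phi i B * Y B).
  by reg.
have E1 : Ex main = Ex (fun B => main B - kappa B * \sum_i e B i 0 * phi i B * Y B) +
    Ex (fun B => kappa B * \sum_i e B i 0 * phi i B * Y B).
  by rewrite -ExD//; [apply: eq_Ex => B; rewrite subrK|exact: regular0B].
have E2 : N%:R^-1 * Ex (fun B => err B + main' B -
      N%:R * kappa B * \sum_i e B i 0 * phi i B * Y B) =
    N%:R^-1 * Ex err + N%:R^-1 * Ex main' -
    Ex (fun B => kappa B * \sum_i e B i 0 * phi i B * Y B).
  rewrite ExB; [|exact: regular0D|]; last first.
    by have := regular0M (regular0_cst N%:R) rk; congr regular0; apply/funext => B; rewrite mulrA.
  have E3 : Ex (fun B => N%:R * kappa B * \sum_i e B i 0 * phi i B * Y B) =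
      N%:R * Ex (fun B => kappa B * \sum_i e B i 0 * phi i B * Y B).
    by rewrite -ExZ//; apply: eq_Ex => B; rewrite mulrA.
  by rewrite ExD// mulrBr mulrDr E3 mulKf// lt0r_neq0.
rewrite E1 IBP E2 subrK addrK normrM gtr0_norm ?invr_gt0//.
by rewrite ler_pM2l ?invr_gt0// Ex_norm_le.
Qed.

End tested_relation.

Section noise_relation.
Variables (v : 'cV[R]_M) (D : 'cV[R]_N) (Y : 'M[R]_(M, N) -> R).
Variable DY : 'M[R]_(M, N) -> 'M[R]_(M, N).
Hypothesis rY : regular1 Y DY.
Variables (kY kD mu : R).
Hypothesis mu0 : 0 < mu.
Hypothesis Y_le : forall B, `|Y B| <= kY.
Hypothesis DY_le : forall B, \sum_m \sum_i DY B m i ^+ 2 <= kD.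

Let E0 := ridge_energy v D.
Let r B := ridge_res B v D.
Let e B := ridge B v D.

Let rY0 : regular0 Y. Proof. by case: rY. Qed.
Let rDY m i : regular0 (fun B => DY B m i). Proof. by case: rY. Qed.
Let rr m : regular0 (fun B => r B m 0). Proof. exact: regular0_ridge_res. Qed.
Let re i : regular0 (fun B => e B i 0). Proof. exact: regular0_ridge. Qed.

Ltac reg := regular; match goal with
  | |- regular0 (fun B => fun_of_matrix (r B) _ _) => exact: rr
  | |- regular0 (fun B => fun_of_matrix (e B) _ _) => exact: re
  | |- regular0 (fun B => fun_of_matrix (DY B) _ _) => exact: rDY
  | |- _ => exact: rY0
  end.

Let err B := \sum_m \sum_i v m 0 * e B i 0 * DY B m i - Y B * dot (e B) (ridge B v 0).

Let rerr : regular0 err.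
Proof. by rewrite /err /dot; reg. Qed.

Let err_le B : `|err B| <= (mu * dot v v * (E0 / t) + kD / mu) / 2 +
  kY * ((E0 / t + dot v v / t) / 2).
Proof.
apply: le_trans (ler_normB _ _) _; apply: lerD.
  apply: le_trans (bilinear_sum_le _ _ mu0 (DY_le B)) _.
  rewrite ler_pM2r// lerD2r ler_wpM2l//; last exact: ridge_le.
  by rewrite mulr_ge0 ?dot_ge0// ltW.
rewrite normrM; apply: ler_pM => //.
apply: le_trans (dot_le_half _ _) _; rewrite ler_pM2r// lerD//; first exact: ridge_le.
by apply: le_trans (ridge_le _ _ _ _) _ => //; rewrite energy_noise.
Qed.

Let rtr : regular0 (fun B : 'M[R]_(M, N) => trG t B).
Proof. by rewrite /trG; regular. Qed.

(** By parts on the sum of [A_mi v_m e_i Y], which equals [(|v|^2 - v . r) Y]. The diagonal of the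
    resolvent contributes [tr G (v . r)]. *)
Lemma noise_relation :
  `|Ex (fun B => (dot v v - (1 + N%:R^-1 * trG t B) * dot v (r B)) * Y B)| <= N%:R^-1 *
  ((mu * dot v v * (E0 / t) + kD / mu) / 2 + kY * ((E0 / t + dot v v / t) / 2)).
Proof.
have rprod m i : regular1 (fun B => v m 0 * (e B i 0 * Y B))
    (fun B => v m 0 *: (e B i 0 *: DY B + Y B *: Dridge t v D i B)).
  by apply: regular1Z; apply: regular1M => //; exact: regular1_ridge.
have IBP := sum_by_parts rprod.
have lhsE B : \sum_m \sum_i B m i * (v m 0 * (e B i 0 * Y B)) =
    (dot v v - dot v (r B)) * Y B.
  rewrite -dotBr /r -mulmx_ridge mulr_suml; apply: eq_bigr => m _.
  by rewrite mxE mulr_sumr mulr_suml; apply: eq_bigr => i _; ring.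
have rhsE B : \sum_m \sum_i (v m 0 *: (e B i 0 *: DY B + Y B *: Dridge t v D i B)) m i =
    err B + trG t B * dot v (r B) * Y B.
  rewrite exchange_big /err [X in X - _ + _]exchange_big /dot /trG mulr_sumr /=.
  rewrite 2!mulr_suml -sumrB -big_split /=; apply: eq_bigr => i _.
  transitivity (\sum_m (v m 0 * e B i 0 * DY B m i +
      (Y B * ridge_prior B i i 0) * (v m 0 * r B m 0) +
      (Y B * e B i 0) * (v m 0 * res_prior B i m 0))).
    apply: eq_bigr => m _; rewrite combine_mxE DridgeE ridge_noiseE.
    by rewrite -/(r B) -/(e B); ring.
  by rewrite !big_split /= -!mulr_sumr sum_res_prior//; ring.
rewrite (eq_Ex A lhsE) (eq_Ex A rhsE) in IBP.
have rg : regular0 (fun B => trG t B * dot v (r B) * Y B).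
  by rewrite /dot /trG; reg.
have E1 : Ex (fun B => (dot v v - (1 + N%:R^-1 * trG t B) * dot v (r B)) * Y B) =
    Ex (fun B => (dot v v - dot v (r B)) * Y B) -
    N%:R^-1 * Ex (fun B => trG t B * dot v (r B) * Y B).
  have r1 : regular0 (fun B => (dot v v - dot v (r B)) * Y B) by rewrite /dot; reg.
  have r2 : regular0 (fun B => N%:R^-1 * (trG t B * dot v (r B) * Y B)).
    by apply: regular0M => //; exact: regular0_cst.
  by rewrite -ExZ// -ExB//; apply: eq_Ex => B; ring.
rewrite E1 IBP ExD// mulrDr addrK normrM gtr0_norm ?invr_gt0//.
by rewrite ler_pM2l ?invr_gt0// Ex_norm_le.
Qed.

End noise_relation.

(** The data [v = 0], [D = t^-1 e_i] make the ridge error the resolvent column [G e_i], and testing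
    with the constant [i]-th basis vector isolates [G_ii]. *)
Lemma prior_relation i Y DY kY kD : regular1 Y DY -> (forall B, `|Y B| <= kY) ->
  (forall B, \sum_m \sum_i DY B m i ^+ 2 <= kD) ->
  `|Ex (fun B => ((t + kappa B) * ridge_prior B i i 0 - 1) * Y B)| <=
  N%:R^-1 * ((t^-1 + kD) / 2 + kY * ((1 + t^-2) / 2)).
Proof.
move=> rY Yk DYk.
pose phi (j : 'I_N) (B : 'M[R]_(M, N)) : R := (j == i)%:R.
pose psi (j : 'I_N) (B : 'M[R]_(M, N)) : R := 0.
have rphi j : regular1 (phi j)
    (fun B => psi j B *: Dridge t 0 (t^-1 *: delta_mx i 0) j B).
  have := @regular1_cst R M N (j == i)%:R.
  by congr regular1; apply/funext => B; rewrite scale0r.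
have dd : dot (delta_mx i 0) (delta_mx i 0 : 'cV[R]_N) = 1.
  by rewrite dot_delta mxE !eqxx.
have phile B : \sum_j phi j B ^+ 2 <= 1.
  rewrite /phi (bigD1 i)//= big1 => [|j /negbTE ->]; last by rewrite expr0n.
  by rewrite eqxx expr1n addr0.
have psile j B : `|psi j B| <= 0 by rewrite /psi normr0.
have := tested_relation rphi (fun=> regular0_cst 0) rY ltr01 phile psile Yk DYk.
rewrite energy_prior// dd mulr0 mul0r addr0 mul1r mulr1 div1r invr1 mulr1.
rewrite (_ : Ex _ = Ex (fun B => ((t + kappa B) * ridge_prior B i i 0 - 1) * Y B)).
  rewrite [Ex (fun B => \sum_(_ < _) _)](_ : _ = 0) ?mulr0 ?subr0.
    move=> /le_trans; apply; rewrite le_eqVlt; apply/orP; left; apply/eqP.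
    by field; rewrite gt_eqF// lt0r_neq0.
  transitivity (Ex (fun=> 0)); last exact: Ex_cst.
  apply: eq_Ex => B.
  by rewrite big1// => j _; rewrite /psi !mul0r.
apply: eq_Ex => B; rewrite (bigD1 i)//= big1 ?addr0 => [|j ji].
  have De : (t^-1 *: delta_mx i 0 : 'cV[R]_N) i 0 = t^-1 by rewrite !mxE !eqxx mulr1.
  by rewrite /phi eqxx mulr1 De divff ?lt0r_neq0.
by rewrite /phi (negbTE ji) mulr0 mul0r.
Qed.

End tested_relations.

Lemma dot_delta_self {R : realType} n (i : 'I_n) :
  dot (delta_mx i 0) (delta_mx i 0 : 'cV[R]_n) = 1.
Proof. by rewrite dot_delta mxE !eqxx. Qed.

Lemma sqr_mean_le {R : realType} N (x : 'I_N -> R) : (0 < N)%N ->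
  (N%:R^-1 * \sum_i x i) ^+ 2 <= N%:R^-1 * \sum_i x i ^+ 2.
Proof.
move=> N0; have Nr0 : 0 < N%:R :> R by rewrite ltr0n.
have := CauchySchwarz_dot (const_mx 1 : 'cV[R]_N) (\col_i x i).
have -> : dot (const_mx 1) (\col_i x i) = \sum_i x i.
  by apply: eq_bigr => i _; rewrite !mxE mul1r.
have -> : dot (\col_i x i) (\col_i x i) = \sum_i x i ^+ 2.
  by apply: eq_bigr => i _; rewrite !mxE expr2.
have -> : dot (const_mx 1) (const_mx 1 : 'cV[R]_N) = N%:R.
  rewrite /dot; under eq_bigr do rewrite !mxE mulr1.
  by rewrite sumr_const card_ord.
move=> h; rewrite exprMn expr2 -mulrA ler_pM2l ?invr_gt0//.
by rewrite ler_pdivrMl.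
Qed.

(** This closes every concentration argument. [Y] is the deviation itself, [E (F Y)] is small by a
    tested relation, and [eta] is a fluctuation already controlled. The difference of the two sides
    dominates a complete square. *)
Lemma absorb_square {R : realType} (lam Y F eta Z kZ : R) : 0 < lam ->
  `|Z| <= kZ -> lam * Y = F - eta * Z ->
  lam / 2 * Y ^+ 2 <= F * Y + kZ ^+ 2 / (2 * lam) * eta ^+ 2.
Proof.
move=> lam0 ZkZ E.
have FE : F = lam * Y + eta * Z by rewrite E subrK.
rewrite FE; have h : Z ^+ 2 <= kZ ^+ 2.
  by rewrite -(real_normK (num_real Z)) lerXn2r// ?nnegrE// (le_trans _ ZkZ).
have h2 : Z ^+ 2 / (2 * lam) * eta ^+ 2 <= kZ ^+ 2 / (2 * lam) * eta ^+ 2.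
  by rewrite ler_wpM2r ?sqr_ge0// ler_wpM2r// invr_ge0 mulr_ge0// ltW.
apply: le_trans (_ : _ <= (lam * Y + eta * Z) * Y + Z ^+ 2 / (2 * lam) * eta ^+ 2) _.
  rewrite -subr_ge0.
  have -> : (lam * Y + eta * Z) * Y + Z ^+ 2 / (2 * lam) * eta ^+ 2 - lam / 2 * Y ^+ 2 =
    (2 * lam)^-1 * (lam * Y + eta * Z) ^+ 2 by field; rewrite gt_eqF.
  by rewrite mulr_ge0 ?sqr_ge0// invr_ge0 mulr_ge0// ltW.
by rewrite lerD2l.
Qed.

(** * Concentration of the trace and of the diagonal of the resolvent *)

Section gaussian_matrix.
Context d (T : measurableType d) (R : realType) (P : probability T R).
Variable Delta : R.

Definition gaussian_matrix {M N : nat} (A : 'I_M -> 'I_N -> {RV P >-> R}) : Prop :=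
  [/\ (0 < N)%N, M%:R = Delta * N%:R :> R,
    forall m n, has_law P (A m n) (gauss (Num.sqrt N%:R^-1)) &
    mutually_independent P (fun mn : 'I_M * 'I_N => A mn.1 mn.2 : T -> R)].

(* c is the large-system limit of kappa, and (c + t)^-1 that of the diagonal of
   the resolvent. *)
Variables t c : R.
Hypotheses (t0 : 0 < t) (c0 : 0 < c) (cE : Delta * (c + t) = c * (c + t) + c).
Local Notation L := (c + t).

Let L0 : 0 < L. Proof. by rewrite addr_gt0. Qed.

Section trace.
Context {M N : nat} (A : 'I_M -> 'I_N -> {RV P >-> R}).
Hypothesis gA : gaussian_matrix A.

Let N0 : (0 < N)%N. Proof. by case: gA. Qed.
Let Nr0 : 0 < N%:R :> R. Proof. by rewrite ltr0n. Qed.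

Definition mean_trG (B : 'M[R]_(M, N)) : R := N%:R^-1 * trG t B.

(** [cE] says [Delta = c + c / L], so [kappa] equals [c] exactly when the normalized trace is
    [L^-1]. *)
Lemma kappaE B : t + kappa t B = L + t * (mean_trG B - L^-1).
Proof.
case: gA => _ MN _ _; rewrite /kappa MN /mean_trG.
have -> : Delta = c + c / L.
  by apply: (mulIf (lt0r_neq0 L0)); rewrite cE mulrDl divfK ?lt0r_neq0.
by field; rewrite !lt0r_neq0.
Qed.

Lemma mean_trG_ge0 B : 0 <= mean_trG B.
Proof.
by rewrite mulr_ge0 ?invr_ge0 ?(ltW Nr0)// sumr_ge0// => i _; exact: ridge_prior_ge0.
Qed.

Lemma mean_trG_le B : mean_trG B <= t^-1.
Proof.
rewrite ler_pdivrMl// mulrC mulr_natr -[X in _ <= _ *+ X]card_ord -sumr_const.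
by apply: ler_sum => i _; exact: ridge_prior_le.
Qed.

Lemma regular0_mean_trG : regular0 mean_trG.
Proof. by rewrite /mean_trG /trG; regular. Qed.

Lemma Dridge_coord_sum_sqr (v : 'cV[R]_M) (D : 'cV[R]_N) j B :
  \sum_m \sum_i (Dridge t v D j B) m i ^+ 2 <= 4 / t ^+ 2 * ridge_energy t v D.
Proof.
have := Dridge_sum_sqr t0 B v D (delta_mx j 0).
have -> : \sum_j0 (delta_mx j 0 : 'cV[R]_N) j0 0 *: Dridge t v D j0 B = Dridge t v D j B.
  rewrite (bigD1 j)//= big1 ?addr0 => [|k kj].
    by rewrite [delta_mx _ _ _ _]mxE !eqxx scale1r.
  by rewrite [delta_mx _ _ _ _]mxE (negbTE kj) scale0r.
by rewrite dot_delta_self mulr1.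
Qed.

Let s0 : 0 < Num.sqrt (N%:R^-1 : R). Proof. by rewrite sqrtr_gt0 invr_gt0. Qed.
Let sN : Num.sqrt (N%:R^-1 : R) ^+ 2 = N%:R^-1.
Proof. by rewrite sqr_sqrtr// invr_ge0 ltW. Qed.

Let kD : R := 4 / t ^+ 3.
Let kY : R := t^-1 + L^-1.
Definition trace_cst : R := (t^-1 + kD) / 2 + kY * ((1 + t^-2) / 2).

Let Dprior_le i (B : 'M[R]_(M, N)) : \sum_m \sum_j (Dridge t (0 : 'cV[R]_M) (t^-1 *: delta_mx i 0) i B) m j ^+ 2 <= kD.
Proof.
apply: le_trans (Dridge_coord_sum_sqr _ _ _ _) _.
rewrite energy_prior// dot_delta_self.
rewrite le_eqVlt; apply/orP; left; apply/eqP; rewrite /kD; field.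
by rewrite lt0r_neq0.
Qed.

Let eta B := mean_trG B - L^-1.

Let reta : regular1 eta (fun B => N%:R^-1 *: \sum_i Dridge t (0 : 'cV[R]_M) (t^-1 *: delta_mx i 0) i B).
Proof.
have r1 (i : 'I_N) := regular1_ridge t0 (0 : 'cV[R]_M) (t^-1 *: delta_mx i 0) i.
have := regular1D (regular1Z N%:R^-1 (regular1_sum (index_enum 'I_N) r1)) (regular1_cst (- L^-1)).
by congr regular1; apply/funext => B; rewrite addr0.
Qed.

Let reta0 : regular0 eta. Proof. by case: reta. Qed.

Let Deta_le B : \sum_m \sum_j
  (N%:R^-1 *: \sum_(i < N) Dridge t (0 : 'cV[R]_M) (t^-1 *: delta_mx i 0) i B) m j ^+ 2 <= kD.
Proof.
apply: (@le_trans _ _ (N%:R^-1 * \sum_(i < N) \sum_m \sum_j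
    (Dridge t (0 : 'cV[R]_M) (t^-1 *: delta_mx i 0) i B) m j ^+ 2)).
  rewrite [X in _ <= _ * X]exchange_big mulr_sumr /=; apply: ler_sum => m _.
  rewrite [X in _ <= _ * X]exchange_big mulr_sumr /=; apply: ler_sum => j _.
  by rewrite mxE summxE sqr_mean_le.
have -> : kD = N%:R^-1 * \sum_(i < N) kD.
  by rewrite sumr_const card_ord -[kD *+ N]mulr_natl mulrA mulVf ?mul1r// lt0r_neq0.
by rewrite ler_pM2l ?invr_gt0//; apply: ler_sum => i _; exact: Dprior_le.
Qed.

Let Li0 : 0 <= L^-1. Proof. by rewrite invr_ge0 ltW. Qed.

Let eta_le B : `|eta B| <= kY.
Proof.
rewrite /eta ler_norml; have := mean_trG_ge0 B; have := mean_trG_le B.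
move: Li0; rewrite /kY => h1 h2 h3.
have ti0 : 0 <= t^-1 by rewrite invr_ge0 ltW.
by apply/andP; split; lra.
Qed.

(** [prior_relation] is averaged over [i] with the deviation [eta] as test function. *)
Lemma mean_trG_concentration : Ex A (fun B => (mean_trG B - L^-1) ^+ 2) <= N%:R^-1 * (trace_cst / L).
Proof.
case: gA => _ _ Al Ai.
have rp i : regular0 (fun B => ((t + kappa t B) * ridge_prior t B i i 0 - 1) * eta B).
  have := @regular0_kappa R M N t t0; move=> rk.
  by regular.
have avg : `|Ex A (fun B => N%:R^-1 * \sum_i ((t + kappa t B) * ridge_prior t B i i 0 - 1) * eta B)|
    <= N%:R^-1 * trace_cst.
  rewrite ExZ; last by apply: regular0_sum.
  rewrite Ex_sum// normrM gtr0_norm ?invr_gt0// ler_pM2l ?invr_gt0//.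
  apply: le_trans (ler_norm_sum _ _ _) _.
  have -> : trace_cst = \sum_(i < N) N%:R^-1 * trace_cst.
    by rewrite sumr_const card_ord -[_ *+ N]mulr_natl mulrA divff ?mul1r// lt0r_neq0.
  by apply: ler_sum => i _; exact: (prior_relation s0 t0 N0 sN Al Ai i reta eta_le Deta_le).
(* The quadratic equation for the normalized trace [g] factors as [(L + t g) eta]. Since [g >= 0],
   the first factor is at least [L] and the second root is excluded. *)
have E B : N%:R^-1 * \sum_i ((t + kappa t B) * ridge_prior t B i i 0 - 1) * eta B =
    (L + t * mean_trG B) * eta B ^+ 2.
  rewrite -mulr_suml sumrB -mulr_sumr sumr_const card_ord kappaE -/(trG t B).
  rewrite [trG t B](_ : _ = N%:R * mean_trG B); last first.
    by rewrite mulrA divff ?mul1r// lt0r_neq0.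
  by rewrite /eta; field; rewrite !lt0r_neq0.
rewrite (eq_Ex A E) in avg.
have re2 : regular0 (fun B => eta B ^+ 2) by under eq_fun do rewrite expr2; exact: regular0M.
have rm := regular0_mean_trG.
rewrite -(ler_pM2l L0) -ExZ//.
have -> : L * (N%:R^-1 * (trace_cst / L)) = N%:R^-1 * trace_cst by field; rewrite !lt0r_neq0.
apply: le_trans (le_trans (ler_norm _) avg); apply: le_Ex.
- by regular.
- by regular.
- by move=> B; rewrite ler_wpM2r ?sqr_ge0// lerDl mulr_ge0 ?(ltW t0)// mean_trG_ge0.
Qed.

Definition resolvent_cst : R := (trace_cst + trace_cst / (2 * L * L)) / (L / 2).

(** [(t + kappa) G_ii - 1] equals [L (G_ii - L^-1)] plus the trace fluctuation times [t G_ii], which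
    lies in [[0, 1]]; [absorb_square] applies with [kZ = 1]. *)
Lemma resolvent_concentration i :
  Ex A (fun B => (ridge_prior t B i i 0 - L^-1) ^+ 2) <= N%:R^-1 * resolvent_cst.
Proof.
case: gA => _ _ Al Ai.
pose Y (B : 'M[R]_(M, N)) := ridge_prior t B i i 0 - L^-1.
have rY : regular1 Y (fun B => Dridge t (0 : 'cV[R]_M) (t^-1 *: delta_mx i 0) i B).
  have := regular1D (regular1_ridge t0 (0 : 'cV[R]_M) (t^-1 *: delta_mx i 0) i) (regular1_cst (- L^-1)).
  by congr regular1; apply/funext => B; rewrite addr0.
have rY0 : regular0 Y by case: rY.
have YkY B : `|Y B| <= kY.
  rewrite /Y ler_norml; have := ridge_prior_ge0 t0 B i; have := ridge_prior_le t0 B i.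
  move: Li0; rewrite /kY => h1 h2 h3.
  have ti0 : 0 <= t^-1 by rewrite invr_ge0 ltW.
  by apply/andP; split; lra.
have rel := prior_relation s0 t0 N0 sN Al Ai i rY YkY (Dprior_le i).
have re2 : regular0 (fun B => eta B ^+ 2) by under eq_fun do rewrite expr2; exact: regular0M.
have rY2 : regular0 (fun B => Y B ^+ 2) by under eq_fun do rewrite expr2; exact: regular0M.
have rk := @regular0_kappa R M N t t0.
have rF : regular0 (fun B => ((t + kappa t B) * ridge_prior t B i i 0 - 1) * Y B).
  by regular.
have pt B : L / 2 * Y B ^+ 2 <= ((t + kappa t B) * ridge_prior t B i i 0 - 1) * Y B +
    1 ^+ 2 / (2 * L) * eta B ^+ 2.
  apply: (@absorb_square _ L (Y B) _ (eta B) (t * ridge_prior t B i i 0) 1) => //.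
    rewrite ger0_norm ?mulr_ge0 ?(ltW t0) ?ridge_prior_ge0//.
    by rewrite -(mulfV (lt0r_neq0 t0)) ler_pM2l// ridge_prior_le.
  by rewrite kappaE /Y /eta; field; rewrite lt0r_neq0.
rewrite -(ler_pM2l (_ : 0 < L / 2)) ?divr_gt0// -ExZ//.
apply: (@le_trans _ _ (Ex A (fun B => ((t + kappa t B) * ridge_prior t B i i 0 - 1) * Y B +
    1 ^+ 2 / (2 * L) * eta B ^+ 2))).
  apply: le_Ex => //; first by regular.
  by regular.
rewrite ExD//; last by regular.
rewrite ExZ//.
have -> : L / 2 * (N%:R^-1 * resolvent_cst) = N%:R^-1 * trace_cst + 1 ^+ 2 / (2 * L) * (N%:R^-1 * (trace_cst / L)).
  by rewrite /resolvent_cst; field; rewrite !lt0r_neq0.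
apply: lerD; first exact: le_trans (ler_norm _) rel.
rewrite ler_wpM2l//; last exact: mean_trG_concentration.
by rewrite divr_ge0// mulr_ge0// ltW.
Qed.

End trace.
End gaussian_matrix.

Lemma scalemx_entry {R : realType} {m n : nat} (a : R) (X : 'M[R]_(m, n)) i j :
  (a *: X) i j = a * X i j.
Proof. by rewrite mxE. Qed.

(** * Concentration of the error and residual energies for frozen data *)

Section energy_concentration.
Context d (T : measurableType d) (R : realType) (P : probability T R).
Variables Delta t c : R.
Hypotheses (t0 : 0 < t) (c0 : 0 < c) (cE : Delta * (c + t) = c * (c + t) + c).
Local Notation L := (c + t).
Context {M N : nat} (A : 'I_M -> 'I_N -> {RV P >-> R}).
Hypothesis gA : gaussian_matrix Delta A.
Variables (v : 'cV[R]_M) (D : 'cV[R]_N) (k1 : R).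
Hypothesis k1_energy : ridge_energy t v D <= k1 * N%:R.

Let L0 : 0 < L. Proof. by rewrite addr_gt0. Qed.
Let N0 : (0 < N)%N. Proof. by case: gA. Qed.
Let Nr0 : 0 < N%:R :> R. Proof. by rewrite ltr0n. Qed.
Let s0 : 0 < Num.sqrt (N%:R^-1 : R). Proof. by rewrite sqrtr_gt0 invr_gt0. Qed.
Let sN : Num.sqrt (N%:R^-1 : R) ^+ 2 = N%:R^-1.
Proof. by rewrite sqr_sqrtr// invr_ge0 ltW. Qed.

Let k10 : 0 <= k1.
Proof. by rewrite -(pmulr_lge0 _ Nr0); apply: le_trans k1_energy; exact: ridge_energy_ge0. Qed.

Let r (B : 'M[R]_(M, N)) := ridge_res t B v D.
Let e (B : 'M[R]_(M, N)) := ridge t B v D.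

Definition mean_sqr_error B : R := N%:R^-1 * dot (e B) (e B).
Definition mean_sqr_res B : R := N%:R^-1 * dot (r B) (r B).
Let q := mean_sqr_error.
Let rho := mean_sqr_res.
Let s B := N%:R^-1 * dot D (e B).
Let w B := N%:R^-1 * dot v (r B).
Let dd := N%:R^-1 * dot D D.
Let sv := N%:R^-1 * dot v v.
Let g (B : 'M[R]_(M, N)) := mean_trG t B.
Let eta B := g B - L^-1.

Let rr m : regular0 (fun B => r B m 0). Proof. exact: regular0_ridge_res. Qed.
Let re i : regular0 (fun B => e B i 0). Proof. exact: regular0_ridge. Qed.
Let rg : regular0 g. Proof. exact: regular0_mean_trG. Qed.
Let rk : regular0 (fun B : 'M[R]_(M, N) => kappa t B). Proof. exact: regular0_kappa. Qed.

Ltac reg := regular; match goal with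
  | |- regular0 (fun B => fun_of_matrix (r B) _ _) => exact: rr
  | |- regular0 (fun B => fun_of_matrix (e B) _ _) => exact: re
  | |- regular0 (fun B => g B) => exact: rg
  | |- _ => idtac
  end.

Let rq : regular0 q. Proof. by rewrite /q /mean_sqr_error /dot; reg. Qed.
Let rrho : regular0 rho. Proof. by rewrite /rho /mean_sqr_res /dot; reg. Qed.
Let rs : regular0 s. Proof. by rewrite /s /dot; reg. Qed.
Let rw : regular0 w. Proof. by rewrite /w /dot; reg. Qed.

Let kE : ridge_energy t v D / N%:R <= k1. Proof. by rewrite ler_pdivrMr. Qed.

Let q_ge0 B : 0 <= q B. Proof. by rewrite mulr_ge0 ?dot_ge0// invr_ge0 ltW. Qed.
Let rho_ge0 B : 0 <= rho B. Proof. by rewrite mulr_ge0 ?dot_ge0// invr_ge0 ltW. Qed.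

Let q_le B : q B <= k1 / t.
Proof.
rewrite /q /mean_sqr_error ler_pdivrMl//; apply: le_trans (ridge_le t0 _ _ _) _.
by rewrite mulrA ler_pM2r ?invr_gt0// mulrC.
Qed.

Let rho_le B : rho B <= k1.
Proof.
rewrite /rho /mean_sqr_res ler_pdivrMl//; apply: le_trans (ridge_res_le t0 _ _ _) _.
by rewrite mulrC.
Qed.

Let vv_le : sv <= k1.
Proof.
rewrite /sv ler_pdivrMl// [leRHS]mulrC; apply: le_trans k1_energy.
by rewrite lerDl mulr_ge0 ?dot_ge0// ltW.
Qed.

Let DD_le : dd <= k1 / t.
Proof.
rewrite /dd ler_pdivrMl// mulrA ler_pdivlMr// [leRHS]mulrC; apply: le_trans k1_energy.
by rewrite [dot D D * t]mulrC lerDr dot_ge0.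
Qed.

Let half_dot_le n (x y : 'cV[R]_n) a b : N%:R^-1 * dot x x <= a -> N%:R^-1 * dot y y <= b ->
  `|N%:R^-1 * dot x y| <= (a + b) / 2.
Proof.
move=> xa yb; rewrite normrM gtr0_norm ?invr_gt0//.
apply: le_trans (ler_wpM2l _ (dot_le_half x y)) _; first by rewrite invr_ge0 ltW.
by rewrite mulrA ler_pM2r// mulrDr lerD.
Qed.

Let s_le B : `|s B| <= k1 / t.
Proof. by apply: le_trans (half_dot_le DD_le (q_le B)) _; lra. Qed.

Let w_le B : `|w B| <= k1.
Proof. by apply: le_trans (half_dot_le vv_le (rho_le B)) _; lra. Qed.

(** An exact identity between the four unknowns [q], [rho], [s], [w]. With the three approximate
    relations below it forms a closed linear system once [kappa] and [g] are near their limits. *)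
Let rhoE B : rho B = w B - t * (q B - s B).
Proof. by rewrite /rho /mean_sqr_res ridge_res_energy// /w /q /s /mean_sqr_error; ring. Qed.

Section test_function.
Variables (Y : 'M[R]_(M, N) -> R) (DY : 'M[R]_(M, N) -> 'M[R]_(M, N)) (kY kD : R).
Hypothesis rY : regular1 Y DY.
Hypothesis Y_le : forall B, `|Y B| <= kY.
Hypothesis DY_le : forall B, \sum_m \sum_i DY B m i ^+ 2 <= kD.

Let rY0 : regular0 Y. Proof. by case: rY. Qed.
Let kY0 : 0 <= kY. Proof. exact: le_trans (Y_le 0). Qed.

Definition relation_cst (k2 kpsi : R) : R :=
  (k1 * k2 + kD) / 2 + kY * kpsi * (k1 / t) + kY * ((k2 + k1 / t) / 2).

Lemma mean_tested_relation (phi psi : 'I_N -> 'M[R]_(M, N) -> R) (k2 kpsi : R) :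
  (forall i, regular1 (phi i) (fun B => psi i B *: Dridge t v D i B)) ->
  (forall i, regular0 (psi i)) -> 0 <= k2 -> 0 <= kpsi ->
  (forall B, \sum_i phi i B ^+ 2 <= k2 * N%:R) -> (forall i B, `|psi i B| <= kpsi) ->
  `|Ex A (fun B => N%:R^-1 *
      (\sum_i ((t + kappa t B) * e B i 0 - t * D i 0) * phi i B) * Y B) -
    Ex A (fun B => rho B * (N%:R^-1 * \sum_i psi i B * ridge_prior t B i i 0) * Y B)|
  <= N%:R^-1 * relation_cst k2 kpsi.
Proof.
case: gA => _ _ Al Ai rphi rpsi k20 kpsi0 phile psile.
have Ni0 : 0 < N%:R^-1 :> R by rewrite invr_gt0.
have rphi0 i : regular0 (phi i) by case: (rphi i).
(* The weight is [mu = N^-1]: the energy and the sum of [phi_i ^+ 2] are both of order [N], so the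
   two terms of Young's inequality balance. *)
have := tested_relation s0 t0 N0 sN Al Ai rphi rpsi rY Ni0 phile psile Y_le DY_le.
set X1 := Ex A _; set X2 := Ex A _ => h.
have -> : Ex A (fun B => N%:R^-1 *
    (\sum_i ((t + kappa t B) * e B i 0 - t * D i 0) * phi i B) * Y B) = N%:R^-1 * X1.
  rewrite -ExZ; last first.
    by apply: regular0_sum => i; reg; first [exact: rphi0|exact: rk|exact: rY0].
  by apply: eq_Ex => B; rewrite -mulrA mulr_suml.
have -> : Ex A (fun B => rho B * (N%:R^-1 * \sum_i psi i B * ridge_prior t B i i 0) * Y B)
    = N%:R^-1 * (N%:R^-1 * X2).
  rewrite -ExZ; last first.
    by rewrite /dot; apply: regular0_sum => i; reg; first [exact: rpsi|exact: rY0].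
  rewrite -ExZ; last first.
    by rewrite /dot; reg; first [exact: rpsi|exact: rY0].
  apply: eq_Ex => B; rewrite /rho /mean_sqr_res -/(r B).
  move: (dot (r B) (r B)) => z; rewrite !mulr_sumr !mulr_suml.
  by apply: eq_bigr => i _; ring.
rewrite -mulrBr normrM (gtr0_norm Ni0) ler_pM2l//.
apply: le_trans h _; rewrite ler_pdivrMl//.
set E0 := ridge_energy t v D; set n : R := N%:R.
have E0k : E0 <= k1 * n by [].
have -> : n^-1 * E0 * (k2 * n) = k2 * E0 by field; rewrite lt0r_neq0.
rewrite invrK /relation_cst.
have h1 := ler_wpM2l k20 E0k.
have kYp : 0 <= kY * kpsi / t by rewrite divr_ge0 ?mulr_ge0// ltW.
have h2 := ler_wpM2l kYp E0k.
have kYt : 0 <= kY / t / 2 by rewrite !divr_ge0// ltW.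
have h3 := ler_wpM2l kYt E0k.
have -> : (k2 * E0 + kD * n) / 2 + kY * kpsi * (E0 / t) + kY * ((k2 * n + E0 / t) / 2) =
  (k2 * E0 + kD * n) / 2 + kY * kpsi / t * E0 + kY * k2 * n / 2 + kY / t / 2 * E0.
  by field; rewrite lt0r_neq0.
have -> : n * ((k1 * k2 + kD) / 2 + kY * kpsi * (k1 / t) + kY * ((k2 + k1 / t) / 2)) =
  (k2 * (k1 * n) + kD * n) / 2 + kY * kpsi / t * (k1 * n) + kY * k2 * n / 2 +
  kY / t / 2 * (k1 * n).
  by field; rewrite lt0r_neq0.
lra.
Qed.

(** Testing against the fixed vector [D], so that [psi] vanishes. *)
Lemma signal_relation :
  `|Ex A (fun B => ((t + kappa t B) * s B - t * dd) * Y B)| <= N%:R^-1 * relation_cst (k1 / t) 0.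
Proof.
have rphi (i : 'I_N) : regular1 (fun B : 'M[R]_(M, N) => D i 0)
    (fun B => (0 : R) *: Dridge t v D i B).
  by have := @regular1_cst R M N (D i 0); congr regular1; apply/funext => B; rewrite scale0r.
have DDn : dot D D <= k1 / t * N%:R by rewrite mulrC -ler_pdivrMl.
have k1t : 0 <= k1 / t by rewrite divr_ge0// ltW.
have phile (B : 'M[R]_(M, N)) : \sum_i D i 0 ^+ 2 <= k1 / t * N%:R.
  apply: le_trans DDn; rewrite le_eqVlt; apply/orP; left; apply/eqP.
  by apply: eq_bigr => i _; rewrite expr2.
have psile (i : 'I_N) (B : 'M[R]_(M, N)) : `|0 : R| <= 0 by rewrite normr0.
have := mean_tested_relation rphi (fun=> regular0_cst 0) k1t (lexx 0) phile psile.
rewrite [X in `|_ - X|](_ : _ = 0); last first.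
  transitivity (Ex A (fun=> 0)); last exact: Ex_cst.
  by apply: eq_Ex => B; rewrite big1 ?mulr0 ?mul0r// => i _; rewrite mul0r.
rewrite subr0 (_ : Ex A _ =
  Ex A (fun B => ((t + kappa t B) * s B - t * dd) * Y B)) //.
apply: eq_Ex => B; congr (_ * _).
rewrite /s /dd /dot [(t + _) * _]mulrCA [t * (_ * _)]mulrCA -mulrBr; congr (_ * _).
by rewrite !mulr_sumr -sumrB; apply: eq_bigr => i _; ring.
Qed.

(** Testing against the error itself, [phi_i = e_i] and [psi_i = 1], so that the trace of the
    resolvent appears next to [rho]. *)
Lemma error_relation :
  `|Ex A (fun B => ((t + kappa t B) * q B - t * s B - g B * rho B) * Y B)|
  <= N%:R^-1 * relation_cst (k1 / t) 1.
Proof.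
have rphi (i : 'I_N) : regular1 (fun B : 'M[R]_(M, N) => e B i 0)
    (fun B => (1 : R) *: Dridge t v D i B).
  have := regular1_ridge t0 v D i.
  by congr regular1; apply/funext => B; rewrite scale1r.
have k1t : 0 <= k1 / t by rewrite divr_ge0// ltW.
have phile B : \sum_i e B i 0 ^+ 2 <= k1 / t * N%:R.
  have -> : \sum_i e B i 0 ^+ 2 = dot (e B) (e B) by apply: eq_bigr => i _; rewrite expr2.
  by have := q_le B; rewrite /q /mean_sqr_error ler_pdivrMl// mulrC.
have psile (i : 'I_N) (B : 'M[R]_(M, N)) : `|1 : R| <= 1 by rewrite normr1.
have := mean_tested_relation rphi (fun=> regular0_cst 1) k1t ler01 phile psile.
rewrite -ExB; last 2 first.
- by reg; first [exact: rk|exact: rY0].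
- by reg; first [exact: rrho|exact: rY0].
rewrite (_ : Ex A _ =
  Ex A (fun B => ((t + kappa t B) * q B - t * s B - g B * rho B) * Y B)); last first.
  apply: eq_Ex => B; rewrite -mulrBl; congr (_ * _).
  congr (_ - _); last first.
    rewrite mulrC; congr (_ * _); rewrite /g /mean_trG /trG; congr (_ * _).
    by apply: eq_bigr => i _; rewrite mul1r.
  rewrite /q /mean_sqr_error /s /dot [(t + _) * _]mulrCA [t * (_ * _)]mulrCA -mulrBr.
  congr (_ * _).
  rewrite !mulr_sumr -sumrB; apply: eq_bigr => i _; ring.
by [].
Qed.

Lemma noise_residual_relation :
  `|Ex A (fun B => (sv - (1 + g B) * w B) * Y B)| <= N%:R^-1 * relation_cst (k1 / t) 0.
Proof.
case: gA => _ _ Al Ai.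
have Ni0 : 0 < N%:R^-1 :> R by rewrite invr_gt0.
have h := noise_relation s0 t0 N0 sN Al Ai v D rY Ni0 Y_le DY_le.
rewrite (_ : Ex A _ = N%:R^-1 * Ex A (fun B =>
  (dot v v - (1 + N%:R^-1 * trG t B) * dot v (r B)) * Y B)); last first.
  rewrite -ExZ; last first.
    by rewrite /dot; have := rg; rewrite /g /mean_trG => rg'; reg; exact: rY0.
  by apply: eq_Ex => B; rewrite /sv /w /g /mean_trG; ring.
rewrite normrM (gtr0_norm Ni0) ler_pM2l//; apply: le_trans h _.
rewrite /relation_cst mulr0 mul0r addr0.
have vvk : dot v v <= k1 * N%:R by rewrite mulrC -ler_pdivrMl.
have E0 := ridge_energy_ge0 t0 v D.
have vE : dot v v * ridge_energy t v D <= k1 * N%:R * (k1 * N%:R).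
  by apply: ler_pM => //; exact: dot_ge0.
rewrite ler_pdivrMl//; set n : R := N%:R in vvk vE *; set E := ridge_energy t v D in vE *.
have Ek : E <= k1 * n by [].
rewrite invrK.
have -> : n^-1 * dot v v * (E / t) = (n * t)^-1 * (dot v v * E).
  by field; rewrite !lt0r_neq0.
have -> : n * ((k1 * (k1 / t) + kD) / 2 + kY * ((k1 / t + k1 / t) / 2)) =
  ((n * t)^-1 * (k1 * n * (k1 * n)) + kD * n) / 2 + kY * (k1 * n / t + k1 * n / t) / 2.
  by field; rewrite !lt0r_neq0.
rewrite mulrA lerD// ler_pM2r//.
  by rewrite lerD2r ler_pM2l// invr_gt0 mulr_gt0.
by rewrite ler_wpM2l// lerD// ler_pM2r ?invr_gt0.
Qed.

(** If a deviation is a combination of the three relation defects plus the trace fluctuation times a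
    bounded quantity, testing with that deviation bounds its own second moment. *)
Lemma square_of_relations (lam b2 b3 b4 kZ : R) (Z : 'M[R]_(M, N) -> R) :
  0 < lam -> regular0 Z -> (forall B, `|Z B| <= kZ) ->
  (forall B, lam * Y B = b4 * ((t + kappa t B) * q B - t * s B - g B * rho B) +
    b2 * ((t + kappa t B) * s B - t * dd) + b3 * (sv - (1 + g B) * w B) - eta B * Z B) ->
  Ex A (fun B => Y B ^+ 2) <= N%:R^-1 * (2 / lam * (`|b4| * relation_cst (k1 / t) 1 +
    (`|b2| + `|b3|) * relation_cst (k1 / t) 0 + kZ ^+ 2 / (2 * lam) * (trace_cst t c / L))).
Proof.
move=> lam0 rZ ZkZ YE.
pose R4 B := ((t + kappa t B) * q B - t * s B - g B * rho B) * Y B.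
pose R2 B := ((t + kappa t B) * s B - t * dd) * Y B.
pose R3 B := (sv - (1 + g B) * w B) * Y B.
have r4 : regular0 R4 by rewrite /R4; reg; first [exact: rk|exact: rq|exact: rs|exact: rrho|exact: rY0].
have r2 : regular0 R2 by rewrite /R2; reg; first [exact: rk|exact: rs|exact: rY0].
have r3 : regular0 R3 by rewrite /R3; reg; first [exact: rw|exact: rY0].
have reta : regular0 eta by rewrite /eta; reg.
have reta2 : regular0 (fun B => eta B ^+ 2) by under eq_fun do rewrite expr2; exact: regular0M.
have rY2 : regular0 (fun B => Y B ^+ 2) by under eq_fun do rewrite expr2; exact: regular0M.
have rb b F : regular0 F -> regular0 (fun B => b * F B).
  by move=> rF; apply: regular0M => //; exact: regular0_cst.
have lam2 : 0 < lam / 2 by rewrite divr_gt0.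
have cst0 : 0 <= kZ ^+ 2 / (2 * lam) by rewrite divr_ge0 ?sqr_ge0// mulr_ge0// ltW.
rewrite -(ler_pM2l lam2) -ExZ//.
apply: (@le_trans _ _ (Ex A (fun B => b4 * R4 B + b2 * R2 B + b3 * R3 B +
    kZ ^+ 2 / (2 * lam) * eta B ^+ 2))).
  apply: le_Ex; [exact: rb| |].
    by apply: regular0D; [apply: regular0D; [apply: regular0D|]|]; exact: rb.
  move=> B; have := absorb_square lam0 (ZkZ B) (YE B).
  move=> h; apply: le_trans h _; rewrite lerD2r le_eqVlt; apply/orP; left; apply/eqP.
  by rewrite /R4 /R2 /R3; ring.
rewrite ExD; [|by apply: regular0D; [apply: regular0D|]; exact: rb|exact: rb].
rewrite ExD; [|by apply: regular0D; exact: rb|exact: rb].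
rewrite ExD; [|exact: rb|exact: rb].
rewrite !ExZ//.
have -> : lam / 2 * (N%:R^-1 * (2 / lam * (`|b4| * relation_cst (k1 / t) 1 +
    (`|b2| + `|b3|) * relation_cst (k1 / t) 0 + kZ ^+ 2 / (2 * lam) * (trace_cst t c / L)))) =
  `|b4| * (N%:R^-1 * relation_cst (k1 / t) 1) + `|b2| * (N%:R^-1 * relation_cst (k1 / t) 0) +
  `|b3| * (N%:R^-1 * relation_cst (k1 / t) 0) +
  kZ ^+ 2 / (2 * lam) * (N%:R^-1 * (trace_cst t c / L)).
  by field; rewrite !lt0r_neq0.
have le_abs (b x y : R) : `|x| <= y -> b * x <= `|b| * y.
  by move=> xy; apply: le_trans (ler_norm _) _; rewrite normrM ler_wpM2l.
apply: lerD; [apply: lerD; [apply: lerD|]|].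
- exact: le_abs error_relation.
- exact: le_abs signal_relation.
- exact: le_abs noise_residual_relation.
- by rewrite ler_wpM2l//; exact: (mean_trG_concentration t0 c0 cE gA).
Qed.

End test_function.

Local Notation gs := (L^-1).
Let lam := L + gs * t.
Let gs0 : 0 < gs. Proof. by rewrite invr_gt0. Qed.
Let lam0 : 0 < lam. Proof. by rewrite addr_gt0// mulr_gt0. Qed.
Let gs1 : 0 < 1 + gs. Proof. by rewrite addr_gt0. Qed.
Let ss := t * dd / L.
Let ws := sv / (1 + gs).

Definition limit_sqr_error := ((1 + gs) * t * ss + gs * ws) / lam.
Definition limit_sqr_res := ws - t * (limit_sqr_error - ss).
Let qs := limit_sqr_error.
Let rhos := limit_sqr_res.

(** [a2] and [- a3] are the multipliers of the signal and noise relations after eliminating [s] and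
    [w] from the linear system; [kq], [kr], [kZ] and [kZ'] bound what remains. *)
Let a2 := (1 + gs) * t / L.
Let a3 := gs / (1 + gs).
Let kq := ((1 + gs) * t * (k1 / L) + gs * (k1 / (1 + gs))) / lam.
Let kr := k1 / (1 + gs) + t * kq + t * (k1 / L).
Let kZ := k1 * (2 + a2 + a3).
Let kZ' := k1 / (1 + gs) + t / lam * kZ + t / L * k1.

(** The bound of [square_of_relations] with multipliers [1], [a2], [- a3]. The gradient constant
    [16 * k1 ^+ 2 / t ^+ 3] is [Dridge_sum_sqr] applied to [psi = (2 / N) e]. *)
Definition sqr_error_cst : R := let kY := k1 / t + kq in let kD := 16 * k1 ^+ 2 / t ^+ 3 in
  2 / lam * (`|1| * relation_cst kY kD (k1 / t) 1 +
    (`|a2| + `|- a3|) * relation_cst kY kD (k1 / t) 0 + kZ ^+ 2 / (2 * lam) * (trace_cst t c / L)).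

Definition sqr_res_cst : R := let kY := k1 + kr in let kD := 16 * k1 ^+ 2 / t in
  2 / 1 * (`|- (t / lam)| * relation_cst kY kD (k1 / t) 1 +
    (`|t / L - t / lam * a2| + `|t / lam * a3 - (1 + gs)^-1|) * relation_cst kY kD (k1 / t) 0 +
    kZ' ^+ 2 / (2 * 1) * (trace_cst t c / L)).

Let dd0 : 0 <= dd. Proof. by rewrite mulr_ge0 ?dot_ge0// invr_ge0 ltW. Qed.
Let sv0 : 0 <= sv. Proof. by rewrite mulr_ge0 ?dot_ge0// invr_ge0 ltW. Qed.

Let ss_le : 0 <= ss <= k1 / L.
Proof.
apply/andP; split.
  by apply: divr_ge0; [apply: mulr_ge0 => //; exact: ltW|exact: ltW].
by rewrite ler_pM2r ?invr_gt0// mulrC -ler_pdivlMr.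
Qed.

Let ws_le : 0 <= ws <= k1 / (1 + gs).
Proof.
apply/andP; split; first by apply: divr_ge0 => //; exact: ltW.
by rewrite ler_pM2r// invr_gt0.
Qed.

Let qs_le : 0 <= qs <= kq.
Proof.
case/andP: ss_le => ss0 ssk; case/andP: ws_le => ws0 wsk.
have c1 : 0 <= (1 + gs) * t by rewrite mulr_ge0// ltW.
apply/andP; split.
  apply: divr_ge0; last exact: ltW.
  by apply: addr_ge0; apply: mulr_ge0 => //; exact: ltW.
rewrite ler_pM2r ?invr_gt0// lerD//; first by rewrite ler_wpM2l.
by rewrite ler_wpM2l// ltW.
Qed.

Let rhos_le : `|rhos| <= kr.
Proof.
case/andP: ss_le => ss0 ssk; case/andP: ws_le => ws0 wsk; case/andP: qs_le => qs0 qsk.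
rewrite /rhos /limit_sqr_res -/qs; apply: le_trans (ler_normB _ _) _.
rewrite ger0_norm// /kr -addrA lerD// normrM (gtr0_norm t0) -mulrDr ler_pM2l//.
by apply: le_trans (ler_normB _ _) _; rewrite !ger0_norm// lerD.
Qed.

Let Z B := - (rho B - t * q B) + a2 * (t * s B) + a3 * w B.
Let rZ : regular0 Z.
Proof. by rewrite /Z; reg; first [exact: rrho|exact: rq|exact: rs|exact: rw]. Qed.

Let a20 : 0 <= a2.
Proof. by apply: divr_ge0; [apply: mulr_ge0|]; exact: ltW. Qed.
Let a30 : 0 <= a3. Proof. by apply: divr_ge0; exact: ltW. Qed.

Let ts_le B : `|t * s B| <= k1.
Proof. by rewrite normrM (gtr0_norm t0) -ler_pdivlMl// mulrC s_le. Qed.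

Let Z_le B : `|Z B| <= kZ.
Proof.
rewrite /Z /kZ !mulrDr [k1 * a2]mulrC [k1 * a3]mulrC.
apply: le_trans (ler_normD _ _) _; rewrite normrM (ger0_norm a30).
apply: lerD; last by rewrite ler_wpM2l.
apply: le_trans (ler_normD _ _) _; rewrite normrM (ger0_norm a20).
apply: lerD; last by rewrite ler_wpM2l.
rewrite normrN; apply: le_trans (ler_normB _ _) _.
have tq0 : 0 <= t * q B by apply: mulr_ge0 => //; exact: ltW.
rewrite (ger0_norm (rho_ge0 B)) (ger0_norm tq0).
have := rho_le B; have : t * q B <= k1 by rewrite -ler_pdivlMl// mulrC.
by lra.
Qed.

Let tkE B : t + kappa t B = L + t * eta B.
Proof. exact: kappaE gA B. Qed.

Let sE B : s B - ss = (((t + kappa t B) * s B - t * dd) - eta B * (t * s B)) / L.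
Proof. by rewrite tkE /ss; field; rewrite lt0r_neq0. Qed.

Let wE B : w B - ws = - ((sv - (1 + g B) * w B) + eta B * w B) / (1 + gs).
Proof. by rewrite /ws /eta; field; rewrite !lt0r_neq0// addrC addr_gt0// ltr01. Qed.

(** [s] and [w] are eliminated through [sE] and [wE], and [rho] through [rhoE]. Each replacement of
    [kappa] or [g] by its limit costs [eta] times a bounded quantity; these costs make up [Z]. *)
Let qE B : lam * (q B - qs) = 1 * ((t + kappa t B) * q B - t * s B - g B * rho B) +
    a2 * ((t + kappa t B) * s B - t * dd) + (- a3) * (sv - (1 + g B) * w B) - eta B * Z B.
Proof.
have -> : lam * (q B - qs) = lam * q B - ((1 + gs) * t * ss + gs * ws).
  by rewrite mulrBr /qs /limit_sqr_error mulrC [X in _ - X]mulrC divfK// lt0r_neq0.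
have -> : ss = s B - (s B - ss) by rewrite subKr.
have -> : ws = w B - (w B - ws) by rewrite subKr.
rewrite sE wE tkE rhoE /Z /a2 /a3 rhoE /lam.
have -> : g B = eta B + gs by rewrite /eta subrK.
by field; rewrite !lt0r_neq0// addrC addr_gt0// ltr01.
Qed.

Let Z' B := w B / (1 + gs) - t / lam * Z B + t / L * (t * s B).
Let rZ' : regular0 Z'.
Proof. by rewrite /Z'; reg; first [exact: rZ|exact: rs|exact: rw]. Qed.

Let Z'_le B : `|Z' B| <= kZ'.
Proof.
have tl : 0 <= t / lam by apply: divr_ge0; exact: ltW.
have tL : 0 <= t / L by apply: divr_ge0; exact: ltW.
rewrite /Z' /kZ'; apply: le_trans (ler_normD _ _) _; apply: lerD.
  apply: le_trans (ler_normB _ _) _; apply: lerD.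
    by rewrite normrM (gtr0_norm (_ : 0 < (1 + gs)^-1)) ?invr_gt0// ler_pM2r ?invr_gt0.
  by rewrite normrM (ger0_norm tl) ler_wpM2l.
by rewrite normrM (ger0_norm tL) ler_wpM2l.
Qed.

(** By [rhoE] the deviation of [rho] is the deviation of [w] minus [t] times those of [q] and [s],
    each expressed above through the relations. *)
Let rhoE' B : 1 * (rho B - rhos) =
    - (t / lam) * ((t + kappa t B) * q B - t * s B - g B * rho B) +
    (t / L - t / lam * a2) * ((t + kappa t B) * s B - t * dd) +
    (t / lam * a3 - (1 + gs)^-1) * (sv - (1 + g B) * w B) - eta B * Z' B.
Proof.
have -> : 1 * (rho B - rhos) = (w B - ws) - t / lam * (lam * (q B - qs)) + t * (s B - ss).
  rewrite rhoE /rhos /limit_sqr_res -/qs; field; exact: lt0r_neq0.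
rewrite qE sE wE /Z'; move: (Z B) => z; rewrite /a2 /a3.
by field; rewrite !lt0r_neq0// addrC addr_gt0// ltr01.
Qed.

Let kDE n (psi x : 'cV[R]_n) : psi = (N%:R^-1 * 2) *: x ->
  dot psi psi = 4 / N%:R ^+ 2 * dot x x.
Proof. by move=> ->; rewrite dotZl dotZr; field; rewrite lt0r_neq0. Qed.

Lemma sqr_error_concentration :
  Ex A (fun B => (mean_sqr_error B - limit_sqr_error) ^+ 2) <= N%:R^-1 * sqr_error_cst.
Proof.
pose DY (B : 'M[R]_(M, N)) := \sum_(j < N) ((N%:R^-1 * 2) *: e B) j 0 *: Dridge t v D j B.
have rY : regular1 (fun B => mean_sqr_error B - limit_sqr_error) DY.
  have r1 (j : 'I_N) := regular1M (regular1_ridge t0 v D j) (regular1_ridge t0 v D j).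
  have := regular1D (regular1Z N%:R^-1 (regular1_sum (index_enum 'I_N) r1))
    (regular1_cst (- limit_sqr_error)).
  congr regular1; apply/funext => B; rewrite addr0 scaler_sumr; apply: eq_bigr => j _.
  rewrite -/(e B) -scalerDl -mulr2n scalerA; congr (_ *: _).
  by rewrite [RHS]scalemx_entry -mulr_natr; ring.
apply: (square_of_relations rY _ _ lam0 rZ Z_le) => // B.
- apply: le_trans (ler_normB _ _) _; apply: lerD.
    by rewrite ger0_norm ?q_ge0// q_le.
  by case/andP: qs_le => qs0 qsk; rewrite ger0_norm.
- apply: le_trans (Dridge_sum_sqr t0 B v D _) _.
  rewrite (kDE erefl).
  have := q_le B; rewrite /q /mean_sqr_error ler_pdivrMl// => h.
  have E0 := ridge_energy_ge0 t0 v D.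
  have h2 : ridge_energy t v D * dot (e B) (e B) <= (k1 * N%:R) * (N%:R * (k1 / t)).
    by apply: ler_pM => //; exact: dot_ge0.
  have c1 : 0 <= 16 / t ^+ 2 / N%:R ^+ 2.
    by rewrite !divr_ge0// exprn_ge0// ltW.
  have := ler_wpM2l c1 h2; congr (_ <= _); field; rewrite !lt0r_neq0//.
Qed.

Lemma sqr_res_concentration :
  Ex A (fun B => (mean_sqr_res B - limit_sqr_res) ^+ 2) <= N%:R^-1 * sqr_res_cst.
Proof.
pose DY (B : 'M[R]_(M, N)) := \sum_(j < M) ((N%:R^-1 * 2) *: r B) j 0 *: Dridge_res t v D j B.
have rY : regular1 (fun B => mean_sqr_res B - limit_sqr_res) DY.
  have r1 (j : 'I_M) := regular1M (regular1_ridge_res t0 v D j) (regular1_ridge_res t0 v D j).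
  have := regular1D (regular1Z N%:R^-1 (regular1_sum (index_enum 'I_M) r1))
    (regular1_cst (- limit_sqr_res)).
  congr regular1; apply/funext => B; rewrite addr0 scaler_sumr; apply: eq_bigr => j _.
  rewrite -/(r B) -scalerDl -mulr2n scalerA; congr (_ *: _).
  by rewrite [RHS]scalemx_entry -mulr_natr; ring.
apply: (square_of_relations rY _ _ ltr01 rZ' Z'_le) => // B.
- apply: le_trans (ler_normB _ _) _; apply: lerD; last exact: rhos_le.
  by rewrite ger0_norm ?rho_ge0// rho_le.
- apply: le_trans (Dridge_res_sum_sqr t0 B v D _) _.
  rewrite (kDE erefl).
  have := rho_le B; rewrite /rho /mean_sqr_res ler_pdivrMl// => h.
  have E0 := ridge_energy_ge0 t0 v D.
  have h2 : ridge_energy t v D * dot (r B) (r B) <= (k1 * N%:R) * (N%:R * k1).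
    by apply: ler_pM => //; exact: dot_ge0.
  have c1 : 0 <= 16 / t / N%:R ^+ 2.
    by rewrite !divr_ge0// ?exprn_ge0// ltW.
  have := ler_wpM2l c1 h2; congr (_ <= _); field; rewrite !lt0r_neq0//.
Qed.

End energy_concentration.

(** * Stein's equation for a centred normal law *)

Section stein_equation.
Context {R : realType} (tau : R).
Hypothesis tau0 : 0 < tau.
Notation mu := (@lebesgue_measure R).
Notation p := (@normal_pdf R 0 tau).

Let cp : continuous p. Proof. by apply: continuous_normal_pdf; rewrite gt_eqF. Qed.
Let p0 a : 0 < p a. Proof. exact: normal_pdf_gt0. Qed.
Let pge0 a : 0 <= p a. Proof. exact: normal_pdf_ge0. Qed.
Let mp : measurable_fun setT p. Proof. exact: measurable_normal_pdf. Qed.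

Let ip A : measurable A -> mu.-integrable A (EFin \o p).
Proof. move=> mA; apply: integrableS (integrable_normal_pdf 0 tau) => //. Qed.

Let tail a := \int[mu]_(x in `[a, +oo[) p x.

Let tail_first_moment a : 0 <= a -> \int[mu]_(x in `[a, +oo[) (x * p x) = tau ^+ 2 * p a.
Proof.
move=> a0.
have dF (x : R) : is_derive x (1 : R) (fun x => - (tau ^+ 2 * p x)) (x * p x).
  have dp := is_derive_normal_pdf tau0 x.
  apply: is_derive_eq; rewrite /GRing.scale/=.
  by field; rewrite gt_eqF.
have cF : continuous (fun x => - (tau ^+ 2 * p x)).
  by move=> x; apply: differentiable_continuous; apply/derivable1_diffP; case: (dF x).
rewrite (@Rintegral_ge0_continuous_FTC2y _ _ (fun x => - (tau ^+ 2 * p x)) a 0).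
- by rewrite sub0r opprK.
- by move=> x ax; rewrite mulr_ge0// (le_trans a0).
- apply: continuous_subspaceT => x; apply: cvgM => //; exact: cp.
- have [K HK] := normal_pdf_quadratic_bound tau0.
  have K0 : 0 <= K by apply: le_trans (HK 0); rewrite mulr_ge0// addr_ge0// sqr_ge0.
  apply/norm_cvg0P.
  apply: (@squeeze_cvgr _ _ _ _ (cst 0) (fun x => tau ^+ 2 * K * x^-1)).
  + near=> x; rewrite normr_ge0/= normrN normrM !ger0_norm ?sqr_ge0// -mulrA.
    rewrite ler_wpM2l ?sqr_ge0//.
    have x1 : 1 <= x by near: x; exact: nbhs_pinfty_ge.
    rewrite ler_pdivlMr; last exact: lt_le_trans x1.
    apply: le_trans (HK x); rewrite mulrC ler_wpM2r//.
    by have := sqr_ge0 (x - 1); nra.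
  + exact: cvg_cst.
  + rewrite -(mulr0 (tau ^+ 2 * K)); apply: cvgM; first exact: cvg_cst.
    by apply/(@gtr0_cvgV0 _ _ _ _ id); [near=> x; near: x; exact: nbhs_pinfty_gt|exact: cvg_id].
- by move=> x _; case: (dF x).
- by apply: cvg_at_right_filter; exact: cF.
- by move=> x _; rewrite derive1E; case: (dF x).
Unshelve. all: by end_near. Qed.

Let tail_ge0 a : 0 <= tail a. Proof. by apply: Rintegral_ge0 => x _. Qed.

Let tail_le1 a : tail a <= 1.
Proof.
rewrite -[leRHS]/(fine 1%:E) -(integral_normal_pdf 0 tau) /tail /Rintegral fine_le//.
- by apply: integrable_fin_num => //; exact: ip.
- by apply: integrable_fin_num => //; exact: ip.
- by apply: ge0_subset_integral => //; [exact/measurable_EFinP|move=> x _; rewrite lee_fin].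
Qed.

(** Mills' bound: on [[a, +oo[] the integrand [a p] is at most [x p], whose integral is exact
    because [x p] is the derivative of [- tau ^+ 2 * p]. *)
Let tail_mills a : 0 <= a -> a * tail a <= tau ^+ 2 * p a.
Proof.
move=> a0; rewrite -tail_first_moment// /tail -RintegralZl//; last exact: ip.
apply: le_Rintegral => //.
- have mA : measurable ([set` `[a, +oo[] : set (measurableTypeR R)) by exact: measurable_itv.
  by have := integrableZl mA a (ip mA).
- have := (integrable_normal_prob_quadratic tau0 (f := id) (K := 1) _ _).1.
  move=> /(_ _ _)/integrableS h; apply: h => //.
  move=> x; rewrite mul1r -(real_normK (num_real x)).
  by have := sqr_ge0 (`|x| - 1); have := sqr_ge0 `|x|; lra.
- by move=> x; rewrite /= in_itv/= andbT => ax; rewrite ler_wpM2r.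
Qed.

Let tail_left a : \int[mu]_(x in `]-oo, (- a)]) p x = tail a.
Proof.
congr fine; rewrite ge0_integration_by_substitutionNy//.
- by apply: eq_integral => x _ /=; rewrite normal_pdf_sym.
- exact: continuous_subspaceT.
Qed.

Variables (h : R -> R) (C : R).
Hypothesis ch : continuous h.
Hypothesis hC : forall a, `|h a| <= C.

Definition stein_mean := \int[gauss tau]_a h a.
Let m := stein_mean.

Let C0 : 0 <= C. Proof. exact: le_trans (hC 0). Qed.

Let bh : bounded_mfun h.
Proof. by split; [exact: continuous_measurable_fun|exists C]. Qed.

Let mC : `|m| <= C.
Proof.
have bc (c : R) : bounded_mfun (fun _ : R => c) by exact: bounded_mfun_cst.
rewrite ler_norml -{1}(Rintegral_prob_cst (gauss tau) (- C)) -{2}(Rintegral_prob_cst (gauss tau) C).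
by apply/andP; split; apply: le_Rintegral_bounded => // a; have := hC a; rewrite ler_norml => /andP[].
Qed.

Let K a := (h a - m) * p a.

Let cK : continuous K.
Proof.
by move=> a; apply: cvgM; [apply: cvgB; [exact: ch|exact: cvg_cst]|exact: cp].
Qed.

Let mhp : mu.-integrable setT (EFin \o (fun a => h a * p a)).
Proof.
apply: (integrable_normal_prob_quadratic tau0 (K := C) _ _).1 => [|a]; first by case: bh.
by apply: le_trans (hC a) _; rewrite ler_peMr// lerDl sqr_ge0.
Qed.

Let iK A : measurable A -> mu.-integrable A (EFin \o K).
Proof.
move=> mA; apply: (integrableS measurableT) => //.
have := integrableB measurableT mhp (integrableZl measurableT m (ip measurableT)).
by congr integrable; apply/funext => a /=; rewrite /K mulrBl EFinB.
Qed.

Let K_le a : `|K a| <= 2 * C * p a.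
Proof.
rewrite /K normrM (ger0_norm (pge0 a)) ler_wpM2r//.
by apply: le_trans (ler_normB _ _) _; have := hC a; have := mC; lra.
Qed.

Let K_total : \int[mu]_a K a = 0.
Proof.
rewrite /K; under eq_Rintegral do rewrite mulrBl.
rewrite RintegralB//; last exact: (integrableZl measurableT m (ip measurableT)).
rewrite RintegralZl//; last exact: ip.
rewrite [X in m * X](_ : _ = 1); last by rewrite /Rintegral integral_normal_pdf.
rewrite mulr1 /m /stein_mean Rintegral_gauss; last exact: bounded_mfun_integrable.
by rewrite Rintegral_normal_prob// ?subrr//; case: bh.
Qed.

Let H y := \int[mu]_(x in `]-oo, y]) K x.

Let dH (y : R) : is_derive y (1 : R) H (K y).
Proof.
have yy : y < y + 1 by rewrite ltrDl.
have [|||d1 d2] := @continuous_FTC1 R K -oo%O y (y + 1) yy.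
- exact: iK.
- exact: ltNyr.
- exact: cK.
by split => //; rewrite -derive1E.
Qed.

Let abs_int_le A : measurable A ->
  `|\int[mu]_(x in A) K x| <= 2 * C * \int[mu]_(x in A) p x.
Proof.
move=> mA; apply: le_trans (le_normr_Rintegral mA (iK mA)) _.
rewrite -RintegralZl//; last exact: ip.
apply: le_Rintegral => //.
- by have := integrable_abse (iK mA).
- by have := integrableZl mA (2 * C) (ip mA).
Qed.

(** The total integral of [K] vanishes, so for [y >= 0] the integral up to [y] is minus the one
    beyond [y]; on either side only the tail past [|y|] counts. *)
Let H_le y : `|H y| <= 2 * C * tail `|y|.
Proof.
have [y0|y0] := leP 0 y.
  have : H y + \int[mu]_(x in `]y, +oo[) K x = 0.
    rewrite -K_total /H -Rintegral_setU//.
    - by rewrite -itv_bndbnd_setU ?bnd_simp//; congr Rintegral; apply/seteqP; split.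
    - by apply: iK; exact: measurableU.
    - apply/disj_setPS => x [/=]; rewrite !in_itv/= andbT => h1 h2.
      by have := le_lt_trans h1 h2; rewrite ltxx.
  move=> /eqP; rewrite addr_eq0 => /eqP ->; rewrite normrN (ger0_norm y0).
  have mA : measurable ([set` `]y, +oo[] : set (measurableTypeR R)) by exact: measurable_itv.
  apply: le_trans (abs_int_le mA) _; rewrite /tail.
  by rewrite Rintegral_itv_obnd_cbnd//; exact: ip.
have mA : measurable ([set` `]-oo, y]] : set (measurableTypeR R)) by exact: measurable_itv.
rewrite (ltr0_norm y0); apply: le_trans (abs_int_le mA) _.
by rewrite -tail_left opprK.
Qed.

(** The solution of [tau ^+ 2 * f' - y * f = h - m] by the integrating factor [p]. Only this one,
    with [H] vanishing at both ends, stays bounded. *)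
Definition stein_sol y := H y / (tau ^+ 2 * p y).
Definition stein_sol' y := (h y - m + y * stein_sol y) / tau ^+ 2.

Let tp0 y : 0 < tau ^+ 2 * p y. Proof. by rewrite mulr_gt0// exprn_gt0. Qed.

Lemma is_derive_stein_sol (y : R) : is_derive y (1 : R) stein_sol (stein_sol' y).
Proof.
have dp := is_derive_normal_pdf tau0 y; have dHy := dH y.
have nz : tau ^+ 2 * p y != 0 by rewrite gt_eqF.
have dV : is_derive y (1 : R) (fun y => (tau ^+ 2 * p y)^-1)
    (- (tau ^+ 2 * p y) ^- 2 * (tau ^+ 2 * (- (y / tau ^+ 2 * p y)))).
  have dtp : is_derive y (1 : R) (fun y => tau ^+ 2 * p y) (tau ^+ 2 * (- (y / tau ^+ 2 * p y))).
    by apply: is_derive_eq; rewrite /GRing.scale/=; ring.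
  exact: (is_deriveV (f := fun y => tau ^+ 2 * p y) nz dtp).
have E : H y *: (- (tau ^+ 2 * p y) ^- 2 * (tau ^+ 2 * (- (y / tau ^+ 2 * p y)))) +
    (tau ^+ 2 * p y)^-1 *: K y = stein_sol' y.
  rewrite /GRing.scale/= /stein_sol' /stein_sol /K.
  by field; rewrite !gt_eqF.
by have := is_deriveM dHy dV; rewrite E.
Qed.

Lemma stein_equation y : tau ^+ 2 * stein_sol' y - y * stein_sol y = h y - m.
Proof. by rewrite /stein_sol'; field; rewrite gt_eqF. Qed.

Lemma mul_stein_sol_le y : `|y * stein_sol y| <= 2 * C.
Proof.
rewrite /stein_sol mulrA normrM [in X in _ * X]gtr0_norm ?invr_gt0// ler_pdivrMr//.
rewrite normrM; apply: le_trans (ler_wpM2l (normr_ge0 _) (H_le y)) _.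
rewrite mulrCA ler_wpM2l ?mulr_ge0//.
apply: le_trans (tail_mills (normr_ge0 y)) _.
by case: (leP 0 y) => y0; [rewrite ger0_norm|rewrite ltr0_norm// normal_pdf_sym].
Qed.

(** Outside [[-1, 1]] the bound on [y * stein_sol y] is enough; inside, the density is at least
    [p 1] and the tail at most [1]. *)
Definition stein_cst := 2 * C * (1 + (tau ^+ 2 * p 1)^-1).

Lemma stein_sol_le y : `|stein_sol y| <= stein_cst.
Proof.
have C2 : 0 <= 2 * C by rewrite mulr_ge0.
have i0 : 0 <= (tau ^+ 2 * p 1)^-1 by rewrite invr_ge0 ltW.
have [y1|y1] := leP 1 `|y|.
  apply: le_trans (_ : 2 * C <= _); last by rewrite /stein_cst ler_peMr// lerDl.
  by apply: le_trans (mul_stein_sol_le y); rewrite [leRHS]normrM ler_peMl.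
rewrite /stein_sol normrM [in X in _ * X]gtr0_norm ?invr_gt0//.
apply: (@le_trans _ _ (2 * C * (tau ^+ 2 * p 1)^-1)).
  apply: ler_pM => //; first by rewrite invr_ge0 ltW.
    apply: le_trans (H_le y) _; rewrite -[leRHS]mulr1 ler_wpM2l//.
  rewrite lef_pV2 ?posrE// ler_pM2l ?exprn_gt0//.
  have -> : p y = p `|y|.
    by case: (leP 0 y) => y0; [rewrite ger0_norm|rewrite ltr0_norm// normal_pdf_sym].
  by apply: normal_pdf_decreasing => //; exact: ltW.
by rewrite /stein_cst ler_wpM2l// lerDr.
Qed.

Lemma stein_sol'_le y : `|stein_sol' y| <= 4 * C / tau ^+ 2.
Proof.
rewrite /stein_sol' normrM [in X in _ * X]gtr0_norm ?invr_gt0 ?exprn_gt0//.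
rewrite ler_pM2r ?invr_gt0 ?exprn_gt0//.
apply: le_trans (ler_normD _ _) _.
apply: le_trans (lerD (ler_normB _ _) (mul_stein_sol_le y)) _.
by have := hC y; have := mC; lra.
Qed.

Lemma continuous_stein_sol' : continuous stein_sol'.
Proof.
move=> y; apply: cvgM; last exact: cvg_cst.
apply: cvgD; first by apply: cvgB; [exact: ch|exact: cvg_cst].
apply: cvgM; first exact: cvg_id.
apply: differentiable_continuous; apply/derivable1_diffP.
by case: (is_derive_stein_sol y).
Qed.

End stein_equation.

(** * Concentration of empirical averages for frozen data *)

Section empirical_concentration.
Context d (T : measurableType d) (R : realType) (P : probability T R).
Variables Delta t c : R.
Hypotheses (t0 : 0 < t) (c0 : 0 < c) (cE : Delta * (c + t) = c * (c + t) + c).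
Local Notation L := (c + t).
Local Notation gs := (L^-1).
Variables (tau : R) (g g' : R -> R) (Cg Cg' : R).
Hypotheses (tau0 : 0 < tau) (dg : forall a : R, is_derive a (1 : R) g (g' a)).
Hypotheses (cg' : continuous g') (gC : forall a, `|g a| <= Cg) (gC' : forall a, `|g' a| <= Cg').

Let cg : continuous g.
Proof.
by move=> a; apply: differentiable_continuous; apply/derivable1_diffP; case: (dg a).
Qed.

Let cgs x : continuous (fun a => g (x + a)).
Proof.
move=> a; apply: (@continuous_comp _ _ _ (fun a => x + a) g); last exact: cg.
by apply: cvgD; [exact: cvg_cst|exact: cvg_id].
Qed.

Definition smoothed x := stein_mean tau (fun a => g (x + a)).

Let sol x := stein_sol tau (fun a => g (x + a)).
Let sol' x := stein_sol' tau (fun a => g (x + a)).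
Let F := stein_cst tau Cg.
Let F' := 4 * Cg / tau ^+ 2.

Let sol_le x a : `|sol x a| <= F.
Proof. by apply: stein_sol_le => // b; exact: gC. Qed.

Let sol'_le x a : `|sol' x a| <= F'.
Proof. by apply: stein_sol'_le => // b; exact: gC. Qed.

Context {M N : nat} (A : 'I_M -> 'I_N -> {RV P >-> R}).
Hypothesis gA : gaussian_matrix Delta A.
Variables (v : 'cV[R]_M) (D x : 'cV[R]_N) (k1 : R).
Hypothesis k1_energy : ridge_energy t v D <= k1 * N%:R.

Let L0 : 0 < L. Proof. by rewrite addr_gt0. Qed.
Let gs0 : 0 < gs. Proof. by rewrite invr_gt0. Qed.
Let N0 : (0 < N)%N. Proof. by case: gA. Qed.
Let Nr0 : 0 < N%:R :> R. Proof. by rewrite ltr0n. Qed.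
Let Ni0 : 0 < N%:R^-1 :> R. Proof. by rewrite invr_gt0. Qed.
Let k10 : 0 <= k1.
Proof. by rewrite -(pmulr_lge0 _ Nr0); apply: le_trans k1_energy; exact: ridge_energy_ge0. Qed.
Let Cg0 : 0 <= Cg. Proof. exact: le_trans (gC 0). Qed.
Let Cg'0 : 0 <= Cg'. Proof. exact: le_trans (gC' 0). Qed.
Let F0 : 0 <= F. Proof. exact: le_trans (sol_le 0 0). Qed.
Let F'0 : 0 <= F'. Proof. exact: le_trans (sol'_le 0 0). Qed.

Let e (B : 'M[R]_(M, N)) := ridge t B v D.
(** [mu i] is the predicted centre of the [i]-th coordinate of the estimate and [xi] the fluctuation
    around it, expected to be Gaussian with standard deviation [tau]. *)
Let mu i := x i 0 + t * gs * D i 0.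
Let xi B i := e B i 0 - t * gs * D i 0.

Definition statistic_gap B : R := N%:R^-1 * \sum_i (g (x i 0 + e B i 0) - smoothed (mu i)).
Let Y := statistic_gap.

Let psi (i : 'I_N) B := sol' (mu i) (xi B i).
Let phi (i : 'I_N) B := sol (mu i) (xi B i).

Let DY (B : 'M[R]_(M, N)) :=
  \sum_(i < N) (\col_i (N%:R^-1 * g' (x i 0 + e B i 0))) i 0 *: Dridge t v D i B.

Let shift_derive (f f' : R -> R) b : (forall a : R, is_derive a (1 : R) f (f' a)) ->
  forall a : R, is_derive a (1 : R) (fun a => f (b + a)) (f' (b + a)).
Proof.
move=> df a; have h : is_derive a (1 : R) (fun a => b + a) 1.
  by apply: is_derive_eq; rewrite ?add0r ?mulr1.
by have := is_derive1_comp (df (b + a)) h; rewrite mulr1.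
Qed.

Let shift_continuous (f : R -> R) b : continuous f -> continuous (fun a => f (b + a)).
Proof.
move=> cf a; apply: (@continuous_comp _ _ _ (fun a => b + a) f); last exact: cf.
by apply: cvgD; [exact: cvg_cst|exact: cvg_id].
Qed.

Let rY : regular1 Y DY.
Proof.
have r1 (i : 'I_N) : regular1 (fun B => g (x i 0 + e B i 0) - smoothed (mu i))
    (fun B => g' (x i 0 + e B i 0) *: Dridge t v D i B).
  have h := regular1_comp (@shift_derive _ _ (x i 0) dg) (@shift_continuous _ (x i 0) cg')
    (ex_intro _ Cg (fun a => gC _)) (ex_intro _ Cg' (fun a => gC' _)) (regular1_ridge t0 v D i).
  have := regular1D h (regular1_cst (- smoothed (mu i))).
  by congr regular1; apply/funext => B; rewrite addr0.
have := regular1Z N%:R^-1 (regular1_sum (index_enum 'I_N) r1).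
congr regular1; apply/funext => B; rewrite scaler_sumr; apply: eq_bigr => i _.
by rewrite scalerA [in RHS]mxE.
Qed.

Let rphi i : regular1 (phi i) (fun B => psi i B *: Dridge t v D i B).
Proof.
have ds (a : R) : is_derive a (1 : R) (sol (mu i)) (sol' (mu i) a).
  exact: (is_derive_stein_sol tau0 (@cgs (mu i)) (fun b => gC (mu i + b)) a).
have cs' : continuous (sol' (mu i)).
  exact: (continuous_stein_sol' tau0 (@cgs (mu i)) (fun b => gC (mu i + b))).
have h := regular1_comp (@shift_derive _ _ (- (t * gs * D i 0)) ds)
  (@shift_continuous _ (- (t * gs * D i 0)) cs')
    (ex_intro _ F (fun a => sol_le _ _)) (ex_intro _ F' (fun a => sol'_le _ _))
    (regular1_ridge t0 v D i).
by move: h; congr regular1; apply/funext => B; rewrite /phi /psi /xi addrC.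
Qed.

Let rpsi i : regular0 (psi i).
Proof.
have cs' : continuous (sol' (mu i)).
  exact: (continuous_stein_sol' tau0 (@cgs (mu i)) (fun b => gC (mu i + b))).
have := regular0_comp (@shift_continuous _ (- (t * gs * D i 0)) cs')
  (ex_intro _ F' (fun a => sol'_le _ _)) (regular0_ridge t0 v D i).
by congr regular0; apply/funext => B; rewrite /psi /xi addrC.
Qed.

Let m_le i : `|smoothed (mu i)| <= Cg.
Proof.
have bc (k : R) : bounded_mfun (fun _ : R => k) by exact: bounded_mfun_cst.
have bg : bounded_mfun (fun a : R => g (mu i + a)).
  by split; [exact: continuous_measurable_fun|exists Cg].
rewrite ler_norml -{1}(Rintegral_prob_cst (gauss tau) (- Cg)) -{2}(Rintegral_prob_cst (gauss tau) Cg).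
apply/andP; split; apply: le_Rintegral_bounded => // a; have := gC (mu i + a);
  by rewrite ler_norml => /andP[].
Qed.

Let Y_le B : `|Y B| <= 2 * Cg.
Proof.
rewrite /Y /statistic_gap normrM gtr0_norm// ler_pdivrMl//.
apply: le_trans (ler_norm_sum _ _ _) _.
apply: (@le_trans _ _ (\sum_(i < N) (2 * Cg))).
  apply: ler_sum => i _; apply: le_trans (ler_normB _ _) _.
  by have := gC (x i 0 + e B i 0); have := m_le i; lra.
by rewrite sumr_const card_ord -[_ *+ N]mulr_natl.
Qed.

Let kD := 4 / t ^+ 2 * k1 * Cg' ^+ 2.

Let DY_le B : \sum_m \sum_i DY B m i ^+ 2 <= kD.
Proof.
apply: le_trans (Dridge_sum_sqr t0 B v D _) _.
set u := \col_i _.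
have uu : dot u u <= N%:R^-1 * Cg' ^+ 2.
  have -> : N%:R^-1 * Cg' ^+ 2 = \sum_(i < N) N%:R^-1 ^+ 2 * Cg' ^+ 2.
    rewrite sumr_const card_ord -[_ *+ N]mulr_natl; field; exact: lt0r_neq0.
  apply: ler_sum => i _; rewrite mxE -expr2 exprMn ler_wpM2l ?sqr_ge0//.
  by rewrite -(real_normK (num_real (g' _))) lerXn2r// nnegrE.
have E0 := ridge_energy_ge0 t0 v D.
have h : ridge_energy t v D * dot u u <= (k1 * N%:R) * (N%:R^-1 * Cg' ^+ 2).
  by apply: ler_pM => //; exact: dot_ge0.
have c1 : 0 <= 4 / t ^+ 2 by rewrite divr_ge0// sqr_ge0.
have := ler_wpM2l c1 h; congr (_ <= _); rewrite /kD; [ring|field].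
by rewrite !lt0r_neq0.
Qed.

Let rho B : R := N%:R^-1 * dot (ridge_res t B v D) (ridge_res t B v D).
Let eta (B : 'M[R]_(M, N)) := mean_trG t B - gs.
Let b2 := L ^+ 2 * tau ^+ 2.
Let ka := (k1 / t + F ^+ 2) / 2.

Let phi_le B : \sum_i phi i B ^+ 2 <= F ^+ 2 * N%:R.
Proof.
have -> : F ^+ 2 * N%:R = \sum_(i < N) F ^+ 2 by rewrite sumr_const card_ord -[RHS]mulr_natr.
apply: ler_sum => i _.
by rewrite -(real_normK (num_real (phi i B))) lerXn2r ?nnegrE// sol_le.
Qed.

Let a_ B := N%:R^-1 * \sum_i e B i 0 * phi i B.
Let bpsi B := N%:R^-1 * \sum_i psi i B.
Let dG B := N%:R^-1 * \sum_i psi i B * (ridge_prior t B i i 0 - gs).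
Let X1 B := rho B * (N%:R^-1 * \sum_i psi i B * ridge_prior t B i i 0) -
   N%:R^-1 * (\sum_i ((t + kappa t B) * e B i 0 - t * D i 0) * phi i B).

(** By Stein's equation each summand of [Y] is [tau ^+ 2 * psi - xi * phi]. [X1] is the defect
    controlled by [mean_tested_relation]; the rest are fluctuations of the trace, of the residual
    energy around [L ^+ 2 * tau ^+ 2], and of the resolvent diagonal. *)
Let YE B : L * Y B = X1 B + (t * eta B * a_ B + gs * (b2 - rho B) * bpsi B - rho B * dG B).
Proof.
have st i : g (x i 0 + e B i 0) - smoothed (mu i) =
    tau ^+ 2 * psi i B - xi B i * phi i B.
  rewrite (stein_equation tau0 (fun a => g (mu i + a)) (xi B i)).
  congr (g _ - _); rewrite /mu /xi; ring.
rewrite /X1 (kappaE t0 c0 cE gA) -/(eta B) /Y /statistic_gap /a_ /bpsi /dG.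
rewrite !mulr_sumr -!sumrB -!big_split /= -sumrB -big_split /=.
apply: eq_bigr => i _; rewrite st /b2 /xi.
by field; rewrite !lt0r_neq0.
Qed.

Let a_le B : `|a_ B| <= ka.
Proof.
rewrite /a_ normrM (gtr0_norm Ni0) ler_pdivrMl//.
have -> : \sum_i e B i 0 * phi i B = dot (e B) (\col_i phi i B).
  by apply: eq_bigr => i _; rewrite [(\col_i0 _) i 0]mxE.
apply: le_trans (dot_le_half _ _) _; rewrite /ka mulrA ler_pM2r// mulrDr lerD//.
  apply: le_trans (ridge_le t0 _ _ _) _.
  by rewrite mulrA ler_pM2r ?invr_gt0// mulrC.
rewrite [leRHS]mulrC; apply: le_trans (phi_le B).
by rewrite le_eqVlt; apply/orP; left; apply/eqP; apply: eq_bigr => i _; rewrite !mxE expr2.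
Qed.

Let bpsi_le B : `|bpsi B| <= F'.
Proof.
rewrite /bpsi normrM (gtr0_norm Ni0) ler_pdivrMl//.
apply: le_trans (ler_norm_sum _ _ _) _.
have -> : N%:R * F' = \sum_(i < N) F' by rewrite sumr_const card_ord -[RHS]mulr_natl.
by apply: ler_sum => i _; exact: sol'_le.
Qed.

Let dG_le B : dG B ^+ 2 <= F' ^+ 2 * (N%:R^-1 * \sum_i (ridge_prior t B i i 0 - gs) ^+ 2).
Proof.
apply: le_trans (sqr_mean_le _ N0) _.
rewrite mulrCA ler_pM2l// mulr_sumr; apply: ler_sum => i _.
rewrite exprMn ler_wpM2r ?sqr_ge0//.
by rewrite -(real_normK (num_real (psi i B))) lerXn2r ?nnegrE// sol'_le.
Qed.

Let rho_le B : 0 <= rho B <= k1.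
Proof.
rewrite /rho mulr_ge0 ?dot_ge0 ?(ltW Ni0)//= ler_pdivrMl//.
by apply: le_trans (ridge_res_le t0 _ _ _) _; rewrite mulrC.
Qed.

(** [absorb_square] with the whole remainder of [YE] as [Z] and [eta = -1]; the factor [3] is the
    cost of squaring a sum of three terms. *)
Let Ysqr_le B : L / 2 * Y B ^+ 2 <= X1 B * Y B + 3 / (2 * L) *
  (t ^+ 2 * ka ^+ 2 * eta B ^+ 2 + gs ^+ 2 * F' ^+ 2 * (b2 - rho B) ^+ 2 +
   k1 ^+ 2 * F' ^+ 2 * (N%:R^-1 * \sum_i (ridge_prior t B i i 0 - gs) ^+ 2)).
Proof.
set S := N%:R^-1 * _.
pose u1 := t * eta B * a_ B; pose u2 := gs * (b2 - rho B) * bpsi B; pose u3 := rho B * dG B.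
have sq_le (p q : R) : `|p| <= q -> p ^+ 2 <= q ^+ 2.
  by move=> pq; rewrite -(real_normK (num_real p)) lerXn2r ?nnegrE// (le_trans _ pq).
have h1 : u1 ^+ 2 <= t ^+ 2 * ka ^+ 2 * eta B ^+ 2.
  have -> : u1 ^+ 2 = t ^+ 2 * a_ B ^+ 2 * eta B ^+ 2 by rewrite /u1; ring.
  rewrite ler_wpM2r ?sqr_ge0// ler_wpM2l ?sqr_ge0//.
  by apply: sq_le; exact: a_le.
have h2 : u2 ^+ 2 <= gs ^+ 2 * F' ^+ 2 * (b2 - rho B) ^+ 2.
  have -> : u2 ^+ 2 = gs ^+ 2 * bpsi B ^+ 2 * (b2 - rho B) ^+ 2 by rewrite /u2; ring.
  rewrite ler_wpM2r ?sqr_ge0// ler_wpM2l ?sqr_ge0//.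
  by apply: sq_le; exact: bpsi_le.
have h3 : u3 ^+ 2 <= k1 ^+ 2 * F' ^+ 2 * S.
  have -> : u3 ^+ 2 = rho B ^+ 2 * dG B ^+ 2 by rewrite /u3; ring.
  rewrite -[leRHS]mulrA; apply: ler_pM; [exact: sqr_ge0|exact: sqr_ge0| |exact: dG_le].
  by apply: sq_le; case/andP: (rho_le B) => r0 r1; rewrite ger0_norm.
have YE' : L * Y B = X1 B - (-1) * (u1 + u2 - u3) by rewrite YE mulN1r opprK.
have := absorb_square L0 (lexx `|u1 + u2 - u3|) YE'; rewrite real_normK ?num_real// sqrrN expr1n mulr1.
move=> /le_trans; apply; rewrite lerD2l.
have -> : 3 / (2 * L) * (t ^+ 2 * ka ^+ 2 * eta B ^+ 2 +
    gs ^+ 2 * F' ^+ 2 * (b2 - rho B) ^+ 2 + k1 ^+ 2 * F' ^+ 2 * S) =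
  (3 * (t ^+ 2 * ka ^+ 2 * eta B ^+ 2 +
    gs ^+ 2 * F' ^+ 2 * (b2 - rho B) ^+ 2 + k1 ^+ 2 * F' ^+ 2 * S)) / (2 * L) by field; rewrite lt0r_neq0.
rewrite ler_pM2r; last by rewrite invr_gt0 mulr_gt0.
have := sqr_ge0 (u1 - u2); have := sqr_ge0 (u1 + u3); have := sqr_ge0 (u2 + u3).
by nra.
Qed.

Definition statistic_cst : R := 2 / L *
  (relation_cst t k1 (2 * Cg) kD (F ^+ 2) F' + 3 / (2 * L) *
    (t ^+ 2 * ka ^+ 2 * (trace_cst t c / L) + gs ^+ 2 * F' ^+ 2 * (2 * sqr_res_cst t c k1) +
     k1 ^+ 2 * F' ^+ 2 * resolvent_cst t c)).

(** The coefficient of the term that does not decay with [N]: for frozen data the limit of the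
    residual energy need not equal [L ^+ 2 * tau ^+ 2]. The mismatch becomes small once the
    empirical moments of the data do. *)
Definition variance_mismatch_cst : R := 2 / L * (3 / (2 * L) * (gs ^+ 2 * F' ^+ 2 * 2)).

Lemma statistic_concentration :
  Ex A (fun B => statistic_gap B ^+ 2) <=
  N%:R^-1 * statistic_cst + variance_mismatch_cst * (limit_sqr_res t c v D - L ^+ 2 * tau ^+ 2) ^+ 2.
Proof.
have hres := sqr_res_concentration t0 c0 cE gA k1_energy.
move: (limit_sqr_res _ _ _ _) hres => lr hres.
have rr : regular0 (fun B => mean_sqr_res t v D B).
  by rewrite /mean_sqr_res /dot; regular.
have rY0 : regular0 Y by case: rY.
have rphi0 i : regular0 (phi i) by case: (rphi i).
have rk := @regular0_kappa R M N t t0.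
have reta : regular0 eta by apply: regular0B; [exact: regular0_mean_trG|exact: regular0_cst].
have rX1a : regular0 (fun B => rho B * (N%:R^-1 * \sum_i psi i B * ridge_prior t B i i 0) * Y B).
  by rewrite /rho /dot; regular; first [exact: rpsi|exact: rY0].
have rX1b : regular0 (fun B => N%:R^-1 *
    (\sum_i ((t + kappa t B) * e B i 0 - t * D i 0) * phi i B) * Y B).
  rewrite /e; regular; first [exact: rk|exact: rphi0|exact: rY0].
have rX1 : regular0 (fun B => X1 B * Y B).
  under eq_fun do rewrite mulrBl; exact: regular0B.
have r2 G0 : regular0 G0 -> regular0 (fun B : 'M[R]_(M, N) => G0 B ^+ 2).
  by move=> rF0; under eq_fun do rewrite expr2; exact: regular0M.
have rb (b : R) G0 : regular0 G0 -> regular0 (fun B : 'M[R]_(M, N) => b * G0 B).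
  by move=> rF0; apply: regular0M => //; exact: regular0_cst.
have rG i : regular0 (fun B : 'M[R]_(M, N) => (ridge_prior t B i i 0 - gs) ^+ 2).
  by apply: r2; regular.
have rS : regular0 (fun B : 'M[R]_(M, N) => \sum_i (ridge_prior t B i i 0 - gs) ^+ 2).
  by apply: regular0_sum => i.
have rlr : regular0 (fun B => (mean_sqr_res t v D B - lr) ^+ 2).
  by apply: r2; apply: regular0B => //; exact: regular0_cst.
have L2 : 0 < L / 2 by rewrite divr_gt0.
have L3 : 0 <= 3 / (2 * L) by apply: divr_ge0 => //; rewrite mulr_ge0// ltW.
rewrite -(ler_pM2l L2) -ExZ; last exact: r2.
pose c1 := 3 / (2 * L) * (t ^+ 2 * ka ^+ 2).
pose c2 := 3 / (2 * L) * (gs ^+ 2 * F' ^+ 2 * 2).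
pose c3 := 3 / (2 * L) * (k1 ^+ 2 * F' ^+ 2) * N%:R^-1.
apply: (@le_trans _ _ (Ex A (fun B => X1 B * Y B + c1 * eta B ^+ 2 +
    c2 * (mean_sqr_res t v D B - lr) ^+ 2 + c3 * (\sum_i (ridge_prior t B i i 0 - gs) ^+ 2) +
    c2 * (lr - b2) ^+ 2))).
  apply: le_Ex => [||B].
  - exact/rb/r2.
  - by repeat apply: regular0D => //; try exact: rb; try exact: rb (r2 _ _); exact: regular0_cst.
  apply: le_trans (Ysqr_le B) _; rewrite -!addrA lerD2l /c1 /c2 /c3 -/(rho B).
  have -> : mean_sqr_res t v D B = rho B by [].
  set S := \sum_i _; set u := eta B.
  (* The distance from [rho] to [b2] is split at [lr] into a concentrating part and a deterministic
     mismatch, whence the factor [2] in [c2]. *)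
  have h : (b2 - rho B) ^+ 2 <= 2 * (rho B - lr) ^+ 2 + 2 * (lr - b2) ^+ 2.
    by have := sqr_ge0 (rho B - lr - (lr - b2)); nra.
  have := ler_wpM2l (mulr_ge0 L3 (mulr_ge0 (sqr_ge0 gs) (sqr_ge0 F'))) h.
  move: (3 / (2 * L)) => k3; set q1 := (b2 - _) ^+ 2; set q2 := (rho B - _) ^+ 2; set q3 := (lr - _) ^+ 2.
  move=> {}h; rewrite -subr_ge0 in h; rewrite -subr_ge0.
  by apply: le_trans h _; rewrite le_eqVlt; apply/orP; left; apply/eqP; ring.
have rA : regular0 (fun B => X1 B * Y B + c1 * eta B ^+ 2).
  by apply: regular0D => //; exact/rb/r2.
have rB : regular0 (fun B => X1 B * Y B + c1 * eta B ^+ 2 +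
    c2 * (mean_sqr_res t v D B - lr) ^+ 2) by apply: regular0D => //; exact: rb.
have rC : regular0 (fun B => X1 B * Y B + c1 * eta B ^+ 2 +
    c2 * (mean_sqr_res t v D B - lr) ^+ 2 +
    c3 * (\sum_i (ridge_prior t B i i 0 - gs) ^+ 2)) by apply: regular0D => //; exact: rb.
rewrite ExD//; last exact: regular0_cst.
rewrite ExD//; last exact: rb.
rewrite ExD//; last exact: rb.
rewrite ExD//; last exact/rb/r2.
rewrite !ExZ ?Ex_cst ?Ex_sum; try solve [exact: regular0_cst|exact: r2|exact: rG|exact: rS|exact: rlr].
have -> : L / 2 * (N%:R^-1 * statistic_cst + variance_mismatch_cst * (lr - L ^+ 2 * tau ^+ 2) ^+ 2) =
  N%:R^-1 * relation_cst t k1 (2 * Cg) kD (F ^+ 2) F' + c1 * (N%:R^-1 * (trace_cst t c / L)) +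
  c2 * (N%:R^-1 * sqr_res_cst t c k1) + c3 * (\sum_(i < N) N%:R^-1 * resolvent_cst t c) +
  c2 * (lr - b2) ^+ 2.
  rewrite sumr_const card_ord -[(_ * resolvent_cst _ _) *+ N]mulr_natl /statistic_cst /variance_mismatch_cst /c1 /c2 /c3 -/b2.
  move: (relation_cst _ _ _ _ _ _) (trace_cst _ _) (sqr_res_cst _ _ _) (resolvent_cst _ _) => r1 r2' r3 r4.
  move: (ka ^+ 2) (F' ^+ 2) ((lr - b2) ^+ 2) => ka2 F2 l2.
  by field; rewrite !lt0r_neq0.
have c10 : 0 <= c1 by rewrite mulr_ge0// mulr_ge0// sqr_ge0.
have c20 : 0 <= c2 by rewrite mulr_ge0// mulr_ge0// mulr_ge0// sqr_ge0.
have c30 : 0 <= c3.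
  by apply: mulr_ge0; [rewrite mulr_ge0// mulr_ge0// sqr_ge0|exact: ltW].
rewrite lerD2r; apply: lerD; [apply: lerD; [apply: lerD|]|].
- apply: le_trans (ler_norm _) _.
  have := mean_tested_relation t0 gA k1_energy rY Y_le DY_le rphi rpsi (sqr_ge0 F) F'0 phi_le
    (fun i B => sol'_le _ _).
  rewrite distrC -ExB//; congr (`|_| <= _); apply: eq_Ex => B.
  by rewrite -mulrBl.
- by rewrite ler_wpM2l//; exact: (mean_trG_concentration t0 c0 cE gA).
- by rewrite ler_wpM2l.
- rewrite ler_wpM2l//; apply: ler_sum => i _.
  exact: (resolvent_concentration t0 c0 cE gA).
Qed.

End empirical_concentration.

(** * Convergence in probability *)

Section convergence_in_probability.
Context d (T : measurableType d) (R : realType) (P : probability T R).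
Implicit Types (U V : nat -> T -> R) (l m : R).

Let mset (f : T -> R) e : measurable_fun setT f -> measurable [set w | e < `|f w|].
Proof.
move=> mf; have := measurableT_comp (@normr_measurable R setT) mf.
move=> /(_ measurableT `]e, +oo[%classic (measurable_itv _)); rewrite setTI.
by congr measurable; apply/seteqP; split => w /=; rewrite in_itv/= andbT.
Qed.

Lemma cvg_in_probP U l : cvg_in_prob P U l <->
  forall e del, 0 < e -> 0 < del ->
    \forall k \near \oo, (P [set w | (e < `|U k w - l|)%R] <= del%:E)%E.
Proof.
split => [h e del e0 del0|h e e0].
  have /fine_cvgP[fin /cvgrPdist_le/(_ del del0)] := h e e0.
  apply: filterS2 fin => k kf /=; rewrite sub0r normrN ger0_norm ?fine_ge0//.
  by rewrite -lee_fin fineK.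
apply/fine_cvgP; split.
  by near=> k; near: k; apply: filterS (h e 1 e0 ltr01) => k hk; rewrite ge0_fin_numE// (le_lt_trans hk)// ltry.
apply/cvgrPdist_le => del del0; apply: filterS (h e del e0 del0) => k hk /=.
rewrite sub0r normrN ger0_norm ?fine_ge0// -lee_fin fineK//.
by rewrite ge0_fin_numE// (le_lt_trans hk)// ltry.
Unshelve. all: by end_near. Qed.

(** Deviations have to be controlled only on events of probability near one, and these events may
    depend on the two tolerances. *)
Lemma cvg_in_prob_good U l : (forall k, measurable_fun setT (U k)) ->
  (forall e del, 0 < e -> 0 < del -> exists G : nat -> set T,
     [/\ forall k, measurable (G k),
         \forall k \near \oo, (P (~` G k) <= del%:E)%E &
         \forall k \near \oo, (P (G k `&` [set w | (e < `|U k w - l|)%R]) <= del%:E)%E]) ->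
  cvg_in_prob P U l.
Proof.
move=> mU h; apply/cvg_in_probP => e del e0 del0.
have del2 : 0 < del / 2 by rewrite divr_gt0.
have [G [mG G1 G2]] := h e _ e0 del2.
apply: filterS2 G1 G2 => k h1 h2.
have mS : measurable [set w | (e < `|U k w - l|)%R] by apply: mset; exact: measurable_funB.
have mC : measurable (~` G k) by exact: measurableC.
have mI := measurableI _ _ (mG k) mS.
apply: (@le_trans _ _ (P (~` G k `|` (G k `&` [set w | (e < `|U k w - l|)%R])))).
  rewrite le_measure ?inE//; first exact: measurableU.
  by move=> w we; have [?|?] := pselect (G k w); [right|left].
apply: le_trans (measureU2 _ _ _) _ => //.
by rewrite [leRHS](_ : _ = (del / 2)%:E + (del / 2)%:E)%E ?leeD// -EFinD -splitr.
Qed.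

Lemma cvg_in_probD U V l m :
  (forall k, measurable_fun setT (U k)) -> (forall k, measurable_fun setT (V k)) ->
  cvg_in_prob P U l -> cvg_in_prob P V m -> cvg_in_prob P (fun k w => U k w + V k w) (l + m).
Proof.
move=> mU mV /cvg_in_probP hU /cvg_in_probP hV.
apply: cvg_in_prob_good => [k|e del e0 del0]; first exact: measurable_funD.
have e2 : 0 < e / 2 by rewrite divr_gt0.
exists (fun k => ~` [set w | (e / 2 < `|U k w - l|)%R]); split.
- by move=> k; apply/measurableC/mset; exact: measurable_funB.
- by apply: filterS (hU _ _ e2 del0) => k; rewrite setCK.
- apply: filterS (hV _ _ e2 del0) => k; apply: le_trans; rewrite le_measure ?inE//.
  + apply: measurableI; last by apply: mset; apply: measurable_funB => //; exact: measurable_funD.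
    by apply/measurableC/mset; exact: measurable_funB.
  + by apply: mset; exact: measurable_funB.
  + move=> w [/negP]; rewrite /= -leNgt => h1 h2; apply: contraTT h2; rewrite -!leNgt => h2.
    rewrite opprD addrACA (le_trans (ler_normD _ _))//.
    by rewrite [leRHS]splitr lerD.
Qed.

Lemma cvg_in_probZ a U l : (forall k, measurable_fun setT (U k)) ->
  cvg_in_prob P U l -> cvg_in_prob P (fun k w => a * U k w) (a * l).
Proof.
move=> mU /cvg_in_probP hU; apply/cvg_in_probP => e del e0 del0.
have a0 : 0 < `|a| + 1 by rewrite ltr_wpDl.
apply: filterS (hU _ _ (divr_gt0 e0 a0) del0) => k; apply: le_trans; rewrite le_measure ?inE//.
- by apply: mset; apply: measurable_funB => //; exact: measurable_funM.
- by apply: mset; exact: measurable_funB.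
move=> w /=; rewrite -mulrBr normrM => h; rewrite ltr_pdivrMr// (lt_le_trans h)//.
by rewrite mulrC ler_wpM2l// lerDl.
Qed.

Lemma cvg_in_prob_cst l : cvg_in_prob P (fun _ _ => l) l.
Proof.
move=> e e0; rewrite [X in X @ _](_ : _ = fun=> 0%E); first exact: cvg_cst.
apply/funext => k; rewrite (_ : [set _ | _] = set0) ?measure0//.
by apply/seteqP; split => // w /=; rewrite subrr normr0 ltNge (ltW e0).
Qed.

Lemma cvg_in_prob_approx U l : (forall k, measurable_fun setT (U k)) ->
  (forall e, 0 < e -> exists V m, [/\ forall k, measurable_fun setT (V k),
     \forall k \near \oo, forall w, `|U k w - V k w| <= e, `|l - m| <= e & cvg_in_prob P V m]) ->
  cvg_in_prob P U l.
Proof.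
move=> mU h; apply/cvg_in_probP => e del e0 del0.
have e4 : 0 < e / 4 by rewrite divr_gt0.
have [V [m [mV UV lm /cvg_in_probP hV]]] := h _ e4.
apply: filterS2 UV (hV _ _ e4 del0) => k UV; apply: le_trans; rewrite le_measure ?inE//.
- by apply: mset; exact: measurable_funB.
- by apply: mset; exact: measurable_funB.
move=> w /= h1; rewrite ltNge; apply/negP => h2.
have : `|U k w - l| <= e / 4 + e / 4 + e / 4.
  have -> : U k w - l = (U k w - V k w) + (V k w - m) + - (l - m) by ring.
  rewrite (le_trans (ler_normD _ _))// lerD ?normrN//.
  by rewrite (le_trans (ler_normD _ _))// lerD.
by move: h1; lra.
Qed.

Lemma markov_Rintegral (f : T -> R) e : 0 < e -> P.-integrable setT (EFin \o f) ->
  (P [set w | (e < `|f w|)%R] <= (e^-1 * \int[P]_w `|f w|)%:E)%E.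
Proof.
move=> e0 fi; have /integrableP[/measurable_EFinP mf _] := fi.
have fin : P [set w | (e < `|f w|)%R] \is a fin_num by rewrite fin_num_measure//; exact: mset.
have iA : P.-integrable setT (EFin \o (fun w => `|f w|)).
  by have := integrable_norm fi.
rewrite -(fineK fin) lee_fin ler_pdivlMl//.
have mS := mset e mf.
have -> : e * fine (P [set w | (e < `|f w|)%R]) =
    \int[P]_w (e * \1_[set w | (e < `|f w|)%R] w).
  rewrite RintegralZl//.
    by rewrite /Rintegral integral_indic// setIT.
  by apply: bounded_mfun_integrable; split; [exact: measurable_indic|exists 1 => w];
    rewrite indicE; case: (w \in _); rewrite ?normr1 ?normr0.
apply: le_Rintegral => //.
  apply: bounded_mfun_integrable; split; first by apply: measurable_funM => //; exact: measurable_indic.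
  by exists e => w; rewrite normrM gtr0_norm// indicE; case: (w \in _); rewrite ?normr1 ?normr0 ?mulr1 ?mulr0// ltW.
move=> w _; rewrite indicE; have [|] := boolP (w \in _); last by rewrite mulr0.
by rewrite inE/= mulr1 => /ltW.
Qed.

Lemma cvg_in_prob_L1 U l : (forall k, P.-integrable setT (EFin \o U k)) ->
  (forall e, 0 < e -> \forall k \near \oo, \int[P]_w `|U k w - l| <= e) ->
  cvg_in_prob P U l.
Proof.
move=> iU h; apply/cvg_in_probP => e del e0 del0.
apply: filterS (h _ (mulr_gt0 e0 del0)) => k hk.
have iUl : P.-integrable setT (EFin \o (fun w => U k w - l)).
  have := integrableB measurableT (iU k) (bounded_mfun_integrable (P := P) (@bounded_mfun_cst _ T R l)).
  by congr integrable; apply/funext => w /=; rewrite EFinB.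
apply: le_trans (markov_Rintegral e0 iUl) _.
by rewrite lee_fin ler_pdivrMl.
Qed.

End convergence_in_probability.

(** * Weak law of large numbers under a first moment *)

Section weak_law_of_large_numbers.
Context d (T : measurableType d) (R : realType) (P : probability T R).
Variable nu : probability R R.
Hypothesis inu : nu.-integrable setT (EFin \o id).
Let m := \int[nu]_y y.

Section one_row.
Context (N : nat) (N0 : (0 < N)%N) (Y : 'I_N -> {RV P >-> R}).
Hypothesis lawY : forall i, has_law P (Y i) nu.
Hypothesis indY : forall i j, i != j -> forall B C, measurable B -> measurable C ->
  P (Y i @^-1` B `&` Y j @^-1` C) = (P (Y i @^-1` B) * P (Y j @^-1` C))%E.
Variables (tr : R -> R) (K : R).
Hypotheses (mtr : measurable_fun setT tr) (trK : forall y, `|tr y| <= K).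
Let mK := \int[nu]_y tr y.
Let btr : bounded_mfun tr. Proof. by split => //; exists K. Qed.
Let Ni0 : 0 < N%:R^-1 :> R. Proof. by rewrite invr_gt0 ltr0n. Qed.

Let Z i w := tr (Y i w) - mK.

Let K0 : 0 <= K. Proof. exact: le_trans (trK 0). Qed.

Let mK_le : `|mK| <= K.
Proof.
have bc (k : R) : bounded_mfun (fun _ : R => k) by exact: bounded_mfun_cst.
rewrite ler_norml -{1}(Rintegral_prob_cst nu (- K)) -{2}(Rintegral_prob_cst nu K).
by apply/andP; split; apply: le_Rintegral_bounded => // a; have := trK a;
  rewrite ler_norml => /andP[].
Qed.

Let Z_le i w : `|Z i w| <= 2 * K.
Proof. by apply: le_trans (ler_normB _ _) _; rewrite mulr_natl mulr2n lerD. Qed.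

Let mZ i : measurable_fun setT (Z i).
Proof. by apply: measurable_funB => //; apply: measurableT_comp => //; exact: measurable_funPT. Qed.

Let bZ i : bounded_mfun (Z i).
Proof. by split => //; exists (2 * K) => w. Qed.

Let Z_mean : \int[nu]_y (tr y - mK) = 0.
Proof.
rewrite RintegralB//; last 2 first.
- exact: bounded_mfun_integrable.
- by apply: bounded_mfun_integrable; exact: bounded_mfun_cst.
by rewrite Rintegral_prob_cst subrr.
Qed.

Let ZZ i j : i != j -> \int[P]_w (Z i w * Z j w) = 0.
Proof.
move=> ij.
rewrite (integral_independent (indY ij) (f := fun p => (tr p.1 - mK) * (tr p.2 - mK))).
- transitivity (\int[distribution P (Y i)]_u (0 : R)); last exact: Rintegral_prob_cst.
  apply: eq_Rintegral => u _; rewrite (eq_Rintegral_law (lawY j)) /=.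
  rewrite RintegralZl ?Z_mean ?mulr0//.
  by apply: bounded_mfun_integrable; apply: bounded_mfunB => //; exact: bounded_mfun_cst.
- by apply: measurable_funM; apply: measurable_funB => //; exact: measurableT_comp.
- by apply: bounded_mfun_integrable; exact: (bounded_mfunM (bZ i) (bZ j)).
Qed.

Let mean_Z_sqr : \int[P]_w (N%:R^-1 * \sum_i Z i w) ^+ 2 <= N%:R^-1 * (2 * K) ^+ 2.
Proof.
have bZZ i j := bounded_mfunM (bZ i) (bZ j).
have E w : (N%:R^-1 * \sum_i Z i w) ^+ 2 = N%:R^-1 ^+ 2 * (\sum_i \sum_j Z i w * Z j w).
  rewrite exprMn; congr (_ * _); rewrite expr2 mulr_suml.
  by apply: eq_bigr => i _; rewrite mulr_sumr.
under eq_Rintegral do rewrite E.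
have bs i : bounded_mfun (fun w => \sum_j Z i w * Z j w) by exact: bounded_mfun_sum.
rewrite RintegralZl//; last by apply: bounded_mfun_integrable; exact: bounded_mfun_sum.
rewrite expr2 -mulrA ler_pM2l// Rintegral_sum; last by move=> i; exact: bounded_mfun_integrable.
rewrite mulrC ler_pdivrMr ?ltr0n//.
have -> : (2 * K) ^+ 2 * N%:R = \sum_(i < N) (2 * K) ^+ 2.
  by rewrite sumr_const card_ord -[RHS]mulr_natr.
apply: ler_sum => i _.
rewrite Rintegral_sum; last by move=> j; exact: bounded_mfun_integrable.
rewrite (bigD1 i)//= big1 ?addr0; last by move=> j ji; rewrite ZZ// eq_sym.
rewrite -(Rintegral_prob_cst P ((2 * K) ^+ 2)).
apply: le_Rintegral_bounded => // [|w]; first exact: bounded_mfun_cst.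
rewrite -expr2 -(real_normK (num_real (Z i w))) lerXn2r ?nnegrE//.
exact: le_trans (Z_le i w).
Qed.

Let iY i : P.-integrable setT (EFin \o Y i).
Proof. exact: (integrable_law (lawY i) inu). Qed.

Let idiff : nu.-integrable setT (EFin \o (fun y => `|y - tr y|)).
Proof.
have := integrable_norm (integrableB measurableT inu (bounded_mfun_integrable (P := nu) btr)).
by congr integrable.
Qed.

Lemma empirical_mean_integrable :
  P.-integrable setT (EFin \o (fun w => N%:R^-1 * \sum_i Y i w)).
Proof.
have h : P.-integrable setT (fun w => \sum_(i < N) (Y i w)%:E)%E.
  by apply: integrable_sum => // i _; exact: iY.
have := integrableZl measurableT N%:R^-1 h.
by congr integrable; apply/funext => w /=; rewrite EFinM sumEFin.
Qed.

(** Truncation: the centred truncated average has second moment of order [1 / N] by pairwise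
    independence, and the remainder counts twice, once for the variables and once for the shift of
    the mean. The weight [s] enters through [|u| <= (s u^2 + 1/s) / 2], which passes from second to
    first moments. *)
Lemma empirical_mean_L1_le s : 0 < s ->
  \int[P]_w `|N%:R^-1 * \sum_i Y i w - m| <=
  (s * (N%:R^-1 * (2 * K) ^+ 2) + s^-1) / 2 + 2 * \int[nu]_y `|y - tr y|.
Proof.
move=> s0.
have bmZ : bounded_mfun (fun w => (N%:R^-1 * \sum_i Z i w) ^+ 2).
  apply: bounded_mfunX; apply: bounded_mfunM; last exact: bounded_mfun_sum.
  exact: bounded_mfun_cst.
have iN i : P.-integrable setT (EFin \o (fun w => `|Y i w - tr (Y i w)|)).
  exact: (integrable_law (lawY i) idiff).
have iS : P.-integrable setT (EFin \o (fun w => N%:R^-1 * \sum_i `|Y i w - tr (Y i w)|)).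
  have h : P.-integrable setT (fun w => \sum_(i < N) (`|Y i w - tr (Y i w)|)%:E)%E.
    by apply: integrable_sum => // i _; exact: iN.
  have := integrableZl measurableT N%:R^-1 h.
  by congr integrable; apply/funext => w /=; rewrite EFinM sumEFin.
have mKm : `|mK - m| <= \int[nu]_y `|y - tr y|.
  rewrite distrC /m /mK -RintegralB//; last exact: bounded_mfun_integrable.
  apply: le_normr_Rintegral => //.
  have := integrableB measurableT inu (bounded_mfun_integrable (P := nu) btr).
  by congr integrable.
have bc (k : R) : bounded_mfun (fun _ : T => k) by exact: bounded_mfun_cst.
pose G w := (s * (N%:R^-1 * \sum_i Z i w) ^+ 2 + s^-1) / 2 + `|mK - m|.
have bG : bounded_mfun G.
  by apply: bounded_mfunD => //; apply: bounded_mfunM => //; apply: bounded_mfunD => //;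
    apply: bounded_mfunM.
have sn u : `|u| <= (s * u ^+ 2 + s^-1) / 2.
  rewrite -(real_normK (num_real u)); move: (normr_ge0 u); move: `|u| => a a0.
  have := sqr_ge0 (s * a - 1); rewrite -(pmulr_lge0 _ s0).
  have := mulfV (lt0r_neq0 s0); move: s^-1 => i i1 h.
  rewrite -(ler_pM2l s0); nra.
have imY : P.-integrable setT (EFin \o (fun w => N%:R^-1 * \sum_i Y i w - m)).
  have := integrableB measurableT empirical_mean_integrable (bounded_mfun_integrable (P := P) (bc m)).
  by congr integrable; apply/funext => w /=; rewrite EFinB.
apply: (@le_trans _ _ (\int[P]_w (G w + N%:R^-1 * \sum_i `|Y i w - tr (Y i w)|))).
  apply: le_Rintegral => //.
  - exact: (integrable_norm imY).
  - have := integrableD measurableT (bounded_mfun_integrable (P := P) bG) iS.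
    by congr integrable.
  - move=> w _; rewrite /G.
    have -> : N%:R^-1 * \sum_i Y i w - m = N%:R^-1 * (\sum_i Z i w) + (mK - m) +
        N%:R^-1 * \sum_i (Y i w - tr (Y i w)).
      have -> : \sum_i Z i w = \sum_i tr (Y i w) - N%:R * mK.
        by rewrite sumrB sumr_const card_ord mulr_natl.
      by rewrite sumrB; field; rewrite pnatr_eq0 -lt0n.
    apply: le_trans (ler_normD _ _) _; apply: lerD.
      by apply: le_trans (ler_normD _ _) _; rewrite lerD2r.
    by rewrite normrM gtr0_norm// ler_pM2l// ler_norm_sum.
rewrite RintegralD//; last exact: bounded_mfun_integrable.
have -> : \int[P]_w (N%:R^-1 * \sum_i `|Y i w - tr (Y i w)|) = \int[nu]_y `|y - tr y|.
  rewrite RintegralZl//; last first.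
    have h : P.-integrable setT (fun w => \sum_(i < N) (`|Y i w - tr (Y i w)|)%:E)%E.
      by apply: integrable_sum => // i _; exact: iN.
    by move: h; congr integrable; apply/funext => w /=; rewrite sumEFin.
  rewrite Rintegral_sum//.
  under eq_bigr do rewrite (Rintegral_law (lawY _) idiff).
  rewrite sumr_const card_ord; set I := \int[nu]_y _.
  by rewrite -[I *+ N]mulr_natl mulKf// pnatr_eq0 -lt0n.
set I := \int[nu]_y _ in mKm *.
rewrite (_ : 2 * I = I + I) ?addrA ?lerD2r; last by rewrite mulr_natl mulr2n.
rewrite RintegralD//; last 2 first.
- by apply: bounded_mfun_integrable; apply: bounded_mfunM => //; apply: bounded_mfunD => //;
    exact: bounded_mfunM.
- exact: bounded_mfun_integrable.
rewrite Rintegral_prob_cst; apply: lerD => //.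
have bsq := bounded_mfunM (bc s) bmZ.
rewrite RintegralZr//; last by apply: bounded_mfun_integrable; exact: bounded_mfunD.
rewrite ler_pM2r// RintegralD//; last 2 first.
- exact: bounded_mfun_integrable.
- exact: bounded_mfun_integrable.
rewrite Rintegral_prob_cst lerD2r RintegralZl//; last exact: bounded_mfun_integrable.
by rewrite ler_pM2l.
Qed.

End one_row.

Lemma truncation_L1_small del : 0 < del -> exists (tr : R -> R) (K : R),
  [/\ measurable_fun setT tr, forall y, `|tr y| <= K & \int[nu]_y `|y - tr y| <= del].
Proof.
move=> del0.
pose B n : set R := `[- n%:R, n%:R]%classic.
pose tr n (y : R) := y * \1_(B n) y.
have mtr n : measurable_fun setT (tr n).
  by apply: measurable_funM => //; apply: measurable_indic; exact: measurable_itv.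
have trn n y : `|tr n y| <= n%:R.
  rewrite /tr indicE; have [|] := boolP (y \in B n); last by rewrite mulr0 normr0.
  by rewrite inE /B/= in_itv/= mulr1 ler_norml.
have tri n y : `|y - tr n y| <= `|y|.
  by rewrite /tr indicE; case: (y \in _); rewrite ?mulr1 ?mulr0 ?subrr ?subr0 ?normr0.
have cv := @dominated_cvg _ R R nu setT measurableT
  (fun n y => (`|y - tr n y|)%:E) (cst 0%E) (fun y => `|y|%:E).
have /fine_cvgP[_ /cvgrPdist_le/(_ _ del0) h] :
    (\int[nu]_y (`|y - tr n y|)%:E)%E @[n --> \oo] --> 0%E.
  rewrite -[X in _ --> X](integral0 nu setT); apply: cv => //.
  - by move=> n; apply/measurable_EFinP; apply: measurableT_comp => //; exact: measurable_funB.
  - move=> y _; apply: cvg_near_cst; near=> n.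
    have yn : `|y| <= n%:R by near: n; exact: nbhs_infty_ger.
    rewrite /tr indicE mem_set ?mulr1 ?subrr ?normr0// /B/= in_itv/=.
    by move: yn; rewrite ler_norml.
  - exact: (integrable_norm inu).
  - by move=> n y _ /=; rewrite lee_fin normr_id.
have [n _ /(_ n (leqnn n))/=] := h; rewrite sub0r normrN => hn.
exists (tr n), n%:R; split => //.
exact: le_trans (ler_norm _) hn.
Unshelve. all: by end_near. Qed.

(** A first moment has to suffice, since [(z - x) ^+ 2] is only known to be integrable. *)
Lemma weak_law (n : nat -> nat) (Y : forall k, 'I_(n k) -> {RV P >-> R}) :
  n @ \oo --> \oo -> (forall k, (0 < n k)%N) ->
  (forall k i, has_law P (Y k i) nu) ->
  (forall k i j, i != j -> forall B C, measurable B -> measurable C ->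
    P (Y k i @^-1` B `&` Y k j @^-1` C) = (P (Y k i @^-1` B) * P (Y k j @^-1` C))%E) ->
  cvg_in_prob P (fun k w => (n k)%:R^-1 * \sum_i Y k i w) (\int[nu]_y y).
Proof.
move=> noo n0 lawY indY; apply: cvg_in_prob_L1 => [k|e e0].
  exact: (empirical_mean_integrable (lawY k)).
have e8 : 0 < e / 8 by rewrite divr_gt0.
have [tr [K [mtr trK trd]]] := truncation_L1_small e8.
have s0 : 0 < 2 / e by rewrite divr_gt0.
(* The threshold for [n k] that makes the variance term at most [e / 2]; with [s = 2 / e] and
   truncation error [e / 8] the total is [3 e / 4]. *)
pose C := 2 / e * (2 * K) ^+ 2 * (2 / e).
near=> k.
apply: le_trans (empirical_mean_L1_le (n0 k) (lawY k) (@indY k) mtr trK s0) _.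
have Ck : C <= (n k)%:R.
  by near: k; exact: (noo _ (nbhs_infty_ger C)).
have nk : 0 < (n k)%:R :> R by rewrite ltr0n.
have : 2 / e * ((n k)%:R^-1 * (2 * K) ^+ 2) <= e / 2.
  have -> : 2 / e * ((n k)%:R^-1 * (2 * K) ^+ 2) = C * (e / 2) / (n k)%:R.
    by rewrite /C; field; rewrite !lt0r_neq0.
  by rewrite ler_pdivrMr// mulrC ler_pM2l// divr_gt0.
have -> : (2 / e)^-1 = e / 2 by rewrite invf_div.
lra.
Unshelve. all: by end_near. Qed.

End weak_law_of_large_numbers.

(** * Chebyshev's inequality with the data frozen *)

Section conditioning_on_independent_data.
Context d (T : measurableType d) (R : realType) (P : probability T R).
Context {M N : nat} (A : 'I_M -> 'I_N -> {RV P >-> R}) (I : Type) (S : I -> T -> R).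
Hypothesis mS : forall i, measurable_fun setT (S i).
Hypothesis indAS : independent_sigma P
  (sigma_rvs (fun mn : 'I_M * 'I_N => A mn.1 mn.2 : T -> R)) (sigma_rvs S).

Let GA : set (set T) := \bigcup_(mn : 'I_M * 'I_N) sigma_rv (A mn.1 mn.2 : T -> R).
Let GS : set (set T) := \bigcup_i sigma_rv (S i).

Let sigma_rv_measurable (f : T -> R) : measurable_fun setT f -> sigma_rv f `<=` measurable.
Proof. by move=> mf _ [B mB <-]; exact: mf. Qed.

Let GAm : GA `<=` measurable.
Proof. by move=> B [mn _]; apply: sigma_rv_measurable; exact: measurable_funPT. Qed.

Let GSm : GS `<=` measurable.
Proof. by move=> B [i _]; exact: sigma_rv_measurable. Qed.

Let U := sub_mfun GAm.
Let V := sub_mfun GSm.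

Let mAU m n : measurable_fun setT (A m n : g_sigma_algebraType GA -> R).
Proof.
by move=> _ B mB; apply: sub_sigma_algebra; exists (m, n) => //; exists B.
Qed.

Lemma measurable_data i : measurable_fun setT (S i : g_sigma_algebraType GS -> R).
Proof. by move=> _ B mB; apply: sub_sigma_algebra; exists i => //; exists B. Qed.

(* F reads its second argument only through the data S. *)
Lemma conditional_chebyshev (F : 'M[R]_(M, N) -> T -> R) (G : set T) (c e : R) :
  (forall d' (W : measurableType d') (B : W -> 'M[R]_(M, N)) (s : W -> T),
     measurable_mx B -> (forall i, measurable_fun setT (fun w => S i (s w))) ->
     measurable_fun setT (fun w => F (B w) (s w))) ->
  measurable (G : set (g_sigma_algebraType GS)) -> 0 < e ->
  (forall w, G w -> regular0 (fun B => F B w)) ->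
  (forall w, G w -> Ex A (fun B => F B w ^+ 2) <= c) -> 0 <= c ->
  (P (G `&` [set w | (e < `|F (random_mx A w) w|)%R]) <= (c / e ^+ 2)%:E)%E.
Proof.
move=> mF mG e0 rF Fc c0.
(* The square of [F], cut off to the data event [G], on the product of the two generated
   sigma-algebras, where independence makes the joint law a product. *)
pose f (p : g_sigma_algebraType GA * g_sigma_algebraType GS) : R :=
  \1_G p.2 * F (random_mx A p.1) p.2 ^+ 2.
have mf : measurable_fun setT f.
  apply: measurable_funM.
    by apply: (measurableT_comp (f := \1_G : g_sigma_algebraType GS -> R));
      [exact: measurable_indic|exact: measurable_snd].
  apply: measurable_funX; apply: mF => [m n|i].
    under eq_fun do rewrite mxE.
    exact: (measurableT_comp (mAU m n) measurable_fst).
  exact: (measurableT_comp (measurable_data i) measurable_snd).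
have f0 p : 0 <= f p by rewrite mulr_ge0 ?sqr_ge0// indicE ler0n.
have fc v : (\int[P]_w (f (U w, v))%:E <= c%:E)%E.
  have [vG|vG] := pselect (G v); last first.
    rewrite (eq_integral (cst 0%E)) ?integral0 ?lee_fin// => w _.
    by rewrite /f indicE memNset// mul0r.
  have rF2 : regular0 (fun B => F B v ^+ 2).
    by under eq_fun do rewrite expr2; apply: regular0M; exact: rF.
  have fin := integrable_fin_num measurableT
    (bounded_mfun_integrable (P := P) (bounded_regular0 A rF2)).
  have E : (\int[P]_w (f (U w, v))%:E = \int[P]_w (F (random_mx A w) v ^+ 2)%:E)%E.
    by apply: eq_integral => w _; rewrite /f indicE mem_set// mul1r.
  rewrite E; have h := Fc v vG; move: h; rewrite /Ex /Rintegral -lee_fin fineK//.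
have indUV B C : measurable B -> measurable C ->
    P (U @^-1` B `&` V @^-1` C) = (P (U @^-1` B) * P (V @^-1` C))%E.
  by move=> mB mC; exact: indAS.
have fP := ge0_integral_independent_le indUV mf f0 fc.
have mh : measurable_fun setT (fun w => f (U w, V w)).
  by apply: measurableT_comp mf _; exact/measurable_fun_pair.
have ih : P.-integrable setT (EFin \o (fun w => f (U w, V w))).
  apply/integrableP; split; first exact/measurable_EFinP.
  rewrite (eq_integral (fun w => (f (U w, V w))%:E)); last first.
    by move=> w _ /=; rewrite ger0_norm.
  by apply: le_lt_trans fP _; rewrite ltry.
have e2 : 0 < e ^+ 2 by rewrite exprn_gt0.
have mFw : measurable_fun setT (fun w => F (random_mx A w) w).
  by apply: mF => //; exact: measurable_random_mx.
apply: (@le_trans _ _ (P [set w | (e ^+ 2 < `|f (U w, V w)|)%R])).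
  rewrite le_measure ?inE//.
  - apply: measurableI; first exact: (smallest_sub (@sigma_algebra_measurable _ T) GSm).
    have := measurableT_comp (@normr_measurable R setT) mFw.
    move=> /(_ measurableT `]e, +oo[%classic (measurable_itv _)); rewrite setTI.
    by congr measurable; apply/seteqP; split => w /=; rewrite in_itv/= andbT.
  - have := measurableT_comp (@normr_measurable R setT) mh.
    move=> /(_ measurableT `]e ^+ 2, +oo[%classic (measurable_itv _)); rewrite setTI.
    by congr measurable; apply/seteqP; split => w /=; rewrite in_itv/= andbT.
  - move=> w [Gw]/= eF; rewrite ger0_norm// /f /= indicE mem_set// mul1r.
    rewrite -(real_normK (num_real (F _ _))) ltrXn2r// ?nnegrE//; exact: ltW.
apply: le_trans (markov_Rintegral e2 ih) _.
rewrite lee_fin mulrC ler_pM2r ?invr_gt0//.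
under eq_Rintegral do rewrite ger0_norm//.
by rewrite -lee_fin /Rintegral fineK// integrable_fin_num.
Qed.

End conditioning_on_independent_data.

(** * The scalar min-max problem as an explicit saddle point *)

(** The equation is [c^2 - b c - Delta t = 0], whose roots have negative product; the witness is the
    positive one. *)
Lemma fixed_point_exists {R : realType} (Delta t : R) : 0 < Delta -> 0 < t ->
  exists2 c, 0 < c & Delta * (c + t) = c * (c + t) + c.
Proof.
move=> D0 t0; pose b := Delta - t - 1.
have Dt : 0 < Delta * t by rewrite mulr_gt0.
have disc0 : 0 <= b ^+ 2 + 4 * (Delta * t) by rewrite addr_ge0 ?sqr_ge0// mulr_ge0// ltW.
pose q := Num.sqrt (b ^+ 2 + 4 * (Delta * t)).
have qq : q ^+ 2 = b ^+ 2 + 4 * (Delta * t) by rewrite sqr_sqrtr.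
have q0 : 0 <= q by exact: sqrtr_ge0.
exists ((b + q) / 2).
  rewrite divr_gt0// -subr_gt0 subr0 ltNge; apply/negP => bq.
  have : q ^+ 2 <= b ^+ 2 by nra.
  by rewrite qq; lra.
have hb : b = Delta - t - 1 by [].
by clearbody b q; nra.
Qed.

Lemma stationary_point_exists {R : realType} (s t sigma c D2 : R) :
  0 < s -> 0 < t -> 0 < sigma -> 0 < c -> s ^+ 2 * (c + t) = c * (c + t) + c -> 0 <= D2 ->
  exists a0 b0, [/\ 0 < a0, 0 < b0, b0 * s = c * a0 &
    a0 ^+ 2 - sigma ^+ 2 = (b0 ^+ 2 + t ^+ 2 * D2) / (c + t) ^+ 2].
Proof.
move=> s0 t0 sigma0 c0 cE D20.
have L0 : 0 < c + t by rewrite addr_gt0.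
(* Eliminating [b0] by [b0 * s = c * a0] and [cE] leaves [r * a0 ^+ 2 = sigma ^+ 2 + t ^+ 2 * D2 /
   (c + t) ^+ 2]. *)
pose r := 1 - c / ((c + t) * (c + t + 1)).
have L10 : 0 < (c + t) * (c + t + 1) by rewrite mulr_gt0// addr_gt0.
have r0 : 0 < r.
  rewrite subr_gt0 ltr_pdivrMr// mul1r.
  have -> : (c + t) * (c + t + 1) = c + ((c + t) * (c + t) + t) by ring.
  by rewrite ltrDl addr_gt0// mulr_gt0.
pose A := (sigma ^+ 2 + t ^+ 2 * D2 / (c + t) ^+ 2) / r.
have A0 : 0 < A.
  apply: divr_gt0 => //; apply: ltr_wpDr; last by rewrite exprn_gt0.
  by apply: divr_ge0; [apply: mulr_ge0 => //|]; exact: sqr_ge0.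
pose a0 := Num.sqrt A; pose b0 := c * a0 / s.
have a00 : 0 < a0 by rewrite sqrtr_gt0.
have b00 : 0 < b0 by rewrite divr_gt0// mulr_gt0.
have b0s : b0 * s = c * a0 by rewrite /b0 divfK// lt0r_neq0.
have aA : a0 ^+ 2 = A by rewrite sqr_sqrtr// ltW.
have bA : b0 ^+ 2 = c * (c + t) / (c + t + 1) * A.
  rewrite /b0 expr_div_n exprMn aA.
  have -> : s ^+ 2 = (c * (c + t) + c) / (c + t) by rewrite -cE mulfK// lt0r_neq0.
  have L2 : 0 < c * (c + t) + c by rewrite addr_gt0// mulr_gt0.
  by field; rewrite !lt0r_neq0//= ?addr_gt0.
have stat : a0 ^+ 2 - sigma ^+ 2 = (b0 ^+ 2 + t ^+ 2 * D2) / (c + t) ^+ 2.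
  rewrite bA aA.
  have -> : (c * (c + t) / (c + t + 1) * A + t ^+ 2 * D2) / (c + t) ^+ 2 =
      (1 - r) * A + t ^+ 2 * D2 / (c + t) ^+ 2.
    rewrite /r; field; rewrite !lt0r_neq0// ?addr_gt0//.
  have -> : t ^+ 2 * D2 / (c + t) ^+ 2 = r * A - sigma ^+ 2.
    by rewrite /A mulrCA mulfV ?lt0r_neq0// mulr1; ring.
  ring.
by exists a0, b0.
Qed.

Section scalar_saddle_point.
Context {R : realType}.
Variables (s t sigma c D2 a0 b0 : R).
Hypotheses (s0 : 0 < s) (t0 : 0 < t) (c0 : 0 < c).
Hypothesis cE : s ^+ 2 * (c + t) = c * (c + t) + c.
Hypothesis D20 : 0 <= D2.
Hypotheses (a00 : 0 < a0) (b00 : 0 < b0).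
Local Notation L := (c + t).
Hypothesis b0s : b0 * s = c * a0.
Hypothesis stationary : a0 ^+ 2 - sigma ^+ 2 = (b0 ^+ 2 + t ^+ 2 * D2) / L ^+ 2.

(** The objective after integrating out [X], [H] and [Z], with [s] for [sqrt Delta], [t] for
    [1 / gamma] and [D2] for the second moment of [Z - X]; the last fraction is [E J], see
    [objectiveE]. *)
Definition scalar_objective (a b : R) : R :=
  a * b * s / 2 + b * sigma ^+ 2 * s / (2 * a) - 2^-1 * b ^+ 2 +
  (t * (b * s / a) * D2 - b ^+ 2) / (2 * (b * s / a + t)).

Let L0 : 0 < L. Proof. exact: addr_gt0. Qed.

(** The reciprocal lies above its tangents; this is all the convexity used below. *)
Let inv_tangent (y y0 : R) : 0 < y -> 0 < y0 -> 0 <= y^-1 - y0^-1 + (y - y0) / y0 ^+ 2.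
Proof.
move=> yp y0p; have -> : y^-1 - y0^-1 + (y - y0) / y0 ^+ 2 = (y - y0) ^+ 2 / (y * y0 ^+ 2).
  by field; rewrite !lt0r_neq0.
by apply: divr_ge0; [exact: sqr_ge0|rewrite mulr_ge0 ?sqr_ge0// ltW].
Qed.

(** In [b] the objective is affine minus [b ^+ 2 / 2] minus a positive multiple of [1 / (k b + t)],
    hence concave, and the equations for [(a0, b0)] say that its derivative vanishes at [b0]. *)
Lemma scalar_objective_max b : 0 <= b -> scalar_objective a0 b <= scalar_objective a0 b0.
Proof.
move=> bge0; pose k := s / a0.
have k0 : 0 < k by rewrite divr_gt0.
have kb0 : k * b0 = c by rewrite /k -[RHS](mulfK (lt0r_neq0 a00)) -b0s; ring.
pose K := t ^+ 2 * (D2 + (k ^+ 2)^-1) / 2.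
have K0 : 0 <= K.
  by apply: divr_ge0 => //; apply: mulr_ge0; [exact: sqr_ge0|rewrite addr_ge0// invr_ge0 sqr_ge0].
pose C1 := a0 * s / 2 + sigma ^+ 2 * s / (2 * a0) - (2 * k)^-1.
pose C0 := t * D2 / 2 + t / (2 * k ^+ 2).
have FE b1 : 0 <= b1 -> scalar_objective a0 b1 = C1 * b1 + C0 - b1 ^+ 2 / 2 - K / (k * b1 + t).
  move=> b10; have y0 : 0 < k * b1 + t by rewrite ltr_wpDl// mulr_ge0// ltW.
  have y0' : s / a0 * b1 + t != 0 by rewrite lt0r_neq0.
  have y0'' : b1 * s + t * a0 != 0.
    by rewrite lt0r_neq0// ltr_wpDl ?mulr_ge0 ?mulr_gt0// ltW.
  have y1 : 0 < s * b1 + t * a0 by rewrite ltr_wpDl ?mulr_ge0 ?mulr_gt0// ltW.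
  by rewrite /scalar_objective /C1 /C0 /K /k; field; rewrite !lt0r_neq0//.
have stat : C1 - b0 + K * k / L ^+ 2 = 0.
  have E : 2 * a0 / s * (C1 - b0 + K * k / L ^+ 2) =
      a0 ^+ 2 + sigma ^+ 2 - a0 ^+ 2 / s ^+ 2 - 2 * (b0 * s) * a0 / s ^+ 2 +
      (t ^+ 2 * D2 + t ^+ 2 * a0 ^+ 2 / s ^+ 2) / L ^+ 2.
    by rewrite /C1 /K /k; field; rewrite !lt0r_neq0.
  have nz : 2 * a0 / s != 0 by rewrite !mulf_neq0// ?invr_eq0// lt0r_neq0.
  apply: (mulfI nz); rewrite E mulr0 b0s.
  have h1 : t ^+ 2 * D2 / L ^+ 2 = a0 ^+ 2 - sigma ^+ 2 - c ^+ 2 * a0 ^+ 2 / s ^+ 2 / L ^+ 2.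
    rewrite stationary -[c ^+ 2 * _]exprMn -b0s.
    by field; rewrite !lt0r_neq0.
  have -> : (t ^+ 2 * D2 + t ^+ 2 * a0 ^+ 2 / s ^+ 2) / L ^+ 2 =
    t ^+ 2 * D2 / L ^+ 2 + t ^+ 2 * a0 ^+ 2 / s ^+ 2 / L ^+ 2 by field; rewrite !lt0r_neq0.
  rewrite h1.
  have s2 : s ^+ 2 = (c * L + c) / L by rewrite -cE; field; rewrite lt0r_neq0.
  have nz1 : c * L + c != 0 by rewrite lt0r_neq0// addr_gt0// mulr_gt0.
  by rewrite s2; field; rewrite nz1 lt0r_neq0.
rewrite !FE ?(ltW b00)// kb0 -subr_ge0.
have y0 : 0 < k * b + t by rewrite ltr_wpDl// mulr_ge0// ltW.
have h := mulr_ge0 K0 (inv_tangent y0 L0).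
have -> : C1 = b0 - K * k / L ^+ 2 by apply/eqP; rewrite -subr_eq0 -stat; apply/eqP; ring.
have E : K * ((k * b + t)^-1 - L^-1 + (k * b + t - L) / L ^+ 2) + (b - b0) ^+ 2 / 2 =
  (b0 - K * k / L ^+ 2) * b0 + C0 - b0 ^+ 2 / 2 - K / (c + t) -
  ((b0 - K * k / L ^+ 2) * b + C0 - b ^+ 2 / 2 - K / (k * b + t)).
  have -> : k * b + t - L = k * (b - b0) by rewrite -kb0; ring.
  by field; rewrite !lt0r_neq0.
by rewrite -E addr_ge0// divr_ge0// sqr_ge0.
Qed.

(** In [a] the objective is affine plus nonnegative multiples of two reciprocals, hence convex, and
    it is stationary at [a0]. *)
Lemma scalar_objective_min a : 0 < a -> scalar_objective a0 b0 <= scalar_objective a b0.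
Proof.
move=> ap.
pose K := (t * b0 * s * D2 + b0 ^+ 3 * s / t) / 2.
have K0 : 0 <= K.
  apply: divr_ge0 => //; apply: addr_ge0; first by rewrite !mulr_ge0// ltW.
  by apply: divr_ge0; rewrite ?mulr_ge0 ?exprn_ge0// ltW.
have FE a1 : 0 < a1 -> scalar_objective a1 b0 =
    (b0 * s / 2) * a1 + (b0 * sigma ^+ 2 * s / 2) / a1 + K / (b0 * s + t * a1) -
    (b0 ^+ 2 / 2 + b0 ^+ 2 / (2 * t)).
  move=> a10; have y0 : 0 < b0 * s + t * a1 by rewrite addr_gt0// mulr_gt0.
  have y1 : b0 * s + t * a1 != 0 by rewrite lt0r_neq0.
  by rewrite /scalar_objective /K; field; rewrite !lt0r_neq0.
rewrite !FE// -subr_ge0.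
have w0 : b0 * s + t * a0 = a0 * L by rewrite b0s; ring.
have w0p : 0 < b0 * s + t * a0 by rewrite w0 mulr_gt0.
have wp : 0 < b0 * s + t * a by rewrite addr_gt0// mulr_gt0.
have c2 : 0 <= b0 * sigma ^+ 2 * s / 2.
  by apply: divr_ge0 => //; apply: mulr_ge0; [apply: mulr_ge0; [exact: ltW|exact: sqr_ge0]|exact: ltW].
have h1 := mulr_ge0 c2 (inv_tangent ap a00).
have h2 := mulr_ge0 K0 (inv_tangent wp w0p).
have stat : b0 * s / 2 = (b0 * sigma ^+ 2 * s / 2) / a0 ^+ 2 + K * t / (b0 * s + t * a0) ^+ 2.
  rewrite w0 /K.
  have nz : b0 * s / (2 * a0 ^+ 2) != 0.
    by rewrite !mulf_neq0 ?invr_eq0 ?mulf_neq0 ?expf_neq0// lt0r_neq0.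
  have -> : b0 * s / 2 = b0 * s / (2 * a0 ^+ 2) * a0 ^+ 2 by field; rewrite !lt0r_neq0.
  have -> : a0 ^+ 2 = sigma ^+ 2 + (a0 ^+ 2 - sigma ^+ 2) by rewrite addrC subrK.
  rewrite {2}stationary.
  by field; rewrite !lt0r_neq0// (_ : _ + _ = a0 ^+ 2) ?exprn_gt0//; ring.
have := addr_ge0 h1 h2; congr (_ <= _).
move: stat; set S1 := b0 * sigma ^+ 2 * s / 2 => stat; rewrite [b0 * s / 2]stat.
clear FE h1 h2 c2 K0 stat; clearbody S1 K.
by field; rewrite !lt0r_neq0.
Qed.

End scalar_saddle_point.

(** * The optimizer of the scalar problem *)

Section scalar_problem_optimizer.
Context {R : realType} (Delta gamma sigmav : R).
Hypotheses (hDelta : 0 < Delta) (hsigmav : 0 < sigmav) (hgamma : 0 < gamma).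
Context {dQ} {TQ : measurableType dQ} (Q : probability TQ R).
Variables (X H Z : {RV Q >-> R}).
Hypothesis hH : has_law Q H (normal_prob 0 1).
Hypothesis hHXZ : independent_sigma Q (sigma_rv H) (sigma_rv (fun w => (X w, Z w))).
Local Notation s := (Num.sqrt Delta).
Local Notation t := (gamma^-1).

Let D w := Z w - X w.
Let s0 : 0 < s. Proof. by rewrite sqrtr_gt0. Qed.
Let t0 : 0 < t. Proof. by rewrite invr_gt0. Qed.

Let mD : measurable_fun setT D. Proof. exact: measurable_funB. Qed.
Let mXZ : measurable_fun setT (fun w => (X w, Z w)).
Proof. exact: measurable_fun_pair. Qed.
Let XZ : {mfun TQ >-> (R * R)%type} := HB.pack (fun w => (X w, Z w))
  (isMeasurableFun.Build _ _ _ _ (fun w => (X w, Z w)) mXZ).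

Let indXZH B C : measurable B -> measurable C ->
  Q (XZ @^-1` B `&` H @^-1` C) = (Q (XZ @^-1` B) * Q (H @^-1` C))%E.
Proof.
move=> mB mC; rewrite setIC muleC; apply: hHXZ; first by exists C => //; rewrite setTI.
by exists B => //; rewrite setTI.
Qed.

Let lawH : has_law Q H (gauss 1). Proof. exact: hH. Qed.

Lemma Shat_sub_signal a b x h z : 0 < a -> 0 <= b ->
  Shat Delta gamma a b x h z - x = (b * h + t * (z - x)) / (b * s / a + t).
Proof.
move=> a0 b0.
have p0 : 0 < b * s * gamma + a.
  by apply: ltr_wpDl => //; apply: mulr_ge0; [apply: mulr_ge0|]; rewrite // ltW.
have p0' : 0 < b * gamma * s + a by rewrite mulrAC.
by rewrite /Shat; field; rewrite !lt0r_neq0.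
Qed.

Let JE a b x h z : 0 < a -> 0 <= b ->
  Jfun Delta gamma a b x h z =
  (t * (b * s / a) * (z - x) ^+ 2 - b ^+ 2 * h ^+ 2 - 2 * b * t * h * (z - x)) /
    (2 * (b * s / a + t)).
Proof.
move=> a0 b0; rewrite /Jfun /=.
have -> : Shat Delta gamma a b x h z - z =
    (Shat Delta gamma a b x h z - x) - (z - x) by ring.
rewrite Shat_sub_signal//.
have p0 : 0 < b * s * gamma + a.
  by apply: ltr_wpDl => //; apply: mulr_ge0; [apply: mulr_ge0|]; rewrite // ltW.
have p0' : 0 < b * gamma * s + a by rewrite mulrAC.
by field; rewrite !lt0r_neq0.
Qed.

Let iH2 : Q.-integrable setT (EFin \o (fun w => H w ^+ 2)).
Proof. exact: (integrable_law lawH (gauss_second_moment ltr01).1). Qed.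

Let EH2 : \int[Q]_w H w ^+ 2 = 1.
Proof.
have [i e] := @gauss_second_moment R 1 ltr01.
by rewrite (Rintegral_law lawH i) e expr1n.
Qed.

Let JZ a b : 0 < a -> 0 <= b -> measurable_fun setT (fun w => Jfun Delta gamma a b (X w) (H w) (Z w)).
Proof.
move=> a0 b0; under eq_fun do rewrite JE//.
apply: measurable_funM => //; apply: measurable_funB.
  apply: measurable_funB; apply: measurable_funM => //; exact: measurable_funX.
by apply: measurable_funM => //; apply: measurable_funM.
Qed.

Section integrable_gap.
Hypothesis iD2 : Q.-integrable setT (EFin \o (fun w => D w ^+ 2)).
Let D2 := \int[Q]_w D w ^+ 2.

Let iHD : Q.-integrable setT (EFin \o (fun w => H w * D w)).
Proof.
apply: (@le_integrable _ _ _ Q setT measurableT _ (fun w => (H w ^+ 2)%:E + (D w ^+ 2)%:E)%E).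
- by apply/measurable_EFinP; exact: measurable_funM.
- move=> w _ /=; rewrite lee_fin normrM [leRHS]ger0_norm ?addr_ge0 ?sqr_ge0//.
  rewrite -(real_normK (num_real (H w))) -(real_normK (num_real (D w))).
  have := mulr_ge0 (normr_ge0 (H w)) (normr_ge0 (D w)).
  by have := sqr_ge0 (`|H w| - `|D w|); nra.
- exact: integrableD.
Qed.

Let EHD : \int[Q]_w (H w * D w) = 0.
Proof.
have [i1 e1] := @gauss_mean R 1 ltr01.
rewrite (integral_independent indXZH (f := fun p => p.2 * (p.1.2 - p.1.1))).
- transitivity (\int[distribution Q XZ]_u (0 : R)); last exact: Rintegral_prob_cst.
  apply: eq_Rintegral => u _; rewrite (eq_Rintegral_law lawH) /=.
  by rewrite RintegralZr// e1 mul0r.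
- apply: measurable_funM => //; apply: measurable_funB.
    by apply: (measurableT_comp measurable_snd); exact: measurable_fst.
  by apply: (measurableT_comp measurable_fst); exact: measurable_fst.
- exact: iHD.
Qed.

Lemma objectiveE a b : 0 < a -> 0 <= b ->
  objective Delta gamma sigmav X H Z a b = (scalar_objective s t sigmav D2 a b)%:E.
Proof.
move=> a0 b0; rewrite /objective /scalar_objective [in RHS]EFinD; congr (_ + _)%E.
pose q := (2 * (b * s / a + t))^-1.
pose c1 := t * (b * s / a) * q; pose c2 := - (b ^+ 2 * q); pose c3 := - (2 * b * t * q).
rewrite unlock.
have i1 := integrableZl measurableT c1 iD2.
have i2 := integrableZl measurableT c2 iH2.
have i3 := integrableZl measurableT c3 iHD.
have i12 := integrableD measurableT i1 i2.
have i123 := integrableD measurableT i12 i3.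
have E : (fun w => (Jfun Delta gamma a b (X w) (H w) (Z w))%:E) =
   EFin \o (fun w => c1 * D w ^+ 2 + c2 * H w ^+ 2 + c3 * (H w * D w)).
  by apply/funext => w /=; rewrite JE// /c1 /c2 /c3 -/q; congr EFin; rewrite /D; ring.
rewrite -[LHS]fineK; last by rewrite E; apply: integrable_fin_num.
congr EFin; transitivity (\int[Q]_w (c1 * D w ^+ 2 + c2 * H w ^+ 2 + c3 * (H w * D w))).
  by rewrite /Rintegral E.
rewrite RintegralD// RintegralD// !RintegralZl// EHD EH2 -/D2 /c1 /c2 -/q.
ring.
Qed.

End integrable_gap.

(** [J] grows like a positive multiple of [(Z - X) ^ 2] up to a multiple of [H ^ 2], which is
    integrable. *)
Lemma objective_infinite a b : ~ Q.-integrable setT (EFin \o (fun w => D w ^+ 2)) ->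
  0 < a -> 0 < b -> objective Delta gamma sigmav X H Z a b = +oo%E.
Proof.
move=> nD a0 b0; rewrite /objective unlock.
pose J w := Jfun Delta gamma a b (X w) (H w) (Z w).
pose p := b * s / a.
have p0 : 0 < p by rewrite divr_gt0// mulr_gt0.
(* [k] and the constant [C] below are chosen so that [J + C * H ^+ 2 - k * D ^+ 2] is a nonnegative
   multiple of [(p * D - 2 * b * H) ^+ 2]. *)
pose k := t * p / (4 * (p + t)).
have pt0 : 0 < p + t by rewrite addr_gt0.
have k0 : 0 < k by apply: divr_gt0; apply: mulr_gt0.
pose C := (b ^+ 2 + 2 * b ^+ 2 * t / p) / (2 * (p + t)).
have C0 : 0 <= C.
  apply: divr_ge0; last by rewrite mulr_ge0// ltW.
  apply: addr_ge0; first exact: sqr_ge0.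
  by apply: divr_ge0; [apply: mulr_ge0; [rewrite mulr_ge0// sqr_ge0|exact: ltW]|exact: ltW].
have mJ : measurable_fun setT J by apply: JZ => //; exact: ltW.
have JD w : k * D w ^+ 2 <= J w + C * H w ^+ 2.
  rewrite /J JE ?(ltW b0)// -/p -/(D w) -subr_ge0.
  have -> : (t * p * D w ^+ 2 - b ^+ 2 * H w ^+ 2 - 2 * b * t * H w * D w) / (2 * (p + t)) +
      C * H w ^+ 2 - k * D w ^+ 2 = t * (p * D w - 2 * b * H w) ^+ 2 / (4 * p * (p + t)).
    have pg : 0 < p * gamma + 1 by rewrite addr_gt0// mulr_gt0.
    by rewrite /k /C; clearbody p; field; rewrite !lt0r_neq0.
  apply: divr_ge0; first by rewrite mulr_ge0 ?sqr_ge0// ltW.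
  by apply: mulr_ge0; [apply: mulr_ge0|]; rewrite // ltW.
have mD2 : measurable_fun setT (fun w => D w ^+ 2) by exact: measurable_funX.
have mH2 : measurable_fun setT (fun w => H w ^+ 2) by exact: measurable_funX.
have iD2 : (\int[Q]_w (k * D w ^+ 2)%:E = +oo)%E.
  rewrite (eq_integral (fun w => k%:E * (D w ^+ 2)%:E)%E)//.
  rewrite ge0_integralZl_EFin//; last 3 first.
  - by move=> w _; rewrite lee_fin sqr_ge0.
  - exact/measurable_EFinP.
  - exact: ltW.
  rewrite (_ : \int[Q]_w _ = +oo)%E ?gt0_muley ?lte_fin//.
  apply/eqP; rewrite -leye_eq leNgt; apply/negP => lt; apply: nD.
  apply/integrableP; split; first exact/measurable_EFinP.
  rewrite (eq_integral (fun w => (D w ^+ 2)%:E))// => w _ /=.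
  by rewrite ger0_norm// sqr_ge0.
have CH w : (0 <= (C * H w ^+ 2)%:E)%E by rewrite lee_fin mulr_ge0// sqr_ge0.
have mCH : measurable_fun setT (EFin \o (fun w => C * H w ^+ 2)).
  by apply/measurable_EFinP; exact: measurable_funM.
have iCH : (\int[Q]_w (C * H w ^+ 2)%:E < +oo)%E.
  have /integrableP[_] := integrableZl measurableT C iH2.
  by apply: le_lt_trans; apply: ge0_le_integral => //; [exact: measurableT_comp|move=> w _ /=; rewrite lee_fin ler_norm].
have mJE : measurable_fun setT (fun w => (J w)%:E) by exact/measurable_EFinP.
have neg : (\int[Q]_w ((fun w => (J w)%:E)^\- w) < +oo)%E.
  apply: le_lt_trans iCH; apply: ge0_le_integral => //.
  - exact: measurable_funeneg.
  - move=> w _; rewrite funenegE ge_max CH andbT -EFinN lee_fin.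
    have := JD w; have := mulr_ge0 (ltW k0) (sqr_ge0 (D w)); lra.
have pos : (\int[Q]_w ((fun w => (J w)%:E)^\+ w) = +oo)%E.
  apply/eqP; rewrite -leye_eq -(@leeD2rE _ (\int[Q]_w (C * H w ^+ 2)%:E)%E); last first.
    by rewrite ge0_fin_numE// integral_ge0.
  rewrite -ge0_integralD//; last exact: measurable_funepos.
  apply: (@le_trans _ _ (\int[Q]_w (k * D w ^+ 2)%:E)%E); first by rewrite iD2 leey.
  apply: ge0_le_integral => //.
  - by move=> w _; rewrite lee_fin mulr_ge0 ?sqr_ge0// ltW.
  - by apply/measurable_EFinP; exact: measurable_funM.
  - by apply: emeasurable_funD => //; exact: measurable_funepos.
  - move=> w _; apply: (@le_trans _ _ ((J w)%:E + (C * H w ^+ 2)%:E)%E).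
      by rewrite -EFinD lee_fin.
    by rewrite leeD2r// funeposE le_max lexx.
rewrite [X in (_ + X)%E]integralE pos addye ?addey//.
have : (- \int[Q]_w ((fun w => (J w)%:E)^\- w))%E \is a fin_num.
  rewrite fin_numN ge0_fin_numE//; apply: integral_ge0 => w _; exact: funeneg_ge0.
by rewrite fin_numE => /andP[].
Qed.

Variables alpha beta : R.
Hypothesis hopt : unique_minimax_optimizer (objective Delta gamma sigmav X H Z) alpha beta.

Lemma optimizer_square_integrable : Q.-integrable setT (EFin \o (fun w => D w ^+ 2)).
Proof.
apply: contrapT => nD.
(* With an infinite second moment every point [(a, 1)] attains the value [+oo] and is an optimizer;
   the points [a = 1] and [a = 2] contradict uniqueness. *)
have opt a : 0 < a -> minimax_optimizer (objective Delta gamma sigmav X H Z) a 1.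
  move=> a0; split => // [b _|a' a'0]; first by rewrite (objective_infinite nD a0 ltr01) leey.
  apply: (@le_trans _ _ (objective Delta gamma sigmav X H Z a' 1)).
    by rewrite !objective_infinite.
  by apply: ereal_sup_ubound; exists 1 => //=.
have [_ h] := hopt.
have [a1 _] := h _ _ (opt 1 ltr01); have [a2 _] := h _ _ (opt 2 (ltr0n R 2)).
have : (1 : R) = 2 := etrans a1 (esym a2).
by lra.
Qed.

(** The point given by [stationary_point_exists] is a saddle point, hence a minimax optimizer, and
    uniqueness identifies it with [(alpha, beta)]. *)
Lemma optimizer_equations (c : R) (D2 := \int[Q]_w D w ^+ 2) : 0 < c ->
  Delta * (c + t) = c * (c + t) + c ->
  [/\ 0 < alpha, 0 < beta, beta * s = c * alpha &
      alpha ^+ 2 - sigmav ^+ 2 = (beta ^+ 2 + t ^+ 2 * D2) / (c + t) ^+ 2].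
Proof.
move=> c0 cE.
have iD2 := optimizer_square_integrable.
have D20 : 0 <= D2 by apply: Rintegral_ge0 => w _; exact: sqr_ge0.
have ss : s ^+ 2 = Delta by rewrite sqr_sqrtr// ltW.
have cE' : s ^+ 2 * (c + t) = c * (c + t) + c by rewrite ss.
have [a0 [b0 [a00 b00 b0s stat]]] := stationary_point_exists s0 t0 hsigmav c0 cE' D20.
have opt : minimax_optimizer (objective Delta gamma sigmav X H Z) a0 b0.
  split => // [|b' b'0|a' a'0]; first exact: ltW.
    rewrite !objectiveE ?(ltW b00)// lee_fin.
    exact: (scalar_objective_max s0 t0 c0 cE' D20 a00 b00 b0s stat b'0).
  apply: (@le_trans _ _ (objective Delta gamma sigmav X H Z a' b0)).
    rewrite !objectiveE ?(ltW b00)// lee_fin.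
    exact: (scalar_objective_min s0 t0 c0 D20 a00 b00 b0s stat a'0).
  by apply: ereal_sup_ubound; exists b0 => //=; exact: ltW.
by have [_ h] := hopt; have [<- <-] := h _ _ opt.
Qed.

End scalar_problem_optimizer.

(** * The proximity operator of the squared loss *)

Section proximity_operator.
Context {R : realType} {m n : nat} (gamma : R).
Hypothesis hgamma : 0 < gamma.
Variables (A : 'M[R]_(m, n)) (y : 'cV[R]_m) (z : 'cV[R]_n).
Local Notation t := (gamma^-1).
Let s := ridge t A y z.

Let t0 : 0 < t. Proof. by rewrite invr_gt0. Qed.

Let loss u : R := 2^-1 * sqnorm2 (y - A *m u) + (2 * gamma)^-1 * sqnorm2 (u - z).

(** The exact second-order expansion at [s], whose linear term vanishes by [ridge_kkt]. It yields
    both minimality and uniqueness. *)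
Let lossE u : loss u - loss s =
  2^-1 * dot (A *m (u - s)) (A *m (u - s)) + (2 * gamma)^-1 * dot (u - s) (u - s).
Proof.
rewrite /loss !sqnorm2_dot; set e := u - s.
have -> : y - A *m u = ridge_res t A y z - A *m e.
  by rewrite /e mulmxBr /ridge_res opprB addrA addrNK.
have -> : u - z = (s - z) + e by rewrite [RHS]addrC /e addrA subrK.
have kkt : dot (ridge_res t A y z) (A *m e) = t * dot (s - z) e.
  by rewrite dotC dot_adjoint (ridge_kkt t0) dotZr dotC.
have -> : y - A *m s = ridge_res t A y z by [].
clearbody e.
move: (ridge_res t A y z) kkt => r; move: (A *m e) (s - z) => f q.
rewrite dotBl !dotBr !dotDl !dotDr (dotC f r) (dotC e q) => ->.
by field; rewrite lt0r_neq0.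
Qed.

Let loss_min u : loss s <= loss u.
Proof.
rewrite -subr_ge0 lossE; apply: addr_ge0; apply: mulr_ge0; rewrite ?dot_ge0//.
by rewrite invr_ge0 mulr_ge0// ltW.
Qed.

Let loss_eq u : loss u <= loss s -> u = s.
Proof.
rewrite -subr_le0 lossE => h; apply/eqP; rewrite -subr_eq0; apply/eqP/dot_eq0.
apply/eqP; rewrite eq_le dot_ge0 andbT.
have c0 : 0 < (2 * gamma)^-1 by rewrite invr_gt0 mulr_gt0.
rewrite -(pmulr_rle0 _ c0); apply: le_trans h; rewrite lerDr mulr_ge0 ?dot_ge0//.
Qed.

Lemma argmin_sqloss : argmin (fun u => (2^-1 * sqnorm2 (y - A *m u)
  + (2 * gamma)^-1 * sqnorm2 (u - z))%:E) = [set s].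
Proof.
apply/seteqP; split => [u /(_ s)|_ -> u]; first by rewrite lee_fin; exact: loss_eq.
by rewrite lee_fin; exact: loss_min.
Qed.

Lemma prox_set_sqloss : prox_set (fun u => (gamma * sqloss A y u)%:E) z = [set s].
Proof.
rewrite -argmin_sqloss /prox_set /argmin; apply/funext => u; apply/propext.
have E u' : (gamma * sqloss A y u')%:E + (2^-1 * sqnorm2 (u' - z))%:E = (gamma * loss u')%:E :> \bar R.
  by rewrite -EFinD /sqloss /loss; congr EFin; field; rewrite lt0r_neq0.
by split => h u'; have := h u'; rewrite !E !lee_fin ler_pM2l.
Qed.

Lemma prox_sqlossE : prox_sqloss gamma A y z = s.
Proof.
rewrite /prox_sqloss /prox; apply: xget_unique; first by rewrite prox_set_sqloss.
by move=> u; rewrite prox_set_sqloss.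
Qed.

(** Subtracting the signal leaves a ridge problem with the noise as observation and [z - x] as
    prior, the form studied above. *)
Lemma ridge_sub_signal x v : ridge t A (A *m x + v) z - x = ridge t A v (z - x).
Proof.
apply: (ridge_unique t0); rewrite mulmxBr gram_ridge// /gram mulmxDl mul_scalar_mx mulmxDr -mulmxA.
by rewrite scalerBr -[X in X - _]addrA opprD addrACA subrr add0r addrA.
Qed.

End proximity_operator.

(** * Smooth approximation of compactly supported functions *)

Section smooth_approximation.
Context {R : realType}.
Notation mu := (@lebesgue_measure R).
Variable g : R -> R.
Hypothesis cg : continuous g.
Hypothesis supp_g : compact (closure [set a | g a != 0]).

Let support_bounded : exists K, forall a, K < `|a| -> g a = 0.
Proof.
have [K [_ /(_ (K + 1))]] := compact_bounded supp_g.
rewrite ltrDl => /(_ ltr01) h; exists (K + 1) => a Ka.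
apply/eqP/negPn/negP => ga; move: Ka; rewrite ltNge h//.
exact: subset_closure.
Qed.

Lemma compact_support_bounded : exists C, forall a, `|g a| <= C.
Proof.
have [K h] := support_bounded.
have cK : compact (g @` `[- K, K]).
  by apply: continuous_compact; [exact: continuous_subspaceT|exact: segment_compact].
have [C [_ /(_ (C + 1))]] := compact_bounded cK.
rewrite ltrDl => /(_ ltr01) hC; exists (Num.max 0 (C + 1)) => a.
have [aK|aK] := leP `|a| K; last by rewrite h// normr0 le_max lexx.
rewrite le_max; apply/orP; right; apply: hC; exists a => //=.
by rewrite in_itv/= -ler_norml.
Qed.

Lemma compact_support_uniform e : 0 < e ->
  exists2 del, 0 < del & forall a b, `|a - b| <= del -> `|g a - g b| <= e.
Proof.
move=> e0; have [K h] := support_bounded.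
(* With a margin [1] around the support and [del < 1], both values vanish as soon as [|a| > K + 1],
   so compactness is needed on this interval only. *)
have cK : compact (`[- (K + 1), K + 1] : set R) by exact: segment_compact.
have e2 : 0 < e / 2 by rewrite divr_gt0.
pose Pr (del a : R) := forall b, `|a - b| <= del -> `|g a - g b| <= e.
have near_Pr a : `[- (K + 1), K + 1]%classic a ->
    \forall a' \near a & del \near (0 : R)^'+, Pr del a'.
  move=> _; have /cvgrPdist_le/(_ _ e2)/nbhs_ballP[r /= r0 hr] := @cg a.
  have r2 : 0 < r / 2 by rewrite divr_gt0.
  exists (ball a (r / 2), [set del | del < r / 2]) => /=.
    by split; [exact: nbhsx_ballx|exact: nbhs_right_lt].
  move=> [a' del] /= [aa' dr] b a'b.
  have -> : g a' - g b = (g a - g b) - (g a - g a') by ring.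
  apply: le_trans (ler_normB _ _) _; rewrite [leRHS]splitr lerD//.
    apply: hr; rewrite /ball/=; have -> : a - b = (a - a') + (a' - b) by ring.
    apply: le_lt_trans (ler_normD _ _) _; rewrite [ltRHS]splitr; apply: ltrD => //.
    exact: le_lt_trans dr.
  by apply: hr; apply: lt_trans aa' _; rewrite ltr_pdivrMr// ltr_pMr// ltr1n.
have := (compact_near_coveringP _).1 cK _ _ _ _ near_Pr => hnear.
near (0 : R)^'+ => del.
exists del; first by near: del; exact: nbhs_right_gt.
have d1 : del < 1 by near: del; exact: nbhs_right_lt.
have hd : `[- (K + 1), K + 1]%classic `<=` Pr del by near: del; exact: hnear.
move=> a b ab; have [aK|aK] := leP `|a| (K + 1).
  by apply: hd => //=; rewrite in_itv/= -ler_norml.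
rewrite !h ?subr0 ?normr0 ?ltW//; last by lra.
have := ler_dist_dist a b; rewrite ler_norml => /andP[_]; lra.
Unshelve. all: by end_near. Qed.

(* h is the average of g over [a, a + del]. *)
Lemma smooth_approximation C e : (forall a, `|g a| <= C) -> 0 < e ->
  exists h h' C', [/\ forall a, is_derive a (1 : R) h (h' a), continuous h',
    forall a, `|h a| <= C, forall a, `|h' a| <= C' & forall a, `|h a - g a| <= e].
Proof.
move=> gC e0; have [del d0 hdel] := compact_support_uniform e0.
have [K hK] := support_bounded.
have iK : mu.-integrable setT (EFin \o g).
  have mI : measurable ([set` `[- K, K]] : set (measurableTypeR R)) by exact: measurable_itv.
  have h : mu.-integrable [set` `[- K, K]] (EFin \o g).
    apply: continuous_compact_integrable; first exact: segment_compact.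
    exact: continuous_subspaceT.
  have := (integrable_mkcond _ mI).1 h; congr integrable; apply/funext => a.
  rewrite patchE /=; case: ifPn => // aK; rewrite hK//.
  by move: aK; rewrite notin_setE/= in_itv/= -ler_norml => /negP; rewrite -ltNge.
pose G x := \int[mu]_(u in `]-oo, x]) g u.
have dG (x : R) : is_derive x (1 : R) G (g x).
  have xx : x < x + 1 by rewrite ltrDl.
  have iK' : mu.-integrable [set` `]-oo, (x + 1)]] (EFin \o g).
    exact: integrableS iK.
  have [|||d1 d2] := @continuous_FTC1 R g -oo%O x (x + 1) xx.
  - exact: iK'.
  - exact: ltNyr.
  - exact: cg.
  by split => //; rewrite -derive1E.
have cG : continuous G.
  by move=> x; apply: differentiable_continuous; apply/derivable1_diffP; case: (dG x).
have dGs (x : R) : is_derive x (1 : R) (fun x => G (x + del)) (g (x + del)).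
  have hd : is_derive x (1 : R) (fun x => del + x) 1.
    by apply: is_derive_eq; rewrite ?add0r ?mulr1.
  have := is_derive1_comp (dG (del + x)) hd; rewrite mulr1 addrC.
  by congr is_derive; apply/funext => u /=; rewrite addrC.
(* The average is a value of [g] at a point within [del], so it inherits the bound [C] and is
   uniformly close to [g]. *)
have mean x : exists2 c, `|x - c| <= del & (G (x + del) - G x) / del = g c.
  have xd : x < x + del by rewrite ltrDl.
  have [|c cx E] := MVT xd (fun u _ => dG u).
    exact: continuous_subspaceT.
  exists c; last by rewrite E addrAC subrr add0r mulfK// lt0r_neq0.
  by move: cx; rewrite in_itv/= => /andP[c1 c2]; rewrite distrC ger0_norm; lra.
exists (fun x => (G (x + del) - G x) / del), (fun x => (g (x + del) - g x) / del), (2 * C / del).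
split => [a|||a|a].
- have dB := is_deriveB (dGs a) (dG a).
  have := is_deriveZ del^-1 dB; rewrite /GRing.scale/=.
  rewrite [_ * (_ - _)]mulrC; congr is_derive.
  by apply/funext => u /=; rewrite mulrC.
- move=> a; apply: cvgM; last exact: cvg_cst.
  apply: cvgB; last exact: cg.
  apply: (@continuous_comp _ _ _ (fun a => a + del) g); last exact: cg.
  by apply: cvgD; [exact: cvg_id|exact: cvg_cst].
- by move=> a; have [c _ ->] := mean a.
- rewrite normrM normfV (gtr0_norm d0) ler_pM2r ?invr_gt0//.
  by apply: le_trans (ler_normB _ _) _; rewrite mulr_natl mulr2n lerD.
- by have [c ac ->] := mean a; rewrite distrC; exact: hdel.
Qed.

End smooth_approximation.

(** * Empirical integrals and Gaussian smoothing *)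

Section empirical_integral.
Context {R : realType} (n : nat) (s : 'cV[R]_n).

(** The default [0] is never reached for [i < n]. Written through Dirac masses, the empirical
    measure admits the integration lemmas for sums of measures. *)
Let atom (i : nat) : R := if insub i is Some j then s j 0 else 0.

Let emp : {measure set R -> \bar R} :=
  mscale (n%:R^-1)%:nng (msum (fun i => @dirac _ R (atom i) R) n).

Let ge0_integral_empirical (f : R -> \bar R) : measurable_fun setT f -> (forall x, 0 <= f x)%E ->
  (\int[empirical_measure s]_x f x = n%:R^-1%:E * \sum_(i < n) f (s i 0%R))%E.
Proof.
move=> mf f0; rewrite (eq_measure_integral emp); last first.
  move=> B mB _; rewrite /empirical_measure /emp /= /mscale /msum /=.
  by congr (_ * _)%E; apply: eq_bigr => i _; rewrite /atom valK.
rewrite ge0_integral_mscale// ge0_integral_measure_sum//; congr (_ * _)%E.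
apply: eq_bigr => i _; rewrite integral_dirac// diracT mul1e.
by rewrite /atom valK.
Qed.

Lemma Rintegral_empirical (g : R -> R) : measurable_fun setT g ->
  \int[empirical_measure s]_x g x = n%:R^-1 * \sum_(i < n) g (s i 0).
Proof.
move=> mg; have mgE : measurable_fun setT (EFin \o g) by exact/measurable_EFinP.
rewrite /Rintegral integralE ge0_integral_empirical; last 2 first.
- exact: measurable_funepos.
- by move=> x; exact: funepos_ge0.
rewrite ge0_integral_empirical; last 2 first.
- exact: measurable_funeneg.
- by move=> x; exact: funeneg_ge0.
under eq_bigr do rewrite funeposE -EFin_max.
under [X in (_ - _ * X)%E]eq_bigr do rewrite funenegE -EFinN -EFin_max.
rewrite !sumEFin -!EFinM -EFinB /= -mulrBr; congr (_ * _).
rewrite -sumrB; apply: eq_bigr => i _ /=.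
have [h|h] := leP (g (s i 0)) 0; first by rewrite max_l ?oppr_ge0// sub0r opprK.
by rewrite max_r ?oppr_le0 ?ltW// subr0.
Qed.

End empirical_integral.

(** Change of scale through Stein's equation: [h (tau * a)] minus its claimed mean is
    [f a - a * F a], with [F] the rescaled Stein solution, and this integrates to zero by
    [gauss_by_parts]. *)
Lemma Rintegral_gauss_scale {R : realType} (tau : R) (h : R -> R) (C : R) :
  0 < tau -> continuous h -> (forall a, `|h a| <= C) ->
  \int[gauss 1]_a h (tau * a) = \int[gauss tau]_a h a.
Proof.
move=> tau0 ch hC.
pose F (a : R) := tau * stein_sol tau h (tau * a).
pose f (a : R) := tau ^+ 2 * stein_sol' tau h (tau * a).
have dF (a : R) : is_derive a (1 : R) F (f a).
  have dl : is_derive a (1 : R) (fun a => tau * a) tau.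
    by apply: is_derive_eq; rewrite /GRing.scale/= ?mulr0 ?add0r ?addr0 mulr1.
  have := is_deriveZ tau (is_derive1_comp (is_derive_stein_sol tau0 ch hC (tau * a)) dl).
  by congr is_derive; rewrite /f /GRing.scale/=; ring.
have cl : continuous (fun a => tau * a) by move=> a; apply: cvgM; [exact: cvg_cst|exact: cvg_id].
have cf : continuous f.
  move=> a; apply: cvgM; first exact: cvg_cst.
  apply: (@continuous_comp _ _ _ (fun a => tau * a) (stein_sol' tau h)); first exact: cl.
  exact: (continuous_stein_sol' tau0 ch hC).
pose k1 := tau * stein_cst tau C; pose k2 := tau ^+ 2 * (4 * C / tau ^+ 2).
have Fk a : `|F a| <= Num.max k1 k2.
  by rewrite le_max normrM (gtr0_norm tau0) ler_pM2l// (stein_sol_le tau0 ch hC).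
have fk a : `|f a| <= Num.max k1 k2.
  by rewrite le_max normrM ger0_norm ?sqr_ge0// ler_wpM2l ?sqr_ge0 ?orbT// (stein_sol'_le tau0 ch hC).
have k0 : 0 <= Num.max k1 k2 by apply: le_trans (Fk 0).
have [|i e] := gauss_by_parts ltr01 dF cf _ fk.
  by move=> a; apply: le_trans (Fk a) _; rewrite ler_peMr// lerDl.
have bh : bounded_mfun (fun a => h (tau * a)).
  split; last by exists C => a; exact: hC.
  by apply: continuous_measurable_fun => a; apply: continuous_comp; [exact: cl|exact: ch].
have bf : bounded_mfun f by split; [exact: continuous_measurable_fun|exists (Num.max k1 k2)].
rewrite expr1n mul1r in e.
have E a : h (tau * a) = stein_mean tau h + (f a - a * F a).
  have := stein_equation tau0 h (tau * a); rewrite /f /F => h1.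
  by rewrite -[LHS](subrK (stein_mean tau h)) -h1; ring.
have i1 : (gauss (1 : R)).-integrable setT (EFin \o (fun=> stein_mean tau h)).
  by apply: bounded_mfun_integrable; exact: bounded_mfun_cst.
have i2 : (gauss (1 : R)).-integrable setT (EFin \o f) by exact: bounded_mfun_integrable.
have i3 : (gauss (1 : R)).-integrable setT (EFin \o (fun a => f a - a * F a)).
  by have := integrableB measurableT i2 i; congr integrable.
transitivity (\int[gauss 1]_a (stein_mean tau h + (f a - a * F a))).
  by apply: eq_Rintegral => a _; exact: E.
rewrite -[RHS]/(stein_mean tau h); clear E bf bh.
move: (stein_mean tau h) f F i i1 i2 i3 e {dF cf Fk fk} => m f F.
move: (gauss 1) => nu i i1 i2 i3 e.
rewrite (RintegralD measurableT i1 i3) (RintegralB measurableT i2 i).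
by rewrite e subrr addr0 Rintegral_prob_cst.
Qed.

Lemma continuous_smoothed {R : realType} (tau : R) (g g' : R -> R) (C C' : R) :
  (forall a : R, is_derive a (1 : R) g (g' a)) -> (forall a, `|g a| <= C) ->
  (forall a, `|g' a| <= C') -> continuous (smoothed tau g).
Proof.
move=> dg gC gC'.
have cg : continuous g.
  by move=> x; apply: differentiable_continuous; apply/derivable1_diffP; case: (dg x).
have lip a b : a <= b -> `|g a - g b| <= C' * `|a - b|.
  move=> ab; have [|c _ E] := MVT_segment ab (fun u _ => dg u).
    exact: continuous_subspaceT.
  by rewrite distrC E normrM distrC ler_wpM2r// distrC.
have lip' a b : `|g a - g b| <= C' * `|a - b|.
  have [/lip//|/ltW/lip] := leP a b; by rewrite distrC [`|b - a|]distrC.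
have bg (x : R) : bounded_mfun (fun a : R => g (x + a)).
  split; last by exists C.
  apply: continuous_measurable_fun => a.
  apply: (@continuous_comp _ _ _ (fun a => x + a) g); last exact: cg.
  by apply: cvgD; [exact: cvg_cst|exact: cvg_id].
have slip x y : `|smoothed tau g x - smoothed tau g y| <= C' * `|x - y|.
  rewrite /smoothed /stein_mean -RintegralB//; try exact: bounded_mfun_integrable.
  have bB := bounded_mfunB (bg x) (bg y).
  have bc (k : R) : bounded_mfun (fun _ : R => k) by exact: bounded_mfun_cst.
  rewrite ler_norml -{1}(Rintegral_prob_cst (gauss tau) (- (C' * _))).
  rewrite -{2}(Rintegral_prob_cst (gauss tau) (C' * _)).
  by apply/andP; split; apply: le_Rintegral_bounded => // a;
    have := lip' (x + a) (y + a); rewrite (_ : x + a - (y + a) = x - y) ?ler_norml; try ring;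
    move=> /andP[].
have C'0 : 0 <= C' by apply: le_trans (gC' 0).
move=> x; apply/cvgrPdist_le => e e0; near=> y.
apply: le_trans (slip x y) _.
have : `|x - y| <= e / (C' + 1).
  near: y; apply: (@cvgr_dist_le _ _ _ _ _ id) => //; rewrite divr_gt0// ltr_wpDl//.
rewrite ler_pdivlMr ?ltr_wpDl//; have := normr_ge0 (x - y); nra.
Unshelve. all: by end_near. Qed.

Lemma norm_smoothed_le {R : realType} (tau : R) (g : R -> R) (C x : R) :
  continuous g -> (forall a, `|g a| <= C) -> `|smoothed tau g x| <= C.
Proof.
move=> cg gC; have bc (k : R) : bounded_mfun (fun _ : R => k) by exact: bounded_mfun_cst.
have bg : bounded_mfun (fun a : R => g (x + a)).
  split; last by exists C.
  apply: continuous_measurable_fun => a.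
  apply: (@continuous_comp _ _ _ (fun a => x + a) g); last exact: cg.
  by apply: cvgD; [exact: cvg_cst|exact: cvg_id].
rewrite ler_norml -{1}(Rintegral_prob_cst (gauss tau) (- C)) -{2}(Rintegral_prob_cst (gauss tau) C).
apply/andP; split; apply: le_Rintegral_bounded => // a; have := gC (x + a);
  by rewrite ler_norml => /andP[].
Qed.

(** * The weak law for functions of independent arrays *)

Section weak_law_for_arrays.
Context d (T : measurableType d) (R : realType) (P : probability T R).
Context d' (E : measurableType d').

Lemma mutually_independent_pair (J : finType) (W : J -> {mfun T >-> E}) :
  mutually_independent P (fun i => W i : T -> E) ->
  forall i j, i != j -> forall B C, measurable B -> measurable C ->
    P (W i @^-1` B `&` W j @^-1` C) = (P (W i @^-1` B) * P (W j @^-1` C))%E.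
Proof.
move=> ind i j ij B C mB mC.
pose S k : set E := if k == i then B else if k == j then C else setT.
have mS k : measurable (S k) by rewrite /S; case: ifP => // _; case: ifP.
have sig k : sigma_rv (W k : T -> E) (W k @^-1` S k) by exists (S k) => //; rewrite setTI.
have ji : (j == i) = false by rewrite eq_sym (negbTE ij).
have := ind _ sig.
have -> : \bigcap_k (W k @^-1` S k) = W i @^-1` B `&` W j @^-1` C.
  apply/seteqP; split => [w h|w [wB wC] k _].
    by have := h i I; have := h j I; rewrite /S !eqxx ji.
  by rewrite /S; case: eqP => [->//|_]; case: eqP => [->//|_].
move=> ->; rewrite (bigD1 i)//= (bigD1 j)//=; last by rewrite eq_sym.
rewrite /S !eqxx ji big1 ?mule1// => k /andP[/negbTE -> /negbTE ->].
by rewrite preimage_setT probability_setT.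
Qed.

Lemma weak_law_image (rho : probability E R) (n : nat -> nat)
    (W : forall k, 'I_(n k) -> {mfun T >-> E}) (f : E -> R) :
  n @ \oo --> \oo -> (forall k, (0 < n k)%N) ->
  (forall k i, has_law P (W k i) rho) ->
  (forall k, mutually_independent P (fun i => W k i : T -> E)) ->
  measurable_fun setT f -> rho.-integrable setT (EFin \o f) ->
  cvg_in_prob P (fun k w => (n k)%:R^-1 * \sum_i f (W k i w)) (\int[rho]_u f u).
Proof.
move=> noo n0 lawW indW mf intf.
pose fE : {mfun E >-> R} := HB.pack f (isMeasurableFun.Build _ _ _ _ f mf).
have mY k i : measurable_fun setT (fun w => f (W k i w)).
  exact: measurableT_comp mf (measurable_funPT _).
pose Y k i : {RV P >-> R} := HB.pack (fun w => f (W k i w))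
  (isMeasurableFun.Build _ _ _ _ (fun w => f (W k i w)) (mY k i)).
have iid : (distribution rho fE).-integrable setT (EFin \o id).
  by apply: integrable_pushforward => //; exact/measurable_EFinP.
have pre B : measurable B -> measurable (f @^-1` B).
  by move=> mB; rewrite -[_ @^-1` _]setTI; apply: (mf measurableT).
have := weak_law iid (Y := Y) noo n0.
rewrite (_ : \int[distribution rho fE]_y y = \int[rho]_u f u); last first.
  by rewrite /Rintegral integral_distribution//; exact: intf.
apply.
- by move=> k i B mB; exact: (lawW k i _ (pre _ mB)).
- move=> k i j ij B C mB mC.
  exact: (mutually_independent_pair (indW k) ij (pre _ mB) (pre _ mC)).
Qed.

End weak_law_for_arrays.

Unset Implicit Arguments.

(** * Large system limit with random data *)

Section large_system_limit.
Context d (T : measurableType d) (R : realType) (P : probability T R).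
Variables Delta t c : R.
Hypotheses (t0 : 0 < t) (c0 : 0 < c) (cE : Delta * (c + t) = c * (c + t) + c).
Local Notation L := (c + t).
Local Notation gs := (L^-1).
Variables (M N : nat -> nat) (x z : forall k, 'I_(N k) -> {RV P >-> R})
  (A : forall k, 'I_(M k) -> 'I_(N k) -> {RV P >-> R}) (v : forall k, 'I_(M k) -> {RV P >-> R}).
Hypothesis hN : N @ \oo --> \oo.
Hypothesis gA : forall k, gaussian_matrix Delta (A k).

Let S k (i : 'I_(N k) + 'I_(N k) + 'I_(M k)) : T -> R := match i with
  | inl (inl n) => x k n
  | inl (inr n) => z k n
  | inr m => v k m
  end.

Hypothesis hA_xzv : forall k, independent_sigma P
  (sigma_rvs (fun mn : 'I_(M k) * 'I_(N k) => A k mn.1 mn.2 : T -> R)) (sigma_rvs (S k)).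

Let D k w : 'cV[R]_(N k) := \col_n (z k n w - x k n w).
Let xv k w : 'cV[R]_(N k) := \col_n x k n w.
Let vv k w : 'cV[R]_(M k) := \col_m v k m w.
Let dd k w := (N k)%:R^-1 * dot (D k w) (D k w).
Let sv k w := (N k)%:R^-1 * dot (vv k w) (vv k w).

Variables D2 V2 : R.
Hypotheses (hdd : cvg_in_prob P dd D2) (hsv : cvg_in_prob P sv V2).

(** [limit_sqr_error] and [limit_sqr_res] as functions of the two empirical moments of the data;
    both are linear, see [lqE] and [lrE]. *)
Let lq a b := ((1 + gs) * t * (t * a / L) + gs * (b / (1 + gs))) / (L + gs * t).
Let lr a b := b / (1 + gs) - t * (lq a b - t * a / L).

Let L0 : 0 < L. Proof. exact: addr_gt0. Qed.
Let N0 k : (0 < N k)%N. Proof. by case: (gA k). Qed.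

Let mS k i : measurable_fun setT (S k i).
Proof. by case: i => [[n|n]|m]; exact: measurable_funPT. Qed.

Section data_measurability.
Context (k : nat) d' (W : measurableType d') (s : W -> T).
Hypothesis ms : forall i, measurable_fun setT (fun w => S k i (s w)).

Lemma measurable_D : measurable_mx (fun w => D k (s w)).
Proof.
move=> i j; under eq_fun do rewrite mxE.
by apply: measurable_funB; [exact: (ms (inl (inr i)))|exact: (ms (inl (inl i)))].
Qed.

Lemma measurable_v : measurable_mx (fun w => vv k (s w)).
Proof. by move=> i j; under eq_fun do rewrite mxE; exact: (ms (inr i)). Qed.

Lemma measurable_dot n (a b : W -> 'cV[R]_n) : measurable_mx a -> measurable_mx b ->
  measurable_fun setT (fun w => dot (a w) (b w)).
Proof. by move=> ma mb; apply: measurable_sum => i; exact: measurable_funM. Qed.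

Lemma measurable_dd : measurable_fun setT (fun w => dd k (s w)).
Proof.
have mD := measurable_D.
by apply: measurable_funM => //; apply: measurable_dot.
Qed.

Lemma measurable_sv : measurable_fun setT (fun w => sv k (s w)).
Proof.
have mv := measurable_v.
by apply: measurable_funM => //; apply: measurable_dot.
Qed.

Lemma measurable_error (B : W -> 'M[R]_(M k, N k)) : measurable_mx B ->
  measurable_mx (fun w => ridge t (B w) (vv k (s w)) (D k (s w))).
Proof.
by move=> mB; apply: measurable_ridge => //; [exact: measurable_v|exact: measurable_D].
Qed.

Lemma measurable_mean_sqr_error (B : W -> 'M[R]_(M k, N k)) : measurable_mx B ->
  measurable_fun setT (fun w => mean_sqr_error t (vv k (s w)) (D k (s w)) (B w)).
Proof.
move=> mB; have me := measurable_error B mB.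
by apply: measurable_funM => //; apply: measurable_dot.
Qed.

Lemma measurable_limit_sqr_error :
  measurable_fun setT (fun w => limit_sqr_error t c (vv k (s w)) (D k (s w))).
Proof.
change (measurable_fun setT (fun w => lq (dd k (s w)) (sv k (s w)))).
have mdd := measurable_dd; have msv := measurable_sv.
apply: measurable_funM => //; apply: measurable_funD.
  apply: measurable_funM => //; apply: measurable_funM => //; exact: measurable_funM.
by apply: measurable_funM => //; exact: measurable_funM.
Qed.

Section statistic.
Variables (tau : R) (h h' : R -> R) (C C' : R).
Hypotheses (dh : forall a : R, is_derive a (1 : R) h (h' a)).
Hypotheses (hC : forall a, `|h a| <= C) (hC' : forall a, `|h' a| <= C').

Let mh : measurable_fun setT h.
Proof.
apply: continuous_measurable_fun => a.
by apply: differentiable_continuous; apply/derivable1_diffP; case: (dh a).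
Qed.

Lemma measurable_smoothed_mean : measurable_fun setT (fun w => (N k)%:R^-1 *
  \sum_i smoothed tau h (xv k (s w) i 0 + t * gs * D k (s w) i 0)).
Proof.
apply: measurable_funM => //; apply: measurable_sum => i.
apply: (measurableT_comp (f := smoothed tau h)).
  by apply: continuous_measurable_fun; exact: (continuous_smoothed dh hC hC').
apply: measurable_funD; last by apply: measurable_funM => //; exact: measurable_D.
by under eq_fun do rewrite mxE; exact: (ms (inl (inl i))).
Qed.

Lemma measurable_statistic_gap (B : W -> 'M[R]_(M k, N k)) : measurable_mx B ->
  measurable_fun setT (fun w => statistic_gap t c tau h (vv k (s w)) (D k (s w)) (xv k (s w)) (B w)).
Proof.
move=> mB; apply: measurable_funM => //; apply: measurable_sum => i; apply: measurable_funB.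
  apply: (measurableT_comp (f := h)) => //; apply: measurable_funD; last exact: measurable_error.
  by under eq_fun do rewrite mxE; exact: (ms (inl (inl i))).
apply: (measurableT_comp (f := smoothed tau h)).
  by apply: continuous_measurable_fun; exact: (continuous_smoothed dh hC hC').
apply: measurable_funD; last by apply: measurable_funM => //; exact: measurable_D.
by under eq_fun do rewrite mxE; exact: (ms (inl (inl i))).
Qed.

End statistic.

End data_measurability.


Let eta_close k eta w := `|dd k w - D2| <= eta /\ `|sv k w - V2| <= eta.

Let k1 := V2 + 1 + t * (D2 + 1).

Let energy_le k eta w : eta <= 1 -> eta_close k eta w ->
  ridge_energy t (vv k w) (D k w) <= k1 * (N k)%:R.
Proof.
move=> eta1 [h1 h2]; have Nk : 0 < (N k)%:R :> R by rewrite ltr0n.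
have h3 : sv k w <= V2 + 1.
  by have := le_trans (ler_norm _) h2; lra.
have h4 : dd k w <= D2 + 1.
  by have := le_trans (ler_norm _) h1; lra.
move: h3 h4; rewrite /sv /dd !ler_pdivrMl// => h3 h4.
rewrite /ridge_energy /k1 mulrDl; apply: lerD; first by rewrite mulrC.
by rewrite -mulrA ler_pM2l// mulrC.
Qed.

Let sub_measurable (f : T -> R) k e :
  measurable_fun setT (f : g_sigma_algebraType (\bigcup_i sigma_rv (S k i)) -> R) ->
  measurable ([set w | `|f w| <= e] : set (g_sigma_algebraType (\bigcup_i sigma_rv (S k i)))).
Proof.
move=> mf; have := measurableT_comp (@normr_measurable R setT) mf.
move=> /(_ measurableT `]-oo, e]%classic (measurable_itv _)); rewrite setTI.
by congr measurable; apply/seteqP; split => w /=; rewrite in_itv.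
Qed.

Lemma concentration_cvg (F : forall k, 'M[R]_(M k, N k) -> T -> R) (K K2 : R) :
  (forall k d' (W : measurableType d') (B : W -> 'M[R]_(M k, N k)) (s : W -> T),
     measurable_mx B -> (forall i, measurable_fun setT (fun w => S k i (s w))) ->
     measurable_fun setT (fun w => F k (B w) (s w))) ->
  (forall k w, regular0 (fun B => F k B w)) ->
  (forall k eta w, eta <= 1 -> eta_close k eta w ->
     ridge_energy t (vv k w) (D k w) <= k1 * (N k)%:R ->
     Ex (A k) (fun B => F k B w ^+ 2) <= (N k)%:R^-1 * K + K2 * eta ^+ 2) ->
  cvg_in_prob P (fun k w => F k (random_mx (A k) w) w) 0.
Proof.
move=> mF rF hF; apply: cvg_in_prob_good => [k|e del e0 del0].
  by apply: mF => //; exact: measurable_random_mx.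
have e2 : 0 < e ^+ 2 by rewrite exprn_gt0.
(* [eta] is fixed before the size of the problem: the mismatch term takes half of the budget
   [del * e ^+ 2], and the [1 / N] term the other half for large [k]. Since [eta <= 1], its square
   is at most [eta]. *)
have [eta [eta0 eta1 etaK]] : exists eta : R, [/\ 0 < eta, eta <= 1 &
    `|K2| * eta ^+ 2 <= del * e ^+ 2 / 2].
  pose u := del * e ^+ 2 / 2 / (`|K2| + 1).
  have K20 : 0 < `|K2| + 1 by rewrite ltr_wpDl.
  have u0 : 0 < u by rewrite /u !divr_gt0// mulr_gt0.
  exists (Num.min 1 u); split; first by rewrite lt_min ltr01.
    by rewrite ge_min lexx.
  have m0 : 0 <= Num.min 1 u by rewrite le_min ler01 ltW.
  apply: (@le_trans _ _ ((`|K2| + 1) * u)); last by rewrite /u mulrC divfK ?lt0r_neq0.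
  apply: ler_pM; rewrite ?sqr_ge0// ?lerDl//.
  rewrite expr2; apply: (@le_trans _ _ (1 * u)); last by rewrite mul1r.
  by apply: ler_pM => //; rewrite ge_min lexx ?orbT.
exists (fun k => [set w | `|dd k w - D2| <= eta] `&` [set w | `|sv k w - V2| <= eta]).
have mid k i : measurable_fun setT (S k i : g_sigma_algebraType (\bigcup_i sigma_rv (S k i)) -> R).
  exact: measurable_data.
have mdd k := measurable_dd k _ (g_sigma_algebraType (\bigcup_i sigma_rv (S k i))) id (mid k).
have msv k := measurable_sv k _ (g_sigma_algebraType (\bigcup_i sigma_rv (S k i))) id (mid k).
have mG k : measurable ([set w | `|dd k w - D2| <= eta] `&` [set w | `|sv k w - V2| <= eta]
    : set (g_sigma_algebraType (\bigcup_i sigma_rv (S k i)))).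
  by apply: measurableI; apply: sub_measurable; exact: measurable_funB.
have mGT k : measurable ([set w | `|dd k w - D2| <= eta] `&` [set w | `|sv k w - V2| <= eta]).
  apply: (smallest_sub (@sigma_algebra_measurable _ T)) (mG k) => B [i _ [C mC <-]].
  exact: mS.
split => //.
  have del2 : 0 < del / 2 by rewrite divr_gt0.
  have h1 := (cvg_in_probP P dd D2).1 hdd _ _ eta0 del2.
  have h2 := (cvg_in_probP P sv V2).1 hsv _ _ eta0 del2.
  have mset (f : T -> R) : measurable_fun setT f -> measurable [set w | eta < `|f w|].
    move=> mf; have := measurableT_comp (@normr_measurable R setT) mf.
    move=> /(_ measurableT `]eta, +oo[%classic (measurable_itv _)); rewrite setTI.
    by congr measurable; apply/seteqP; split => w /=; rewrite in_itv/= andbT.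
  have m1 k : measurable [set w | eta < `|dd k w - D2|].
    by apply: mset; apply: measurable_funB => //; exact: (measurable_dd k _ _ id (mS k)).
  have m2 k : measurable [set w | eta < `|sv k w - V2|].
    by apply: mset; apply: measurable_funB => //; exact: (measurable_sv k _ _ id (mS k)).
  apply: filterS2 h1 h2 => k h1 h2.
  apply: (@le_trans _ _ (P ([set w | eta < `|dd k w - D2|] `|` [set w | eta < `|sv k w - V2|]))).
    rewrite le_measure ?inE//; [exact: measurableC|exact: measurableU|].
    move=> w /= /not_andP[|] /negP; rewrite -ltNge; by [left|right].
  apply: le_trans (measureU2 _ _ _) _ => //.
  by rewrite [leRHS](_ : _ = (del / 2)%:E + (del / 2)%:E)%E ?leeD// -EFinD -splitr.
near=> k.
have Nk : 0 < (N k)%:R :> R by rewrite ltr0n.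
pose cst := (N k)%:R^-1 * `|K| + `|K2| * eta ^+ 2.
have cst0 : 0 <= cst.
  by apply: addr_ge0; apply: mulr_ge0; rewrite ?sqr_ge0// invr_ge0 ltW.
have cstle : cst <= del * e ^+ 2.
  rewrite [leRHS]splitr /cst; apply: lerD => //.
  rewrite ler_pdivrMl// -ler_pdivrMr ?divr_gt0 ?mulr_gt0//.
  by near: k; exact: (hN _ (nbhs_infty_ger _)).
rewrite (_ : [set w | e < `|F k (random_mx (A k) w) w - 0|] =
  [set w | e < `|F k (random_mx (A k) w) w|]); last by apply/funext => w /=; rewrite subr0.
apply: (@le_trans _ _ (cst / e ^+ 2)%:E); last by rewrite lee_fin ler_pdivrMr.
apply: (conditional_chebyshev (mS k) (hA_xzv k) (mF k) (mG k) e0) => //.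
move=> w [h1 h2]; apply: le_trans (hF k eta w eta1 (conj h1 h2) _) _.
  exact: (energy_le k eta w eta1 (conj h1 h2)).
apply: lerD; first by rewrite ler_pM2l ?invr_gt0// ler_norm.
by rewrite ler_wpM2r ?sqr_ge0// ler_norm.
Unshelve. all: by end_near. Qed.

Let gs0 : 0 < gs. Proof. by rewrite invr_gt0. Qed.
Let ca := (1 + gs) * t * t / L / (L + gs * t).
Let cb := gs / (1 + gs) / (L + gs * t).
Let ra := - t * (ca - t / L).
Let rb := (1 + gs)^-1 - t * cb.

Let lqE a b : lq a b = ca * a + cb * b.
Proof. by rewrite /lq /ca /cb; ring. Qed.

Let lrE a b : lr a b = ra * a + rb * b.
Proof. by rewrite /lr lqE /ra /rb; ring. Qed.

Let mdd k : measurable_fun setT (dd k).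
Proof. exact: (measurable_dd k _ _ id (mS k)). Qed.

Let msv k : measurable_fun setT (sv k).
Proof. exact: (measurable_sv k _ _ id (mS k)). Qed.

Lemma mean_sqr_error_cvg :
  cvg_in_prob P (fun k w => mean_sqr_error t (vv k w) (D k w) (random_mx (A k) w)) (lq D2 V2).
Proof.
pose F k (B : 'M[R]_(M k, N k)) w :=
  mean_sqr_error t (vv k w) (D k w) B - limit_sqr_error t c (vv k w) (D k w).
have mF k d' (W : measurableType d') (B : W -> 'M[R]_(M k, N k)) (s : W -> T) :
    measurable_mx B -> (forall i, measurable_fun setT (fun w => S k i (s w))) ->
    measurable_fun setT (fun w => F k (B w) (s w)).
  move=> mB ms; apply: measurable_funB; first exact: (measurable_mean_sqr_error k _ _ s ms).
  exact: (measurable_limit_sqr_error k _ _ s ms).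
have Fcvg : cvg_in_prob P (fun k w => F k (random_mx (A k) w) w) 0.
  apply: (concentration_cvg F (sqr_error_cst t c k1) 0) => // [k w|k eta w _ _ h].
    apply: regular0B; last exact: regular0_cst.
    by rewrite /mean_sqr_error /dot; regular.
  by rewrite mul0r addr0; exact: (sqr_error_concentration t0 c0 cE (gA k) h).
have lcvg : cvg_in_prob P (fun k w => ca * dd k w + cb * sv k w) (lq D2 V2).
  rewrite lqE; apply: cvg_in_probD => [k|k||]; try exact: measurable_funM.
    exact: cvg_in_probZ.
  exact: cvg_in_probZ.
have mFA k : measurable_fun setT (fun w => F k (random_mx (A k) w) w).
  by apply: (mF k) => //; exact: measurable_random_mx.
have := cvg_in_probD mFA _ Fcvg lcvg; rewrite add0r.
rewrite (_ : (fun k w => F k (random_mx (A k) w) w + (ca * dd k w + cb * sv k w)) =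
  (fun k w => mean_sqr_error t (vv k w) (D k w) (random_mx (A k) w))).
  by apply=> k; apply: measurable_funD; exact: measurable_funM.
apply/funext => k; apply/funext => w.
by rewrite -lqE /F -[limit_sqr_error _ _ _ _]/(lq (dd k w) (sv k w)) subrK.
Qed.

(** [lrtau] selects the variance for which the mismatch vanishes at the limiting moments; near them
    it is linear in the deviations, hence at most [(|ra| + |rb|) * eta]. *)
Lemma smooth_statistic_cvg (tau : R) (h h' : R -> R) (C C' l : R) :
  0 < tau -> (forall a : R, is_derive a (1 : R) h (h' a)) -> continuous h' ->
  (forall a, `|h a| <= C) -> (forall a, `|h' a| <= C') ->
  lr D2 V2 = L ^+ 2 * tau ^+ 2 ->
  cvg_in_prob P (fun k w => (N k)%:R^-1 *
    \sum_i smoothed tau h (xv k w i 0 + t * gs * D k w i 0)) l ->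
  cvg_in_prob P (fun k w => (N k)%:R^-1 *
    \sum_i h (xv k w i 0 + ridge t (random_mx (A k) w) (vv k w) (D k w) i 0)) l.
Proof.
move=> tau0 dh ch' hC hC' lrtau scvg.
have ch : continuous h.
  by move=> a; apply: differentiable_continuous; apply/derivable1_diffP; case: (dh a).
pose F k (B : 'M[R]_(M k, N k)) w := statistic_gap t c tau h (vv k w) (D k w) (xv k w) B.
have mF k d' (W : measurableType d') (B : W -> 'M[R]_(M k, N k)) (s : W -> T) :
    measurable_mx B -> (forall i, measurable_fun setT (fun w => S k i (s w))) ->
    measurable_fun setT (fun w => F k (B w) (s w)).
  by move=> mB ms; exact: (measurable_statistic_gap k _ _ s ms tau h h' C C').
have K0 : 0 <= variance_mismatch_cst t c tau C.
  rewrite /variance_mismatch_cst; apply: mulr_ge0; first by rewrite divr_ge0// ltW.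
  apply: mulr_ge0; first by rewrite divr_ge0// mulr_ge0// ltW.
  by rewrite mulr_ge0// mulr_ge0// sqr_ge0.
have Fcvg : cvg_in_prob P (fun k w => F k (random_mx (A k) w) w) 0.
  apply: (concentration_cvg F (statistic_cst t c tau C C' k1)
    (variance_mismatch_cst t c tau C * (`|ra| + `|rb|) ^+ 2)) => // [k w|k eta w _ [h1 h2] hE].
    apply: regular0M; first exact: regular0_cst.
    apply: regular0_sum => i; apply: regular0B; last exact: regular0_cst.
    have cs : continuous (fun a => h (xv k w i 0 + a)).
      move=> a; apply: (@continuous_comp _ _ _ (fun a => xv k w i 0 + a) h); last exact: ch.
      by apply: cvgD; [exact: cvg_cst|exact: cvg_id].
    by apply: (regular0_comp cs) => //; [exists C|exact: regular0_ridge].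
  apply: le_trans (statistic_concentration t0 c0 cE tau0 dh ch' hC hC' (gA k) (xv k w) hE) _.
  rewrite lerD2l -mulrA ler_wpM2l//.
  rewrite -[limit_sqr_res _ _ _ _]/(lr (dd k w) (sv k w)) -lrtau !lrE.
  have -> : ra * dd k w + rb * sv k w - (ra * D2 + rb * V2) =
    ra * (dd k w - D2) + rb * (sv k w - V2) by ring.
  rewrite -exprMn -(real_normK (num_real (_ + _))).
  have eta0 : 0 <= eta by apply: le_trans h1.
  rewrite lerXn2r ?nnegrE// ?mulr_ge0 ?addr_ge0//.
  apply: le_trans (ler_normD _ _) _; rewrite [leRHS]mulrDl !normrM.
  by apply: lerD; apply: ler_wpM2l.
have mFA k : measurable_fun setT (fun w => F k (random_mx (A k) w) w).
  by apply: (mF k) => //; exact: measurable_random_mx.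
have msm k := measurable_smoothed_mean k _ _ id (mS k) tau h h' C C' dh hC hC'.
have := cvg_in_probD mFA msm Fcvg scvg; rewrite add0r.
congr cvg_in_prob; apply/funext => k; apply/funext => w.
by rewrite /F /statistic_gap -mulrDr -big_split; congr (_ * _); apply: eq_bigr => i _ /=; rewrite subrK.
Qed.

End large_system_limit.
Set Implicit Arguments.

(** * Identification of the limits and proof of the theorem *)

(** The fixed point equation gives [Delta], and the two optimizer equations give [b ^+ 2] and [D2],
    all in terms of [a], [c], [t] and [sigma]; both claims then become rational identities. *)
Lemma limit_values {R : realType} (Delta t c sigma a b D2 : R) :
  0 < Delta -> 0 < t -> 0 < c -> Delta * (c + t) = c * (c + t) + c ->
  b * Num.sqrt Delta = c * a ->
  a ^+ 2 - sigma ^+ 2 = (b ^+ 2 + t ^+ 2 * D2) / (c + t) ^+ 2 ->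
  let gs := (c + t)^-1 in
  let q := ((1 + gs) * t * (t * D2 / (c + t)) + gs * (Delta * sigma ^+ 2 / (1 + gs))) /
    (c + t + gs * t) in
  q = a ^+ 2 - sigma ^+ 2 /\
  Delta * sigma ^+ 2 / (1 + gs) - t * (q - t * D2 / (c + t)) = b ^+ 2.
Proof.
move=> hD t0 c0 cE bE stat gs q.
have L0 : 0 < c + t by rewrite addr_gt0.
have L1 : 0 < c + t + 1 by rewrite addr_gt0.
have DE : Delta = c * (c + t + 1) / (c + t).
  by rewrite -[LHS](mulfK (lt0r_neq0 L0)) cE; field; rewrite lt0r_neq0.
have b2 : b ^+ 2 = c * (c + t) / (c + t + 1) * a ^+ 2.
  have h : b ^+ 2 * Delta = c ^+ 2 * a ^+ 2.
    by rewrite -exprMn -bE exprMn sqr_sqrtr// ltW.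
  rewrite -[LHS](mulfK (lt0r_neq0 hD)) h DE.
  by field; rewrite !lt0r_neq0.
have D2E : D2 = ((c + t) ^+ 2 * (a ^+ 2 - sigma ^+ 2) - b ^+ 2) / t ^+ 2.
  by rewrite stat; field; rewrite !lt0r_neq0.
have Lt : 0 < (c + t) ^+ 2 + t by rewrite addr_gt0// exprn_gt0.
have Lt' : 0 < (c + t) * (c + t) + t by rewrite -expr2.
have qE : q = a ^+ 2 - sigma ^+ 2.
  rewrite /q /gs D2E b2 DE; field; rewrite !lt0r_neq0//=.
split => //; rewrite qE /gs D2E b2 DE; field; rewrite !lt0r_neq0//.
Qed.

Section scalar_equivalent.
Context {R : realType} (Delta gamma : R) {dQ} {TQ : measurableType dQ} (Q : probability TQ R).
Hypotheses (hDelta : 0 < Delta) (hgamma : 0 < gamma).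
Variables (X H Z : {RV Q >-> R}).
Hypothesis hH : has_law Q H (normal_prob 0 1).
Hypothesis hHXZ : independent_sigma Q (sigma_rv H) (sigma_rv (fun w => (X w, Z w))).
Local Notation t := (gamma^-1).

Lemma measurable_pair_rv : measurable_fun setT (fun w => (X w, Z w)).
Proof. exact: measurable_fun_pair. Qed.

Definition pair_rv : {mfun TQ >-> (R * R)%type} := HB.pack (fun w => (X w, Z w))
  (isMeasurableFun.Build _ _ _ _ (fun w => (X w, Z w)) measurable_pair_rv).

(** Since [beta * sqrt Delta / alpha = c], conditionally on [(X, Z)] the variable [Shat] is Gaussian
    with mean [X + t (Z - X) / (c + t)] and standard deviation [beta / (c + t)]. *)
Lemma Rintegral_Shat (alpha beta c : R) (h h' : R -> R) (C C' : R) :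
  0 < alpha -> 0 < beta -> 0 < c -> beta * Num.sqrt Delta = c * alpha ->
  (forall a : R, is_derive a (1 : R) h (h' a)) -> (forall a, `|h a| <= C) ->
  (forall a, `|h' a| <= C') ->
  \int[Q]_w h (Shat Delta gamma alpha beta (X w) (H w) (Z w)) =
  \int[distribution Q pair_rv]_u
    smoothed (beta / (c + t)) h (u.1 + t * (c + t)^-1 * (u.2 - u.1)).
Proof.
move=> al0 be0 c0 bs dh hC hC'.
have t0 : 0 < t by rewrite invr_gt0.
have L0 : 0 < c + t by rewrite addr_gt0.
have tau0 : 0 < beta / (c + t) by rewrite divr_gt0.
have ch : continuous h.
  by move=> a; apply: differentiable_continuous; apply/derivable1_diffP; case: (dh a).
pose m (u : R * R) : R := u.1 + t * (c + t)^-1 * (u.2 - u.1).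
pose f (p : (R * R) * R) : R := h (m p.1 + beta / (c + t) * p.2).
have mm : measurable_fun setT m.
  by apply: measurable_funD => //; apply: measurable_funM => //; exact: measurable_funB.
have mf : measurable_fun setT f.
  apply: (measurableT_comp (f := h)); first exact: continuous_measurable_fun.
  apply: measurable_funD; last exact: measurable_funM.
  exact: (measurableT_comp mm).
have fE w : h (Shat Delta gamma alpha beta (X w) (H w) (Z w)) = f (pair_rv w, H w).
  rewrite -[Shat _ _ _ _ _ _ _](subrK (X w)) Shat_sub_signal ?(ltW be0)// bs mulfK ?lt0r_neq0//.
  by rewrite /f /m /=; congr h; ring.
have ind B C1 : measurable B -> measurable C1 ->
    Q (pair_rv @^-1` B `&` H @^-1` C1) = (Q (pair_rv @^-1` B) * Q (H @^-1` C1))%E.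
  move=> mB mC; rewrite setIC muleC; apply: hHXZ; first by exists C1 => //; rewrite setTI.
  by exists B => //; rewrite setTI.
transitivity (\int[Q]_w f (pair_rv w, H w)); first by apply: eq_Rintegral => w _; exact: fE.
rewrite (integral_independent ind mf); last first.
  apply: bounded_mfun_integrable; split; last by exists C => w; exact: hC.
  by apply: (measurableT_comp mf); exact: measurable_fun_pair.
have lawH : has_law Q H (gauss 1) by exact: hH.
apply: eq_Rintegral => u _; rewrite (eq_Rintegral_law lawH).
have cm : continuous (fun a => h (m u + a)).
  move=> a; apply: (@continuous_comp _ _ _ (fun a => m u + a) h); last exact: ch.
  by apply: cvgD; [exact: cvg_cst|exact: cvg_id].
exact: (Rintegral_gauss_scale (h := fun a => h (m u + a)) tau0 cm (fun a => hC _)).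
Qed.

End scalar_equivalent.

Theorem mainTheorem1
  (R : realType)
  (Delta sigmav gamma : R)
  (hDelta : 0 < Delta) (hsigmav : 0 < sigmav) (hgamma : 0 < gamma)
  (pX pZ : probability R R)
  (hpX_mean : ('E_pX[fun t => t])%E \is a fin_num)
  (hpX_var : ('V_pX[fun t => t])%E \is a fin_num)
  (* scalar random variables X, H, Z *)
  (dQ : measure_display) (TQ : measurableType dQ) (Q : probability TQ R)
  (X H Z : {RV Q >-> R})
  (hX : has_law Q X pX) (hZ : has_law Q Z pZ)
  (hH : has_law Q H (normal_prob 0 1))
  (hHXZ : independent_sigma Q (sigma_rv H) (sigma_rv (fun w => (X w, Z w))))
  (* unique optimizer of the scalar min-max problem *)
  (alpha beta : R)
  (hopt : unique_minimax_optimizer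
            (objective Delta gamma sigmav X H Z) alpha beta)
  (* sequence of problems, of sizes M k x N k *)
  (M N : nat -> nat)
  (hM : M @ \oo --> \oo) (hN : N @ \oo --> \oo)
  (hMN : forall k, (M k)%:R / (N k)%:R = Delta)
  (d : measure_display) (T : measurableType d) (P : probability T R)
  (x z : forall k, 'I_(N k) -> {RV P >-> R})
  (A : forall k, 'I_(M k) -> 'I_(N k) -> {RV P >-> R})
  (v : forall k, 'I_(M k) -> {RV P >-> R})
  (* the pairs (x_n, z_n) are i.i.d. with the law of (X, Z) *)
  (hxz_law : forall k n,
     has_law P (fun w => (x k n w, z k n w))
       (pushforward Q (fun w => (X w, Z w))))
  (hxz_ind : forall k,
     mutually_independent P (fun n w => (x k n w, z k n w)))
  (* normal_prob takes the standard deviation *)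
  (hA_law : forall k m n,
     has_law P (A k m n) (normal_prob 0 (Num.sqrt (N k)%:R^-1)))
  (hA_ind : forall k,
     mutually_independent P (fun mn : 'I_(M k) * 'I_(N k) => A k mn.1 mn.2))
  (hv_law : forall k m, has_law P (v k m) (normal_prob 0 sigmav))
  (hv_ind : forall k, mutually_independent P (fun m => v k m))
  (* A is independent of (x, z, v) *)
  (hA_xzv : forall k,
     independent_sigma P
       (sigma_rvs (fun mn : 'I_(M k) * 'I_(N k) => A k mn.1 mn.2))
       (sigma_rvs (fun i : 'I_(N k) + 'I_(N k) + 'I_(M k) =>
          match i with
          | inl (inl n) => x k n
          | inl (inr n) => z k n
          | inr m => v k m
          end : T -> R))) :
  let xv k w : 'cV[R]_(N k) := \col_n x k n w in
  let zv k w : 'cV[R]_(N k) := \col_n z k n w in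
  let vv k w : 'cV[R]_(M k) := \col_m v k m w in
  let Am k w : 'M[R]_(M k, N k) := \matrix_(m, n) A k m n w in
  let y k w := Am k w *m xv k w + vv k w in
  let shat k w := prox_sqloss gamma (Am k w) (y k w) (zv k w) in
  [/\ (* the displayed formulas for the proximity operator *)
      forall k w,
        [/\ prox_set (fun s => (gamma * sqloss (Am k w) (y k w) s)%:E) (zv k w)
              = [set shat k w],
            argmin (fun s => (2^-1 * sqnorm2 (y k w - Am k w *m s)
                       + (2 * gamma)^-1 * sqnorm2 (s - zv k w))%:E)
              = [set shat k w],
            (Am k w)^T *m Am k w + (gamma^-1)%:M \in unitmx &
            shat k w =
              invmx ((Am k w)^T *m Am k w + (gamma^-1)%:M)
              *m ((Am k w)^T *m y k w + gamma^-1 *: zv k w)],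
      (* 1 *)
      cvg_in_prob P
        (fun k w => (N k)%:R^-1 * sqnorm2 (shat k w - xv k w))
        (alpha ^+ 2 - sigmav ^+ 2) &
      (* 2 *)
      weak_cvg_in_prob P
        (fun k w => empirical_measure (shat k w))
        (distribution Q (Shat_rv Delta gamma X H Z alpha beta))].
Proof.
move=> xv zv vv Am y shat; pose t := gamma^-1.
have t0 : 0 < t by rewrite invr_gt0.
have [c c0 cE] := fixed_point_exists hDelta t0.
have L0 : 0 < c + t by rewrite addr_gt0.
have [al0 be0 bs stat] := optimizer_equations hDelta hsigmav hgamma hH hHXZ hopt c0 cE.
have iD2 := optimizer_square_integrable hDelta hgamma hH hopt.
set D2 := \int[Q]_w _ in stat.
have D20 : 0 <= D2 by apply: Rintegral_ge0 => w _; exact: sqr_ge0.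
have [qE rhoE] := limit_values hDelta t0 c0 cE bs stat.
have Nk k : (0 < N k)%N.
  rewrite lt0n; apply/eqP => Nk0; have := hMN k.
  by rewrite Nk0 invr0 mulr0 => /esym/eqP; rewrite gt_eqF.
have ME k : (M k)%:R = Delta * (N k)%:R :> R.
  by rewrite -(hMN k) divfK// pnatr_eq0 -lt0n.
have Mk k : (0 < M k)%N.
  by rewrite -(ltr0n R) ME mulr_gt0// ltr0n.
pose D k w : 'cV[R]_(N k) := \col_n (z k n w - x k n w).
have subE n (a b : 'cV[R]_n) i : (a - b) i 0 = a i 0 - b i 0 by rewrite !mxE.
have xvE k w n : xv k w n 0 = x k n w by rewrite mxE.
have DnE k w n : D k w n 0 = z k n w - x k n w by rewrite mxE.
have gA k : gaussian_matrix Delta (A k) by split.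
have shatE k w : shat k w = ridge t (Am k w) (y k w) (zv k w) by exact: prox_sqlossE.
have DE k w : D k w = zv k w - xv k w by apply/colP => n; rewrite !mxE.
have errE k w : shat k w - xv k w = ridge t (random_mx (A k) w) (vv k w) (D k w).
  by rewrite shatE DE; exact: ridge_sub_signal.
pose rho := distribution Q (pair_rv X Z).
have mW k n : measurable_fun setT (fun w => (x k n w, z k n w)) by exact: measurable_fun_pair.
pose W k n : {mfun T >-> (R * R)%type} := HB.pack (fun w => (x k n w, z k n w))
  (isMeasurableFun.Build _ _ _ _ (fun w => (x k n w, z k n w)) (mW k n)).
have lln_xz (f : R * R -> R) : measurable_fun setT f -> rho.-integrable setT (EFin \o f) ->
    cvg_in_prob P (fun k w => (N k)%:R^-1 * \sum_n f (x k n w, z k n w)) (\int[rho]_u f u).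
  move=> mf intf; have lawW k n : has_law P (W k n) rho by move=> B mB; exact: hxz_law.
  have indW k : mutually_independent P (fun n => W k n : T -> R * R) by exact: hxz_ind.
  exact: (weak_law_image hN Nk lawW indW mf intf).
(* The integrability of [(Z - X) ^ 2] needed by the weak law is [iD2], a consequence of the
   uniqueness of the optimizer. *)
have hdd : cvg_in_prob P (fun k w => (N k)%:R^-1 * dot (D k w) (D k w)) D2.
  pose f (u : R * R) := (u.2 - u.1) ^+ 2.
  have mf : measurable_fun setT f by apply: measurable_funX; exact: measurable_funB.
  have intf : rho.-integrable setT (EFin \o f).
    by apply: integrable_pushforward => //; exact/measurable_EFinP.
  have := lln_xz f mf intf.
  rewrite (_ : \int[rho]_u f u = D2); last first.
    by rewrite /Rintegral integral_distribution//; exact/measurable_EFinP.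
  congr cvg_in_prob; apply/funext => k; apply/funext => w; congr (_ * _).
  by apply: eq_bigr => n _; rewrite /f /D !mxE -expr2.
(* There are [M k] noise terms but the normalization is by [N k], whence the factor [Delta]. *)
have hsv : cvg_in_prob P (fun k w => (N k)%:R^-1 * dot (vv k w) (vv k w)) (Delta * sigmav ^+ 2).
  have [i2 e2] := gauss_second_moment hsigmav.
  have mf : measurable_fun setT (fun a : R => a ^+ 2) by exact: measurable_funX.
  have lawv k m : has_law P (v k m) (gauss sigmav) by exact: hv_law.
  have h := weak_law_image hM Mk lawv hv_ind mf i2.
  rewrite -e2; have := fun mU => cvg_in_probZ Delta mU h.
  rewrite (_ : (fun k w => _) = (fun k w => (N k)%:R^-1 * dot (vv k w) (vv k w))).
    apply=> k; apply: measurable_funM => //; apply: measurable_sum => m.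
    exact: measurable_funX.
  apply/funext => k; apply/funext => w; rewrite mulrA ME.
  rewrite invfM mulrA mulfV ?gt_eqF// mul1r; congr (_ * _).
  by apply: eq_bigr => m _; rewrite !mxE -expr2.
split.
- move=> k w; split.
  + by rewrite shatE; exact: prox_set_sqloss.
  + by rewrite shatE; exact: argmin_sqloss.
  + exact: gram_unit.
  + exact: shatE.
- have := mean_sqr_error_cvg _ _ _ P Delta t c t0 c0 cE M N x z A v hN gA hA_xzv D2
    (Delta * sigmav ^+ 2) hdd hsv.
  rewrite qE; congr cvg_in_prob; apply/funext => k; apply/funext => w.
  by rewrite errE sqnorm2_dot.
- move=> g cg sg; have [C gC] := compact_support_bounded cg sg.
  have mg : measurable_fun setT g by exact: continuous_measurable_fun.
  have mshat k n : measurable_fun setT (fun w => shat k w n 0).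
    have -> : (fun w => shat k w n 0) = (fun w => x k n w +
        ridge t (random_mx (A k) w) (vv k w) (D k w) n 0).
      by apply/funext => w; rewrite -errE subE xvE addrC subrK.
    apply: measurable_funD => //; apply: measurable_ridge => //.
    + exact: measurable_random_mx.
    + by move=> i j; under eq_fun do rewrite mxE; exact: measurable_funPT.
    + by move=> i j; under eq_fun do rewrite mxE; exact: measurable_funB.
  rewrite (_ : \int[_]_a g a = \int[Q]_w g (Shat Delta gamma alpha beta (X w) (H w) (Z w))); last first.
    rewrite /Rintegral integral_distribution//; first exact/measurable_EFinP.
    apply: bounded_mfun_integrable; split; last by exists C => w; exact: gC.
    by apply: (measurableT_comp mg); exact: measurable_funPT (Shat_rv Delta gamma X H Z alpha beta).
  under [X in cvg_in_prob _ X]eq_fun do under eq_fun do rewrite Rintegral_empirical//.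
  have mshatg k (h : R -> R) : measurable_fun setT h ->
      measurable_fun setT (fun w => (N k)%:R^-1 * \sum_n h (shat k w n 0)).
    move=> mh; apply: measurable_funM => //; apply: measurable_sum => n.
    exact: (measurableT_comp mh).
  (* [g] is replaced by a smooth [h] within [e] uniformly, because the concentration of averages
     needs a bounded continuous derivative. *)
  apply: cvg_in_prob_approx => [k|e e0]; first exact: mshatg.
  have [h [h' [C' [dh ch' hC hC' gh]]]] := smooth_approximation cg sg gC e0.
  have ch : continuous h.
    by move=> a; apply: differentiable_continuous; apply/derivable1_diffP; case: (dh a).
  have mh := continuous_measurable_fun ch.
  have bS (f : R -> R) : measurable_fun setT f -> (forall a, `|f a| <= C) ->
      Q.-integrable setT (EFin \o (fun w => f (Shat Delta gamma alpha beta (X w) (H w) (Z w)))).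
    move=> mf fC; apply: bounded_mfun_integrable; split; last by exists C => w; exact: fC.
    by apply: (measurableT_comp mf); exact: measurable_funPT (Shat_rv Delta gamma X H Z alpha beta).
  exists (fun k w => (N k)%:R^-1 * \sum_n h (shat k w n 0)).
  exists (\int[Q]_w h (Shat Delta gamma alpha beta (X w) (H w) (Z w))); split.
  + by move=> k; exact: mshatg.
  + near=> k => w; rewrite -mulrBr -sumrB normrM gtr0_norm ?invr_gt0 ?ltr0n//.
    rewrite ler_pdivrMl ?ltr0n//; apply: le_trans (ler_norm_sum _ _ _) _.
    have -> : (N k)%:R * e = \sum_(n < N k) e by rewrite sumr_const card_ord -[RHS]mulr_natl.
    by apply: ler_sum => n _; rewrite distrC.
  + rewrite -RintegralB//; try exact: bS.
    apply: le_trans (le_normr_Rintegral _ _) _ => //.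
      have := integrableB measurableT (bS g mg gC) (bS h mh hC).
      by congr integrable.
    rewrite -(Rintegral_prob_cst Q e).
    apply: le_Rintegral => //.
    * have := integrable_norm (integrableB measurableT (bS g mg gC) (bS h mh hC)).
      by congr integrable.
    * by apply: bounded_mfun_integrable; exact: bounded_mfun_cst.
    * by move=> w _; rewrite distrC.
  + rewrite (Rintegral_Shat hDelta hgamma hH hHXZ al0 be0 c0 bs dh hC hC').
    have tau0 : 0 < beta / (c + t) by rewrite divr_gt0.
    (* The limit of the residual energy is [beta ^+ 2]; this is what makes [beta / (c + t)] the
       right standard deviation. *)
    have lrE : Delta * sigmav ^+ 2 / (1 + (c + t)^-1) -
        t * (((1 + (c + t)^-1) * t * (t * D2 / (c + t)) +
          (c + t)^-1 * (Delta * sigmav ^+ 2 / (1 + (c + t)^-1))) / (c + t + (c + t)^-1 * t) -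
          t * D2 / (c + t)) = (c + t) ^+ 2 * (beta / (c + t)) ^+ 2.
      by rewrite rhoE; field; rewrite lt0r_neq0.
    pose m (u : R * R) : R := u.1 + t * (c + t)^-1 * (u.2 - u.1).
    have cs := continuous_smoothed (tau := beta / (c + t)) dh hC hC'.
    have ms : measurable_fun setT (fun u => smoothed (beta / (c + t)) h (m u)).
      apply: (measurableT_comp (f := smoothed (beta / (c + t)) h)).
        exact: continuous_measurable_fun.
      by apply: measurable_funD => //; apply: measurable_funM => //; exact: measurable_funB.
    have bg (a : R) : `|smoothed (beta / (c + t)) h a| <= C by exact: norm_smoothed_le.
    have scvg : cvg_in_prob P (fun k w => (N k)%:R^-1 * \sum_n
        smoothed (beta / (c + t)) h (xv k w n 0 + t * (c + t)^-1 * D k w n 0))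
        (\int[rho]_u smoothed (beta / (c + t)) h (m u)).
      have intm : rho.-integrable setT (EFin \o (fun u => smoothed (beta / (c + t)) h (m u))).
        by apply: bounded_mfun_integrable; split => //; exists C => u; exact: bg.
      have E k w n : smoothed (beta / (c + t)) h (xv k w n 0 + t * (c + t)^-1 * D k w n 0) =
          smoothed (beta / (c + t)) h (m (x k n w, z k n w)).
        by rewrite /m DnE xvE.
      under eq_fun do under eq_fun do under eq_bigr do rewrite E.
      exact: lln_xz ms intm.
    have := smooth_statistic_cvg _ _ _ P Delta t c t0 c0 cE M N x z A v hN gA hA_xzv D2
      (Delta * sigmav ^+ 2) hdd hsv _ _ _ _ _ _ tau0 dh ch' hC hC' lrE scvg.
    congr cvg_in_prob; apply/funext => k; apply/funext => w.
    by congr (_ * _); apply: eq_bigr => n _; rewrite -errE subE addrC subrK.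
Unshelve. all: by end_near. Qed.
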